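(* Let $\alpha\in[1,2]$, let $f\in\widehat{C_0}(\alpha)$ and $g\in S(f)$ have Taylor expansions $f(z)=\sum_{n=0}^{\infty}a_nz^n$ and $g(z)=\sum_{n=0}^{\infty}b_nz^n$ in $\mathbb{D}$, and let $m_0\in\mathbb{N}$ and $w_0\in\mathcal{B}_{m_0}$. Then for each $N\in\mathbb{N}$ the inequality $$|g(w_0(z))|+\sum_{n=N}^{\infty}|b_n|r^n\le |f(0)|+d(f(0),\partial f(\mathbb{D}))$$ holds for $|z|=r<\min\{r_{\alpha,m_0}^{N},1/3\}$, where $r_{\alpha,m_0}^{N}$ is the positive root in $(0,1)$ of the equation $F_{\alpha,m_0}^{N}(x)=0$, with $$F_{\alpha,m_0}^{N}(x):=\sum_{n=N}^{\infty}A_nx^n+f_{\alpha}(x^{m_0})-\frac{1}{2\alpha}.$$ If $r_{\alpha,m_0}^{N}\le 1/3$, then the radius $r_{\alpha,m_0}^{N}$ is sharp for the function $f_\alpha$ (i.e. it cannot be replaced by a larger number, as shown by taking $f=f_\alpha$).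
   Context: $\mathbb{D}=\{z\in\mathbb{C}:|z|<1\}$; $H(\mathbb{D})$ is the set of analytic functions on $\mathbb{D}$; $\mathbb{N}=\{1,2,\dots\}$. $\mathcal{B}$ is the set of $w\in H(\mathbb{D})$ bounded by $1$. For $m\in\mathbb{N}$, $\mathcal{B}_m=\{w\in\mathcal{B}: w(0)=\cdots=w^{(m-1)}(0)=0,\ w^{(m)}(0)\neq 0\}$. $g$ is subordinate to $f$, written $g\prec f$, if there is $w\in\mathcal{B}$ with $w(0)=0$ and $g(z)=f(w(z))$ for $z\in\mathbb{D}$; $S(f)=\{g: g\prec f\}$. $d(f(0),\partial f(\mathbb{D}))$ is the Euclidean distance from $f(0)$ to the boundary of $f(\mathbb{D})$. For $\alpha\in[1,2]$, $\widehat{C_0}(\alpha)$ (concave univalent functions with opening angle $\pi\alpha$ at infinity) is the family of functions $f:\mathbb{D}\to\mathbb{C}$ such that: (a) $f\in H(\mathbb{D})$ is univalent (injective) and $f(1)=\infty$; (b) $f$ maps $\mathbb{D}$ conformally onto a set whose complement with respect to $\mathbb{C}$ is convex; (c) the opening angle of $f(\mathbb{D})$ at $\infty$ is less than or equal to $\pi\alpha$. (For such $f$ the closed set $\mathbb{C}\setminus f(\mathbb{D})$ is convex and unbounded; the opening angle of $f(\mathbb{D})$ at $\infty$ is $2\pi$ minus the opening angle of the recession cone of $\mathbb{C}\setminus f(\mathbb{D})$.) The function $f_\alpha$ and the coefficients $A_n=A_n(\alpha)$ are defined by $$f_{\alpha}(z)=\frac{1}{2\alpha}\left[\left(\frac{1+z}{1-z}\right)^{\alpha}-1\right]=\sum_{n=1}^{\infty}A_nz^n,\quad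 z\in\mathbb{D}.$$ *)

(* Defs.v *)
From Stdlib Require Import Reals.
From Coquelicot Require Import Coquelicot.
Open Scope R_scope.

Definition unit_disc (z : C) : Prop := Cmod z < 1.

(* Functions on the disc are total functions [C -> C]; nothing below depends on
   their values outside [unit_disc]. *)
Definition analytic_on_disc (f : C -> C) : Prop :=
  forall z : C, unit_disc z -> @ex_derive C_AbsRing C_NormedModule f z.

Definition taylor_on_disc (a : nat -> C) (f : C -> C) : Prop :=
  forall z : C, unit_disc z -> @is_pseries C_AbsRing C_NormedModule a z (f z).

Fixpoint C_derive_n (f : C -> C) (n : nat) : C -> C :=
  match n with
  | O => f
  | S k => C_derive (C_derive_n f k)
  end.

Definition class_B (w : C -> C) : Prop :=
  analytic_on_disc w /\ forall z : C, unit_disc z -> Cmod (w z) <= 1.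

Definition class_Bm (m : nat) (w : C -> C) : Prop :=
  class_B w /\
  (forall k : nat, (k < m)%nat -> C_derive_n w k (RtoC 0) = RtoC 0) /\
  C_derive_n w m (RtoC 0) <> RtoC 0.

(* [w] maps the disc into itself by the maximum principle, so [f (w z)] only
   involves values of [f] in the disc. *)
Definition subordinate (g f : C -> C) : Prop :=
  exists w : C -> C,
    class_B w /\ w (RtoC 0) = RtoC 0 /\
    forall z : C, unit_disc z -> g z = f (w z).

Definition image_disc (f : C -> C) (p : C) : Prop :=
  exists z : C, unit_disc z /\ f z = p.

Definition compl (S : C -> Prop) (p : C) : Prop := ~ S p.

Definition boundary (S : C -> Prop) (p : C) : Prop :=
  ~ @locally C_UniformSpace p S /\ ~ @locally C_UniformSpace p (compl S).

Definition dist_to_set (p : C) (S : C -> Prop) : R :=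
  real (Glb_Rbar (fun d : R => exists q : C, S q /\ d = Cmod (p - q)%C)).

Definition convex_set (K : C -> Prop) : Prop :=
  forall (p q : C) (t : R), K p -> K q -> 0 <= t <= 1 ->
    K (RtoC (1 - t) * p + RtoC t * q)%C.

Definition recession_cone (K : C -> Prop) (v : C) : Prop :=
  forall (p : C) (t : R), K p -> 0 <= t -> K (p + RtoC t * v)%C.

(* Length of the longest arc of unit directions contained in the cone: 0 for a
   ray, the opening angle for a sector, PI for a half-plane. *)
Definition cone_angle (K : C -> Prop) : R :=
  real (Lub_Rbar (fun beta : R =>
    0 <= beta <= 2 * PI /\
    exists theta0 : R, forall theta : R,
      theta0 <= theta <= theta0 + beta -> K (cos theta, sin theta))).

Definition opening_angle_at_infinity (Omega : C -> Prop) : R :=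
  2 * PI - cone_angle (recession_cone (compl Omega)).

(* [f(1) = infinity]: the continuous extension of [f] to the boundary point 1,
   with values in the Riemann sphere, is infinite there. *)
Definition infinite_at_1 (f : C -> C) : Prop :=
  filterlim (fun z : C => Cmod (f z))
    (within unit_disc (@locally C_UniformSpace (RtoC 1)))
    (Rbar_locally p_infty).

Definition C0hat (alpha : R) (f : C -> C) : Prop :=
  analytic_on_disc f /\
  (forall z1 z2 : C, unit_disc z1 -> unit_disc z2 -> f z1 = f z2 -> z1 = z2) /\
  infinite_at_1 f /\
  convex_set (compl (image_disc f)) /\
  opening_angle_at_infinity (image_disc f) <= PI * alpha.

(* Principal branch of [w ^ a]; the formula is only correct for [0 < Re w],
   where the principal argument is [atan (Im w / Re w)]. *)
Definition Cpower_principal (w : C) (a : R) : C :=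
  let theta := atan (Im w / Re w) in
  (Rpower (Cmod w) a * cos (a * theta), Rpower (Cmod w) a * sin (a * theta)).

(* [(1 + z) / (1 - z)] has positive real part for [z] in the disc. *)
Definition f_alpha (alpha : R) (z : C) : C :=
  (RtoC (1 / (2 * alpha)) *
   (Cpower_principal ((RtoC 1 + z) / (RtoC 1 - z)) alpha - RtoC 1))%C.

Definition tail_terms (c : nat -> R) (N : nat) (r : R) (k : nat) : R :=
  c (N + k)%nat * r ^ (N + k).

Definition F (alpha : R) (A : nat -> R) (m0 N : nat) (x : R) : C :=
  (RtoC (Series (tail_terms A N x)) + f_alpha alpha (RtoC (x ^ m0))
   - RtoC (1 / (2 * alpha)))%C.

Definition bohr_lhs (g : C -> C) (b : nat -> C) (w0 : C -> C) (N : nat) (z : C)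
  : R :=
  Cmod (g (w0 z)) + Series (tail_terms (fun n => Cmod (b n)) N (Cmod z)).

Definition bohr_rhs (f : C -> C) : R :=
  Cmod (f (RtoC 0)) + dist_to_set (f (RtoC 0)) (boundary (image_disc f)).

(* Main.v *)
(** Let p be omitted by f. Convexity of the complement, together with the opening angle, makes the
    closed sector p + K, with K an arc of directions of length (2 - al) pi, omitted by f and hence by
    every g subordinate to f. Therefore g - p = (g(0) - p) exp (al lam), where lam(0) = 0 and Im lam
    stays in an interval of length pi around some psi. Among all such powers the n-th coefficient is
    largest, in modulus, for ((1 + z) / (1 - z)) ^ al: as al >= 1, replacing one of the al
    factors exp lam by a Herglotz kernel k = (1 - xi x z) / (1 - x z), |x| = 1, stays in the
    class by convexity of the strip, and exp (al lam) is an average of such replacements. Hence near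
    a maximiser, singled out by a small multiple of the squared first coefficient, the representing
    measure concentrates at one point, and the extremal function is k ^ al, whose coefficients
    satisfy |c_n(xi)| <= c_n(-1) by an elementary trigonometric estimate. This gives
    |b_n| <= 2 al A_n |f(0) - p|. Summation and the Schwarz lemma |w0 z| <= r ^ m0 bound the left-hand
    side by |f(0)| + |f(0) - p| as soon as F r <= 0, and p may approach the boundary of the image. *)

Require Import Defs.
From Stdlib Require Import Reals ZArith Lra Lia ClassicalEpsilon Ranalysis5.
From Coquelicot Require Import Coquelicot.
Open Scope R_scope.

(** * Complex differentiability *)

(** The coefficient problem lives on a nonlinear class: for al > 1 the values of exp (al lam) fill a
    sector that is not convex, so Herglotz' formula does not apply to these functions directly. It
    is applied to one factor q = exp lam, with exp ((al - 1) lam) frozen. The functional Re (e^(i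
    theta) b_n) + eps |b_1|^2 is affine in that factor apart from the square, and the square leaves
    a gap of eps (|u|^2 - |q_1|^2) below the supremum, where |u| is the largest possible |q_1|. No
    maximiser has to exist: an almost maximal function has |q_1| almost |u|, a quantitative estimate
    then places its first n coefficients near those of one kernel, and the coefficients of the power
    depend on them in a Lipschitz way. The inequality |c_n(xi)| <= c_n(-1) cannot be had term by
    term: after removal of a first-order part, terms of odd index may exceed their value at -1, and
    each is paid for by the even term before it. For al = 2 the sector degenerates to a ray, whose
    existence is a topological fact about simply connected images with convex complement. *)

Definition cder (f : C -> C) (z l : C) : Prop :=
  forall eps, 0 < eps -> exists delta, 0 < delta /\
    forall h, Cmod h < delta -> Cmod (f (z + h) - f z - l * h)%C <= eps * Cmod h.

(** Balls of the uniform structure on [C] are squares in the two coordinates; the factor 2 is a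
    crude bound for sqrt 2. *)
Lemma ball_Cmod (x y : C) (e : R) : @ball C_UniformSpace x e y -> Cmod (y - x)%C <= 2 * e.
Proof.
  intros Hb.
  assert (A : Rabs (fst y - fst x) < e /\ Rabs (snd y - snd x) < e) by exact Hb.
  destruct A as [H1 H2].
  eapply Rle_trans; [apply Cmod_2Rmax|]. simpl.
  assert (sqrt 2 <= 2) by (rewrite <- (sqrt_square 2) at 2 by lra; apply sqrt_le_1; lra).
  assert (0 <= sqrt 2) by apply sqrt_pos.
  assert (Hm : Rmax (Rabs (fst y + - fst x)) (Rabs (snd y + - snd x)) <= e)
    by (apply Rmax_lub; unfold Rminus in *; lra).
  apply Rmult_le_compat; [lra| |lra|lra].
  eapply Rle_trans; [|apply Rmax_l]; apply Rabs_pos.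
Qed.

Lemma Cmod_ball (x y : C) (e : R) : Cmod (y - x)%C < e -> @ball C_UniformSpace x e y.
Proof.
  intros H. pose proof (Rmax_Cmod (y - x)%C) as Hm.
  assert (A : Rabs (fst y - fst x) < e /\ Rabs (snd y - snd x) < e).
  { simpl in Hm. unfold Rminus.
    split; (eapply Rle_lt_trans; [|exact H]); (eapply Rle_trans; [|exact Hm]);
      [apply Rmax_l | apply Rmax_r]. }
  exact A.
Qed.

Lemma locally_Cmod (z : C) (P : C -> Prop) :
  @locally C_UniformSpace z P <->
  exists d, 0 < d /\ forall w, Cmod (w - z)%C < d -> P w.
Proof.
  split.
  - intros [d Hd]. exists d. split; [apply cond_pos|].
    intros w Hw. apply Hd, Cmod_ball, Hw.
  - intros (d & Hd & H). assert (Hd4 : 0 < d / 4) by lra.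
    exists (mkposreal _ Hd4). intros w Hw. apply H.
    apply ball_Cmod in Hw. simpl in Hw. lra.
Qed.

(** Bridge between the division-free increment form used throughout and the derivative of the
    definitions. *)
Lemma cder_is_derive (f : C -> C) (z l : C) :
  cder f z l <-> @is_derive C_AbsRing C_NormedModule f z l.
Proof.
  split.
  - intros H. split; [apply is_linear_scal_l|].
    intros x Hx.
    apply (@is_filter_lim_locally_unique C_AbsRing (AbsRing_NormedModule C_AbsRing)) in Hx.
    subst x.
    intros eps. destruct (H eps (cond_pos eps)) as (d & Hd & Hh).
    apply locally_C, locally_Cmod. exists d. split; auto.
    intros w Hw. specialize (Hh _ Hw).
    change (Cmod (f w - f z - (w - z) * l)%C <= eps * Cmod (w - z)%C).
    replace (z + (w - z))%C with w in Hh by ring.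
    replace ((w - z) * l)%C with (l * (w - z))%C by ring. exact Hh.
  - intros [_ H] eps Heps.
    specialize (H z (fun P HP => HP) (mkposreal _ Heps)).
    apply locally_C, locally_Cmod in H.
    destruct H as (d & Hd & H). exists d; split; auto. intros h Hh.
    specialize (H (z + h)%C).
    change (Cmod (z + h - z)%C < d ->
            Cmod (f (z + h) - f z - (z + h - z) * l)%C <= eps * Cmod (z + h - z)%C) in H.
    replace (z + h - z)%C with h in H by ring.
    replace (l * h)%C with (h * l)%C by ring. auto.
Qed.

Lemma cder_ext (f g : C -> C) (z l : C) (d : R) : 0 < d ->
  (forall w, Cmod (w - z)%C < d -> f w = g w) -> cder f z l -> cder g z l.
Proof.
  intros Hd E H eps He. destruct (H eps He) as (d' & Hd' & Hh).
  exists (Rmin d d'). split; [apply Rmin_pos; auto|]. intros h Hm.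
  rewrite <- !E.
  - apply Hh. eapply Rlt_le_trans; [exact Hm|apply Rmin_r].
  - replace (z - z)%C with (RtoC 0) by ring. rewrite Cmod_0; auto.
  - replace (z + h - z)%C with h by ring. eapply Rlt_le_trans; [exact Hm|apply Rmin_l].
Qed.

Lemma cder_const (c z : C) : cder (fun _ => c) z (RtoC 0).
Proof.
  intros eps He. exists 1. split; [lra|]. intros h _.
  replace (c - c - 0 * h)%C with (RtoC 0) by ring. rewrite Cmod_0.
  apply Rmult_le_pos; [lra|apply Cmod_ge_0].
Qed.

Lemma cder_id (z : C) : cder (fun w => w) z (RtoC 1).
Proof.
  intros eps He. exists 1. split; [lra|]. intros h _.
  replace (z + h - z - 1 * h)%C with (RtoC 0) by ring. rewrite Cmod_0.
  apply Rmult_le_pos; [lra|apply Cmod_ge_0].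
Qed.

Lemma cder_plus f g z l m : cder f z l -> cder g z m ->
  cder (fun w => f w + g w)%C z (l + m)%C.
Proof.
  intros Hf Hg eps He.
  destruct (Hf (eps / 2)) as (d1 & Hd1 & H1); [lra|].
  destruct (Hg (eps / 2)) as (d2 & Hd2 & H2); [lra|].
  exists (Rmin d1 d2). split; [apply Rmin_pos; auto|]. intros h Hh.
  assert (A : Cmod h < d1) by (eapply Rlt_le_trans; [exact Hh|apply Rmin_l]).
  assert (B : Cmod h < d2) by (eapply Rlt_le_trans; [exact Hh|apply Rmin_r]).
  specialize (H1 h A). specialize (H2 h B).
  replace (f (z + h) + g (z + h) - (f z + g z) - (l + m) * h)%C with
    ((f (z + h) - f z - l * h) + (g (z + h) - g z - m * h))%C by ring.
  eapply Rle_trans; [apply Cmod_triangle|]. lra.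
Qed.

Lemma cder_bound f z l : cder f z l -> exists d, 0 < d /\ forall h, Cmod h < d ->
  Cmod (f (z + h) - f z)%C <= (Cmod l + 1) * Cmod h.
Proof.
  intros H. destruct (H 1) as (d & Hd & Hh); [lra|]. exists d; split; auto.
  intros h Hm. specialize (Hh h Hm).
  replace (f (z + h) - f z)%C with ((f (z + h) - f z - l * h) + l * h)%C by ring.
  eapply Rle_trans; [apply Cmod_triangle|]. rewrite Cmod_mult. lra.
Qed.

Lemma cder_comp f g z l m : cder g z m -> cder f (g z) l ->
  cder (fun w => f (g w)) z (l * m)%C.
Proof.
  intros Hg Hf eps He.
  pose proof (Cmod_ge_0 l) as Pl. pose proof (Cmod_ge_0 m) as Pm.
  destruct (cder_bound _ _ _ Hg) as (d0 & Hd0 & H0).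
  assert (E1 : 0 < eps / (2 * (Cmod m + 1))) by (apply Rdiv_lt_0_compat; lra).
  assert (E2 : 0 < eps / (2 * (Cmod l + 1))) by (apply Rdiv_lt_0_compat; lra).
  destruct (Hf _ E1) as (d1 & Hd1 & H1).
  destruct (Hg _ E2) as (d2 & Hd2 & H2).
  assert (D1 : 0 < d1 / (Cmod m + 1)) by (apply Rdiv_lt_0_compat; lra).
  exists (Rmin d0 (Rmin d2 (d1 / (Cmod m + 1)))).
  split; [repeat apply Rmin_pos; auto|]. intros h Hh.
  assert (A : Cmod h < d0) by (eapply Rlt_le_trans; [exact Hh|apply Rmin_l]).
  assert (B : Cmod h < d2) by (eapply Rlt_le_trans; [exact Hh|
    eapply Rle_trans; [apply Rmin_r|apply Rmin_l]]).
  assert (D : Cmod h < d1 / (Cmod m + 1)) by (eapply Rlt_le_trans; [exact Hh|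
    eapply Rle_trans; [apply Rmin_r|apply Rmin_r]]).
  specialize (H0 h A). specialize (H2 h B).
  set (k := (g (z + h) - g z)%C) in *.
  assert (Hk : Cmod k < d1).
  { eapply Rle_lt_trans; [exact H0|].
    apply Rmult_lt_compat_l with (r := Cmod m + 1) in D; [|lra].
    replace ((Cmod m + 1) * (d1 / (Cmod m + 1))) with d1 in D by (field; lra). lra. }
  specialize (H1 k Hk).
  replace (g z + k)%C with (g (z + h)%C) in H1 by (unfold k; ring).
  replace (f (g (z + h)) - f (g z) - l * m * h)%C with
    ((f (g (z + h)) - f (g z) - l * k) + l * (k - m * h))%C by ring.
  eapply Rle_trans; [apply Cmod_triangle|]. rewrite Cmod_mult.
  pose proof (Cmod_ge_0 h) as Ph.
  assert (X1 : eps / (2 * (Cmod m + 1)) * Cmod k <= eps / 2 * Cmod h).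
  { apply Rle_trans with (eps / (2 * (Cmod m + 1)) * ((Cmod m + 1) * Cmod h)).
    - apply Rmult_le_compat_l; lra.
    - apply Req_le. field. lra. }
  assert (X2 : Cmod l * Cmod (k - m * h)%C <= eps / 2 * Cmod h).
  { apply Rle_trans with ((Cmod l + 1) * (eps / (2 * (Cmod l + 1)) * Cmod h)).
    - apply Rmult_le_compat; try lra. apply Cmod_ge_0.
    - apply Req_le. field. lra. }
  lra.
Qed.

Lemma cder_sq (z : C) : cder (fun w => w * w)%C z (z + z)%C.
Proof.
  intros eps He. exists eps. split; auto. intros h Hh.
  replace ((z + h) * (z + h) - z * z - (z + z) * h)%C with (h * h)%C by ring.
  rewrite Cmod_mult. apply Rmult_le_compat_r; [apply Cmod_ge_0|lra].
Qed.

Lemma cder_cmul (c z : C) : cder (fun w => c * w)%C z c.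
Proof.
  intros eps He. exists 1. split; [lra|]. intros h _.
  replace (c * (z + h) - c * z - c * h)%C with (RtoC 0) by ring. rewrite Cmod_0.
  apply Rmult_le_pos; [lra|apply Cmod_ge_0].
Qed.

(* Polarisation: 4 f g = (f + g)^2 - (f - g)^2. *)
Lemma cder_mult f g z l m : cder f z l -> cder g z m ->
  cder (fun w => f w * g w)%C z (l * g z + f z * m)%C.
Proof.
  intros Hf Hg.
  assert (Hn : cder (fun w => - (1) * g w)%C z (- (1) * m)%C)
    by (apply (cder_comp (fun w => - (1) * w)%C g z); auto; apply cder_cmul).
  pose proof (cder_comp _ _ z _ _ (cder_plus _ _ _ _ _ Hf Hg) (cder_sq _)) as A.
  pose proof (cder_comp _ _ z _ _ (cder_plus _ _ _ _ _ Hf Hn) (cder_sq _)) as B.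
  pose proof (cder_comp _ _ z _ _ A (cder_cmul (/ RtoC 4) _)) as A'.
  pose proof (cder_comp _ _ z _ _ B (cder_cmul (- / RtoC 4) _)) as B'.
  pose proof (cder_plus _ _ _ _ _ A' B') as D. cbv beta in D.
  assert (N4 : RtoC 4 <> RtoC 0) by (intros E; apply RtoC_inj in E; lra).
  replace (l * g z + f z * m)%C with
    (/ 4 * ((f z + g z + (f z + g z)) * (l + m)) +
       - / 4 * ((f z + - (1) * g z + (f z + - (1) * g z)) * (l + - (1) * m)))%C
    by (field; auto).
  apply (cder_ext _ _ z _ 1 Rlt_0_1) with (2 := D).
  intros w _. field; auto.
Qed.

Lemma cder_inv (z : C) : z <> RtoC 0 -> cder (fun w => / w)%C z (- / (z * z))%C.
Proof.
  intros Hz eps He.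
  assert (Pz : 0 < Cmod z) by (apply Cmod_gt_0; auto).
  assert (P3 : 0 < Cmod z * Cmod z * Cmod z) by (repeat apply Rmult_lt_0_compat; auto).
  (* The error is h^2 / (z^2 (z + h)). The first bound keeps |z + h| >= |z| / 2, and the second then
     absorbs the factor 2 / |z|^3. *)
  exists (Rmin (Cmod z / 2) (eps * (Cmod z * Cmod z * Cmod z) / 2)).
  split; [apply Rmin_pos; [lra|]|].
  { apply Rmult_lt_0_compat; [apply Rmult_lt_0_compat; auto|lra]. }
  intros h Hh.
  assert (A : Cmod h < Cmod z / 2) by (eapply Rlt_le_trans; [exact Hh|apply Rmin_l]).
  assert (B : Cmod h < eps * (Cmod z * Cmod z * Cmod z) / 2)
    by (eapply Rlt_le_trans; [exact Hh|apply Rmin_r]).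
  assert (Hb : Cmod z / 2 <= Cmod (z + h)%C).
  { pose proof (Cmod_triangle (z + h) (- h)) as T.
    replace (z + h + - h)%C with z in T by ring. rewrite Cmod_opp in T. lra. }
  assert (Hzh : (z + h)%C <> RtoC 0).
  { intros E. rewrite E, Cmod_0 in Hb. lra. }
  replace (/ (z + h) - / z - - / (z * z) * h)%C with (h * h * / (z * z * (z + h)))%C
    by (field; auto).
  rewrite !Cmod_mult, Cmod_inv, !Cmod_mult
    by (repeat (apply Cmult_neq_0; auto)).
  replace (eps * Cmod h) with (Cmod h * eps) by ring.
  rewrite Rmult_assoc. apply Rmult_le_compat_l; [apply Cmod_ge_0|].
  assert (Q : 0 < Cmod z * Cmod z * Cmod (z + h)%C)
    by (repeat apply Rmult_lt_0_compat; lra).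
  apply Rmult_le_reg_r with (1 := Q). rewrite Rmult_assoc, Rinv_l, Rmult_1_r by lra.
  apply Rle_trans with (eps * (Cmod z * Cmod z * Cmod z) / 2); [lra|].
  unfold Rdiv. rewrite Rmult_assoc. apply Rmult_le_compat_l; [lra|].
  rewrite (Rmult_assoc (_ * _)). apply Rmult_le_compat_l; [|lra].
  apply Rmult_le_pos; lra.
Qed.

Lemma Cmult_zero (x y : C) : (x * y)%C = RtoC 0 -> x = RtoC 0 \/ y = RtoC 0.
Proof.
  intros E. destruct (classic (x = RtoC 0)) as [X|X]; auto.
  destruct (classic (y = RtoC 0)) as [Y|Y]; auto.
  exfalso. apply (Cmult_neq_0 x y X Y E).
Qed.

Lemma RtoC_neq_0 (x : R) : x <> 0 -> RtoC x <> RtoC 0.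
Proof. intros A E. apply A. apply RtoC_inj, E. Qed.

(** * Functions holomorphic on the disc *)

Definition holo (f : C -> C) : Prop := forall z, unit_disc z -> exists l, cder f z l.

Lemma holo_analytic f : holo f <-> analytic_on_disc f.
Proof.
  split; intros A z Hz; destruct (A z Hz) as [l Hl]; exists l; apply cder_is_derive, Hl.
Qed.

Lemma unit_disc_open z : unit_disc z ->
  exists d, 0 < d /\ forall w, Cmod (w - z)%C < d -> unit_disc w.
Proof.
  unfold unit_disc. intros Hz. exists (1 - Cmod z). split; [lra|]. intros w Hw.
  pose proof (Cmod_triangle (w - z) z) as T. replace (w - z + z)%C with w in T by ring. lra.
Qed.

Lemma holo_ext f g : (forall z, unit_disc z -> f z = g z) -> holo f -> holo g.
Proof.
  intros E Hf z Hz. destruct (Hf z Hz) as [l Hl]. exists l.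
  destruct (unit_disc_open z Hz) as (d & Hd & Ho).
  apply (cder_ext f g z l d); auto.
Qed.

Lemma holo_const c : holo (fun _ => c).
Proof. intros z _. exists (RtoC 0). apply cder_const. Qed.

Lemma holo_id : holo (fun w => w).
Proof. intros z _. exists (RtoC 1). apply cder_id. Qed.

Lemma holo_plus f g : holo f -> holo g -> holo (fun w => f w + g w)%C.
Proof.
  intros Hf Hg z Hz. destruct (Hf z Hz) as [l Hl], (Hg z Hz) as [m Hm].
  exists (l + m)%C. apply cder_plus; auto.
Qed.

Lemma holo_mult f g : holo f -> holo g -> holo (fun w => f w * g w)%C.
Proof.
  intros Hf Hg z Hz. destruct (Hf z Hz) as [l Hl], (Hg z Hz) as [m Hm].
  exists (l * g z + f z * m)%C. apply cder_mult; auto.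
Qed.

Lemma holo_cmul c f : holo f -> holo (fun w => c * f w)%C.
Proof. intros Hf. apply holo_mult; auto. apply holo_const. Qed.

Lemma holo_minus f g : holo f -> holo g -> holo (fun w => f w - g w)%C.
Proof.
  intros Hf Hg. apply holo_ext with (fun w => f w + (- (1)) * g w)%C.
  - intros; ring.
  - apply holo_plus; auto. apply holo_cmul; auto.
Qed.

Lemma holo_inv f : holo f -> (forall z, unit_disc z -> f z <> RtoC 0) -> holo (fun w => / f w)%C.
Proof.
  intros Hf Hn z Hz. destruct (Hf z Hz) as [l Hl]. eexists.
  apply (cder_comp (fun w => / w)%C f z); eauto. apply cder_inv; auto.
Qed.

Lemma holo_comp f g : holo f -> holo g -> (forall z, unit_disc z -> unit_disc (g z)) ->
  holo (fun w => f (g w)).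
Proof.
  intros Hf Hg Hd z Hz. destruct (Hg z Hz) as [m Hm].
  destruct (Hf (g z) (Hd z Hz)) as [l Hl]. exists (l * m)%C. apply cder_comp; auto.
Qed.

Lemma holo_pow f n : holo f -> holo (fun w => f w ^ n)%C.
Proof.
  intros Hf. induction n; [exact (holo_const (RtoC 1))|].
  apply holo_ext with (fun w => f w * f w ^ n)%C; [intros; now rewrite Cpow_S|].
  apply holo_mult; auto.
Qed.

(** * Integrals of complex functions of a real variable *)

Definition pcont (f : R -> C) (t : R) : Prop :=
  continuous (fun s => Re (f s)) t /\ continuous (fun s => Im (f s)) t.

Definition CInt (f : R -> C) (a b : R) : C :=
  (RInt (fun t => Re (f t)) a b, RInt (fun t => Im (f t)) a b).

Definition contin (f : R -> C) (a b : R) : Prop :=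
  forall t, a <= t <= b -> pcont f t.

Lemma pcont_intro (f : R -> C) (t : R) :
  (forall eps, 0 < eps -> exists d, 0 < d /\
     forall s, Rabs (s - t) < d -> Cmod (f s - f t)%C <= eps) -> pcont f t.
Proof.
  intros A. split; apply continuity_pt_filterlim; intros eps He;
    destruct (A (eps / 2)) as (d & Hd & B); try lra;
    exists d; (split; [exact Hd|]); intros s [_ Hs]; simpl in *; unfold R_dist in *;
    specialize (B s Hs); pose proof (Rmax_Cmod (f s - f t)%C) as M; simpl in M.
  - pose proof (Rmax_l (Rabs (fst (f s) + - fst (f t))) (Rabs (snd (f s) + - snd (f t)))).
    unfold Re, Rminus in *. lra.
  - pose proof (Rmax_r (Rabs (fst (f s) + - fst (f t))) (Rabs (snd (f s) + - snd (f t)))).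
    unfold Im, Rminus in *. lra.
Qed.

Lemma pcont_elim (f : R -> C) (t : R) : pcont f t ->
  forall eps, 0 < eps -> exists d, 0 < d /\
     forall s, Rabs (s - t) < d -> Cmod (f s - f t)%C <= eps.
Proof.
  intros [A B] eps He.
  apply continuity_pt_filterlim in A. apply continuity_pt_filterlim in B.
  destruct (A (eps / 2)) as (d1 & Hd1 & H1); [lra|].
  destruct (B (eps / 2)) as (d2 & Hd2 & H2); [lra|].
  exists (Rmin d1 d2). split; [apply Rmin_pos; auto|]. intros s Hs.
  destruct (Req_dec s t) as [->|Hn].
  { replace (f t - f t)%C with (RtoC 0) by ring. rewrite Cmod_0. lra. }
  assert (D1 : Rabs (s - t) < d1) by (eapply Rlt_le_trans; [exact Hs|apply Rmin_l]).
  assert (D2 : Rabs (s - t) < d2) by (eapply Rlt_le_trans; [exact Hs|apply Rmin_r]).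
  assert (E1 : Rabs (Re (f s) - Re (f t)) < eps / 2)
    by (apply H1; split; [split; [exact I|auto]|exact D1]).
  assert (E2 : Rabs (Im (f s) - Im (f t)) < eps / 2)
    by (apply H2; split; [split; [exact I|auto]|exact D2]).
  eapply Rle_trans; [apply Cmod_2Rmax|]. simpl.
  assert (sqrt 2 <= 2) by (rewrite <- (sqrt_square 2) at 2 by lra; apply sqrt_le_1; lra).
  assert (0 <= sqrt 2) by apply sqrt_pos.
  assert (Hm : Rmax (Rabs (fst (f s) + - fst (f t))) (Rabs (snd (f s) + - snd (f t))) <= eps / 2)
    by (apply Rmax_lub; unfold Re, Im, Rminus in *; lra).
  apply Rle_trans with (2 * (eps / 2)); [|lra].
  apply Rmult_le_compat; [lra| |lra|lra].
  eapply Rle_trans; [|apply Rmax_l]; apply Rabs_pos.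
Qed.

Lemma pcont_comp (F : C -> C) (g : R -> C) (t : R) (l : C) :
  cder F (g t) l -> pcont g t -> pcont (fun s => F (g s)) t.
Proof.
  intros HF Hg. apply pcont_intro. intros eps He.
  destruct (cder_bound _ _ _ HF) as (d & Hd & B).
  pose proof (Cmod_ge_0 l).
  assert (Q : 0 < Rmin (d / 2) (eps / (Cmod l + 1)))
    by (apply Rmin_pos; [lra|apply Rdiv_lt_0_compat; lra]).
  destruct (pcont_elim _ _ Hg _ Q) as (d' & Hd' & B').
  exists d'. split; auto. intros s Hs. specialize (B' s Hs).
  assert (X : Cmod (g s - g t)%C <= d / 2) by (eapply Rle_trans; [exact B'|apply Rmin_l]).
  assert (Y : Cmod (g s - g t)%C <= eps / (Cmod l + 1))
    by (eapply Rle_trans; [exact B'|apply Rmin_r]).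
  specialize (B (g s - g t)%C). replace (g t + (g s - g t))%C with (g s) in B by ring.
  eapply Rle_trans; [apply B; lra|].
  apply Rle_trans with ((Cmod l + 1) * (eps / (Cmod l + 1))).
  - apply Rmult_le_compat_l; lra.
  - apply Req_le. field. lra.
Qed.

Lemma pcont_ext f g t : (forall s, f s = g s) -> pcont f t -> pcont g t.
Proof.
  intros E [A B]; split; [revert A|revert B]; apply continuous_ext; intros s; now rewrite E.
Qed.

Lemma pcont_const c t : pcont (fun _ => c) t.
Proof. split; apply continuous_const. Qed.

Lemma pcont_plus f g t : pcont f t -> pcont g t -> pcont (fun s => f s + g s)%C t.
Proof.
  intros [A B] [A' B']; split; simpl.
  - apply (continuous_plus (fun s => Re (f s)) (fun s => Re (g s))); auto.
  - apply (continuous_plus (fun s => Im (f s)) (fun s => Im (g s))); auto.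
Qed.

Lemma pcont_mult f g t : pcont f t -> pcont g t -> pcont (fun s => f s * g s)%C t.
Proof.
  intros [A B] [A' B']; split; simpl.
  - apply (continuous_minus (fun s => Re (f s) * Re (g s)) (fun s => Im (f s) * Im (g s)));
      apply (continuous_mult (K := R_AbsRing)); auto.
  - apply (continuous_plus (fun s => Re (f s) * Im (g s)) (fun s => Im (f s) * Re (g s)));
      apply (continuous_mult (K := R_AbsRing)); auto.
Qed.

Lemma pcont_minus f g t : pcont f t -> pcont g t -> pcont (fun s => f s - g s)%C t.
Proof.
  intros A B. apply pcont_ext with (fun s => f s + (- (1)) * g s)%C; [intros; ring|].
  apply pcont_plus; auto. apply pcont_mult; auto. apply pcont_const.
Qed.

Lemma pcont_conj f t : pcont f t -> pcont (fun s => Cconj (f s)) t.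
Proof.
  intros [A B]; split; auto. simpl.
  apply (continuous_opp (fun s => Im (f s))); auto.
Qed.

Lemma contin_ex (f : R -> C) a b : a <= b -> contin f a b ->
  ex_RInt (fun t => Re (f t)) a b /\ ex_RInt (fun t => Im (f t)) a b.
Proof.
  intros Hab A; split; apply (ex_RInt_continuous (V := R_CompleteNormedModule));
    rewrite Rmin_left, Rmax_right by lra; intros t Ht; apply A; lra.
Qed.

Lemma CInt_ext f g a b : a <= b -> (forall t, a <= t <= b -> f t = g t) ->
  CInt f a b = CInt g a b.
Proof.
  intros Hab E. unfold CInt. f_equal; apply RInt_ext; rewrite Rmin_left, Rmax_right by lra;
    intros t Ht; rewrite E; auto; lra.
Qed.

Lemma CInt_plus f g a b : a <= b -> contin f a b -> contin g a b ->
  CInt (fun t => f t + g t)%C a b = (CInt f a b + CInt g a b)%C.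
Proof.
  intros Hab A B. destruct (contin_ex f a b Hab A), (contin_ex g a b Hab B).
  unfold CInt. apply injective_projections; simpl.
  - apply (RInt_plus (V := R_CompleteNormedModule) (fun t => Re (f t)) (fun t => Re (g t))); auto.
  - apply (RInt_plus (V := R_CompleteNormedModule) (fun t => Im (f t)) (fun t => Im (g t))); auto.
Qed.

Lemma RInt_Rscal (f : R -> R) a b k : ex_RInt f a b ->
  RInt (fun t => k * f t) a b = k * RInt f a b.
Proof. intros A. apply (RInt_scal (V := R_CompleteNormedModule) f); auto. Qed.

Lemma ex_RInt_Rscal (f : R -> R) a b k : ex_RInt f a b -> ex_RInt (fun t => k * f t) a b.
Proof. intros A. apply (ex_RInt_scal (V := R_NormedModule) f); auto. Qed.

Lemma CInt_scal c f a b : a <= b -> contin f a b ->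
  CInt (fun t => c * f t)%C a b = (c * CInt f a b)%C.
Proof.
  intros Hab A. destruct (contin_ex f a b Hab A) as [X Y].
  unfold CInt. apply injective_projections; simpl.
  - rewrite <- (RInt_Rscal _ a b (fst c)), <- (RInt_Rscal _ a b (snd c)) by auto.
    apply (RInt_minus (V := R_CompleteNormedModule)
      (fun t => fst c * Re (f t)) (fun t => snd c * Im (f t))); apply ex_RInt_Rscal; auto.
  - rewrite <- (RInt_Rscal _ a b (fst c)), <- (RInt_Rscal _ a b (snd c)) by auto.
    apply (RInt_plus (V := R_CompleteNormedModule)
      (fun t => fst c * Im (f t)) (fun t => snd c * Re (f t))); apply ex_RInt_Rscal; auto.
Qed.

Lemma contin_scal c f a b : contin f a b -> contin (fun t => c * f t)%C a b.
Proof. intros A t Ht. apply pcont_mult; auto. apply pcont_const. Qed.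

Lemma CInt_minus f g a b : a <= b -> contin f a b -> contin g a b ->
  CInt (fun t => f t - g t)%C a b = (CInt f a b - CInt g a b)%C.
Proof.
  intros Hab A B. rewrite CInt_ext with (g := fun t => (f t + (- (1)) * g t)%C); auto.
  - rewrite CInt_plus, CInt_scal; auto; [ring|]. apply contin_scal; auto.
  - intros; ring.
Qed.

Lemma CInt_const c a b : CInt (fun _ => c) a b = (RtoC (b - a) * c)%C.
Proof.
  unfold CInt. rewrite !RInt_const. apply injective_projections; simpl;
    unfold scal; simpl; unfold mult; simpl; unfold Re, Im; ring.
Qed.

Lemma CInt_Chasles f a b c : a <= b -> b <= c -> contin f a c ->
  (CInt f a b + CInt f b c)%C = CInt f a c.
Proof.
  intros Hab Hbc A.
  destruct (contin_ex f a b Hab) as [X1 Y1]; [intros t Ht; apply A; lra|].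
  destruct (contin_ex f b c Hbc) as [X2 Y2]; [intros t Ht; apply A; lra|].
  unfold CInt. apply injective_projections; simpl.
  - apply (RInt_Chasles (V := R_CompleteNormedModule)); auto.
  - apply (RInt_Chasles (V := R_CompleteNormedModule)); auto.
Qed.

Lemma Cmod_sqr (z : C) : Cmod z * Cmod z = Re z * Re z + Im z * Im z.
Proof.
  unfold Cmod. rewrite sqrt_sqrt; [unfold Re, Im; ring|].
  apply Rplus_le_le_0_compat; apply pow2_ge_0.
Qed.

Lemma Re_le_Cmod z : Re z <= Cmod z.
Proof. pose proof (re_le_Cmod z). pose proof (Rle_abs (Re z)). lra. Qed.

(** Multiplication by the conjugate of the integral J turns J into the real number |J|^2, so that
    only a real part has to be bounded. *)
Lemma CInt_bound f a b M : a <= b -> contin f a b ->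
  (forall t, a <= t <= b -> Cmod (f t) <= M) -> Cmod (CInt f a b) <= M * (b - a).
Proof.
  intros Hab A B. set (J := CInt f a b).
  destruct (Req_dec (Cmod J) 0) as [E|E].
  { rewrite E. apply Rmult_le_pos; [|lra].
    apply Rle_trans with (Cmod (f a)); [apply Cmod_ge_0|apply B; lra]. }
  assert (P : 0 < Cmod J) by (pose proof (Cmod_ge_0 J); lra).
  apply Rmult_le_reg_l with (1 := P).
  pose proof (CInt_scal (Cconj J) f a b Hab A) as S. fold J in S.
  destruct (contin_ex _ a b Hab (contin_scal (Cconj J) f a b A)) as [X _].
  assert (Q : Re (CInt (fun t => Cconj J * f t)%C a b) <= Cmod J * M * (b - a)).
  { change (RInt (fun t => Re (Cconj J * f t)) a b <= Cmod J * M * (b - a)).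
    apply Rle_trans with (RInt (fun _ => Cmod J * M) a b).
    - apply RInt_le; auto; [apply ex_RInt_const|]. intros t Ht.
      eapply Rle_trans; [apply Re_le_Cmod|]. rewrite Cmod_mult, Cmod_conj.
      apply Rmult_le_compat_l; [lra|apply B; lra].
    - rewrite RInt_const. unfold scal; simpl; unfold mult; simpl. lra. }
  rewrite S in Q. rewrite Cmod_sqr.
  replace (Re (Cconj J * J)%C) with (Re J * Re J + Im J * Im J) in Q
    by (unfold Re, Im; simpl; ring).
  lra.
Qed.

Definition pder (g : R -> C) (t : R) (l : C) : Prop :=
  is_derive (fun s => Re (g s)) t (Re l) /\ is_derive (fun s => Im (g s)) t (Im l).

Lemma pder_pcont g t l : pder g t l -> pcont g t.
Proof.
  intros [A B]; split; apply (ex_derive_continuous (V := R_NormedModule)); eexists; eauto.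
Qed.

Lemma CInt_pder (g g' : R -> C) a b : a <= b ->
  (forall t, a <= t <= b -> pder g t (g' t)) -> contin g' a b ->
  CInt g' a b = (g b - g a)%C.
Proof.
  intros Hab D A. unfold CInt. apply injective_projections; simpl.
  - apply is_RInt_unique.
    apply (is_RInt_derive (V := R_CompleteNormedModule) (fun t => Re (g t)));
      rewrite Rmin_left, Rmax_right by lra; intros t Ht; [apply D; auto|apply A; auto].
  - apply is_RInt_unique.
    apply (is_RInt_derive (V := R_CompleteNormedModule) (fun t => Im (g t)));
      rewrite Rmin_left, Rmax_right by lra; intros t Ht; [apply D; auto|apply A; auto].
Qed.

(* [g'] stands for the velocity of the path [g]. *)
Definition path_integral (G : C -> C) (g g' : R -> C) (a b : R) : C :=
  CInt (fun t => G (g t) * g' t)%C a b.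

(** With A = a1 - i a2 and B = b1 - i b2 this is the real part of A z + B z^2 / 2 along z = x + i y;
    another choice of the constants gives the imaginary part. *)
Lemma is_derive_quadratic (x y : R -> R) (t dx dy a1 a2 b1 b2 : R) :
  is_derive x t dx -> is_derive y t dy ->
  is_derive (fun s => a1 * x s + a2 * y s +
     (b1 * (x s * x s - y s * y s) + 2 * (b2 * (x s * y s))) / 2) t
    (a1 * dx + a2 * dy + b1 * (x t * dx - y t * dy) + b2 * (x t * dy + dx * y t)).
Proof.
  intros X Y.
  assert (EX : ex_derive x t) by (eexists; exact X).
  assert (EY : ex_derive y t) by (eexists; exact Y).
  auto_derive; [repeat split; auto|].
  replace (Derive (fun s => x s) t) with dx by (symmetry; apply is_derive_unique; exact X).
  replace (Derive (fun s => y s) t) with dy by (symmetry; apply is_derive_unique; exact Y).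
  field.
Qed.

(** An affine function has the primitive A z + B z^2 / 2, so its integral sees only the end points.
    This is what cancels around a closed quadrilateral. *)
Lemma path_integral_affine (A B : C) (g g' : R -> C) a b : a <= b ->
  (forall t, a <= t <= b -> pder g t (g' t)) -> contin g' a b ->
  path_integral (fun z => A + B * z)%C g g' a b =
  ((A * g b + B * (g b * g b) / 2) - (A * g a + B * (g a * g a) / 2))%C.
Proof.
  intros Hab D Cc.
  assert (Cg : contin g a b) by (intros t Ht; eapply pder_pcont, D; auto).
  apply (CInt_pder (fun t => (A * g t + B * (g t * g t) / 2)%C)); auto.
  - intros t Ht. destruct (D t Ht) as [X Y].
    split.
    + evar_last; [eapply is_derive_ext;
        [|apply (is_derive_quadratic _ _ t _ _ (Re A) (- Im A) (Re B) (- Im B) X Y)]|].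
      * intros s; match goal with |- ?x = ?y => change (@eq R x y) end.
        unfold Re, Im; simpl; field.
      * unfold Re, Im; simpl; ring.
    + evar_last; [eapply is_derive_ext;
        [|apply (is_derive_quadratic _ _ t _ _ (Im A) (Re A) (Im B) (Re B) X Y)]|].
      * intros s; match goal with |- ?x = ?y => change (@eq R x y) end.
        unfold Re, Im; simpl; field.
      * unfold Re, Im; simpl; ring.
  - intros t Ht. apply pcont_mult; auto.
    apply pcont_plus; [apply pcont_const|apply pcont_mult; auto; apply pcont_const].
Qed.

(** * Cauchy's theorem and formula *)

(** Goursat's bisection, freed from its integrals. If [J] did not vanish, some quarter of each
    rectangle would keep a quarter of its modulus, and the nested quarters shrink to a point near
    which [J] is below any multiple of the squared size. *)
Lemma bisection_vanishing (J : R -> R -> R -> R -> C) (a b p q : R) :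
  a <= b -> p <= q ->
  (forall a' m b' p' n q', a <= a' -> a' <= m -> m <= b' -> b' <= b ->
     p <= p' -> p' <= n -> n <= q' -> q' <= q ->
     J a' b' p' q' = (J a' m p' n + J m b' p' n + J a' m n q' + J m b' n q')%C) ->
  (forall x y eps, a <= x <= b -> p <= y <= q -> 0 < eps ->
     exists d, 0 < d /\ forall a' b' p' q', a <= a' -> a' <= x <= b' -> b' <= b ->
       p <= p' -> p' <= y <= q' -> q' <= q -> b' - a' < d -> q' - p' < d ->
       Cmod (J a' b' p' q') <= eps * ((b' - a') + (q' - p')) ^ 2) ->
  J a b p q = RtoC 0.
Proof.
  intros Hab Hpq Hadd Hloc.
  destruct (Req_dec (Cmod (J a b p q)) 0) as [E|E]; [apply Cmod_eq_0; auto|exfalso].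
  set (e0 := Cmod (J a b p q)). assert (P0 : 0 < e0) by (pose proof (Cmod_ge_0 (J a b p q)); unfold e0; lra).
  set (size := fun S : (R * R) * (R * R) => Cmod (J (fst (fst S)) (snd (fst S)) (fst (snd S)) (snd (snd S)))).
  (* The last quarter is taken by default: when the first three fail the test, the triangle
     inequality forces it to pass. *)
  set (step := fun S : (R * R) * (R * R) =>
    let a := fst (fst S) in let b := snd (fst S) in
    let p := fst (snd S) in let q := snd (snd S) in
    let m := (a + b) / 2 in let n := (p + q) / 2 in
    if Rle_dec (size S / 4) (size ((a, m), (p, n))) then ((a, m), (p, n)) else
    if Rle_dec (size S / 4) (size ((m, b), (p, n))) then ((m, b), (p, n)) else
    if Rle_dec (size S / 4) (size ((a, m), (n, q))) then ((a, m), (n, q)) else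
    ((m, b), (n, q))).
  set (sq := fix sq k := match k with O => ((a, b), (p, q)) | S k => step (sq k) end).
  set (A := fun k => fst (fst (sq k))). set (B := fun k => snd (fst (sq k))).
  set (U := fun k => fst (snd (sq k))). set (V := fun k => snd (snd (sq k))).
  assert (Inv : forall k, a <= A k /\ A k <= B k /\ B k <= b /\
     p <= U k /\ U k <= V k /\ V k <= q /\ B k - A k = (b - a) / 2 ^ k /\
     V k - U k = (q - p) / 2 ^ k /\ e0 / 4 ^ k <= size (sq k) /\
     A k <= A (S k) /\ B (S k) <= B k /\ U k <= U (S k) /\ V (S k) <= V k).
  { assert (St : forall k, a <= A k -> A k <= B k -> B k <= b ->
       p <= U k -> U k <= V k -> V k <= q ->
       A k <= A (S k) /\ A (S k) <= B (S k) /\ B (S k) <= B k /\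
       U k <= U (S k) /\ U (S k) <= V (S k) /\ V (S k) <= V k /\
       B (S k) - A (S k) = (B k - A k) / 2 /\ V (S k) - U (S k) = (V k - U k) / 2 /\
       size (sq k) / 4 <= size (sq (S k))).
    { intros k Ha Hb Hc Hp Hu Hv. unfold A, B, U, V in *.
      change (sq (S k)) with (step (sq k)).
      destruct (sq k) as [[a1 b1] [p1 q1]]. simpl in *. unfold step; simpl.
      assert (T : size (a1, b1, (p1, q1)) <=
        size (a1, (a1 + b1) / 2, (p1, (p1 + q1) / 2)) +
        size ((a1 + b1) / 2, b1, (p1, (p1 + q1) / 2)) +
        size (a1, (a1 + b1) / 2, ((p1 + q1) / 2, q1)) +
        size ((a1 + b1) / 2, b1, ((p1 + q1) / 2, q1))).
      { unfold size; simpl.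
        rewrite (Hadd a1 ((a1 + b1) / 2) b1 p1 ((p1 + q1) / 2) q1) by lra.
        eapply Rle_trans; [apply Cmod_triangle|]. apply Rplus_le_compat_r.
        eapply Rle_trans; [apply Cmod_triangle|]. apply Rplus_le_compat_r.
        apply Cmod_triangle. }
      destruct (Rle_dec _ (size (a1, (a1 + b1) / 2, (p1, (p1 + q1) / 2)))); simpl;
        [repeat split; lra|].
      destruct (Rle_dec _ (size ((a1 + b1) / 2, b1, (p1, (p1 + q1) / 2)))); simpl;
        [repeat split; lra|].
      destruct (Rle_dec _ (size (a1, (a1 + b1) / 2, ((p1 + q1) / 2, q1)))); simpl;
        repeat split; lra. }
    assert (In : forall k, a <= A k /\ A k <= B k /\ B k <= b /\
     p <= U k /\ U k <= V k /\ V k <= q /\ B k - A k = (b - a) / 2 ^ k /\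
     V k - U k = (q - p) / 2 ^ k /\ e0 / 4 ^ k <= size (sq k)).
    { induction k as [|k IH].
      - unfold A, B, U, V; simpl. repeat split; try lra. unfold size, e0; simpl. lra.
      - destruct IH as (H1 & H2 & H3 & H4 & H5 & H6 & H7 & H8 & H9).
        destruct (St k H1 H2 H3 H4 H5 H6) as (S1 & S2 & S3 & S4 & S5 & S6 & S7 & S8 & S9).
        assert (0 < 2 ^ k) by (apply pow_lt; lra). assert (0 < 4 ^ k) by (apply pow_lt; lra).
        repeat split; try lra.
        + rewrite S7, H7. simpl. field. lra.
        + rewrite S8, H8. simpl. field. lra.
        + eapply Rle_trans; [|exact S9]. simpl.
          replace (e0 / (4 * 4 ^ k)) with (e0 / 4 ^ k / 4) by (field; lra). lra. }
    intros k. destruct (In k) as (H1 & H2 & H3 & H4 & H5 & H6 & H7 & H8 & H9).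
    destruct (St k H1 H2 H3 H4 H5 H6) as (S1 & S2 & S3 & S4 & S5 & S6 & S7 & S8 & S9).
    repeat split; auto. }
  assert (Nest : forall (L R : nat -> R), (forall k, L k <= L (S k)) ->
    (forall k, R (S k) <= R k) -> (forall k, L k <= R k) ->
    exists x, forall k, L k <= x <= R k).
  { intros L R HL HR HLR.
    assert (ML : forall i j, L i <= L (i + j)%nat).
    { intros i j; induction j; [rewrite Nat.add_0_r; lra|].
      rewrite Nat.add_succ_r. specialize (HL (i + j)%nat). lra. }
    assert (MR : forall i j, R (i + j)%nat <= R i).
    { intros i j; induction j; [rewrite Nat.add_0_r; lra|].
      rewrite Nat.add_succ_r. specialize (HR (i + j)%nat). lra. }
    assert (LR : forall i j, L i <= R j).
    { intros i j. specialize (ML i j). specialize (MR j i). specialize (HLR (i + j)%nat).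
      rewrite (Nat.add_comm j i) in MR. lra. }
    destruct (completeness (fun x => exists k, x = L k)) as [x [X1 X2]].
    - exists (R 0%nat). intros y [k ->]. apply LR.
    - exists (L 0%nat). now exists 0%nat.
    - exists x. intros k. split; [apply X1; now exists k|].
      apply X2. intros y [j ->]. apply LR. }
  destruct (Nest A B) as [x Hx]; try (intros k; now destruct (Inv k) as (H1&H2&H3&H4&H5&H6&H7&H8&H9&H10&H11&H12&H13)).
  destruct (Nest U V) as [y Hy]; try (intros k; now destruct (Inv k) as (H1&H2&H3&H4&H5&H6&H7&H8&H9&H10&H11&H12&H13)).
  set (s := (b - a) + (q - p)).
  (* With this multiple the factors 4^k cancel and e0 <= e0 s^2 / (2 (s^2 + 1)) results, which is
     absurd. *)
  assert (Heps : 0 < e0 / (2 * (s ^ 2 + 1))).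
  { apply Rdiv_lt_0_compat; auto. pose proof (pow2_ge_0 s). lra. }
  destruct (Hloc x y (e0 / (2 * (s ^ 2 + 1)))) as (d & Hd & Hdd); auto.
  { destruct (Inv 0%nat) as (H1&H2&H3&_). specialize (Hx 0%nat). lra. }
  { destruct (Inv 0%nat) as (_&_&_&H1&H2&H3&_). specialize (Hy 0%nat). lra. }
  destruct (pow_lt_1_zero (/ 2)) with (y := d / (s + 1)) as [k Hk].
  { rewrite Rabs_pos_eq; lra. }
  { apply Rdiv_lt_0_compat; unfold s; lra. }
  specialize (Hk k (le_n k)).
  assert (P2 : 0 < 2 ^ k) by (apply pow_lt; lra).
  rewrite pow_inv, Rabs_pos_eq in Hk by (left; apply Rinv_0_lt_compat; auto).
  assert (Hs : s / 2 ^ k < d).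
  { assert (0 <= s) by (unfold s; lra).
    apply Rle_lt_trans with ((s + 1) * / 2 ^ k).
    - unfold Rdiv. apply Rmult_le_compat_r; [left; apply Rinv_0_lt_compat; auto|lra].
    - apply Rmult_lt_compat_l with (r := s + 1) in Hk; [|lra].
      replace ((s + 1) * (d / (s + 1))) with d in Hk by (field; lra). auto. }
  destruct (Inv k) as (H1&H2&H3&H4&H5&H6&H7&H8&H9&_).
  assert (D1 : (b - a) / 2 ^ k <= s / 2 ^ k).
  { unfold Rdiv. apply Rmult_le_compat_r; [left; apply Rinv_0_lt_compat; auto|unfold s; lra]. }
  assert (D2 : (q - p) / 2 ^ k <= s / 2 ^ k).
  { unfold Rdiv. apply Rmult_le_compat_r; [left; apply Rinv_0_lt_compat; auto|unfold s; lra]. }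
  specialize (Hdd (A k) (B k) (U k) (V k) H1 (Hx k) H3 H4 (Hy k) H6).
  assert (Z : Cmod (J (A k) (B k) (U k) (V k)) <=
     e0 / (2 * (s ^ 2 + 1)) * ((B k - A k) + (V k - U k)) ^ 2) by (apply Hdd; lra).
  change (Cmod (J (A k) (B k) (U k) (V k))) with (size (sq k)) in Z.
  rewrite H7, H8 in Z.
  replace (((b - a) / 2 ^ k + (q - p) / 2 ^ k) ^ 2) with (s ^ 2 / 4 ^ k) in Z.
  2:{ replace 4 with (2 * 2) by ring. rewrite Rpow_mult_distr. unfold s. field. lra. }
  assert (P4 : 0 < 4 ^ k) by (apply pow_lt; lra).
  assert (W : e0 / 4 ^ k <= e0 / (2 * (s ^ 2 + 1)) * (s ^ 2 / 4 ^ k)) by lra.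
  apply Rmult_le_compat_r with (r := 4 ^ k * (2 * (s ^ 2 + 1))) in W.
  2:{ apply Rmult_le_pos; [lra|]. pose proof (pow2_ge_0 s). lra. }
  pose proof (pow2_ge_0 s) as S2.
  replace (e0 / 4 ^ k * (4 ^ k * (2 * (s ^ 2 + 1)))) with (e0 * (2 * (s ^ 2 + 1))) in W by (field; lra).
  replace (e0 / (2 * (s ^ 2 + 1)) * (s ^ 2 / 4 ^ k) * (4 ^ k * (2 * (s ^ 2 + 1))))
    with (e0 * s ^ 2) in W by (field; split; lra).
  nra.
Qed.

Lemma path_integral_Chasles G g g' a b c : a <= b -> b <= c ->
  contin (fun t => G (g t) * g' t)%C a c ->
  path_integral G g g' a c = (path_integral G g g' a b + path_integral G g g' b c)%C.
Proof. intros. unfold path_integral. rewrite CInt_Chasles; auto. Qed.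

Lemma path_integral_close (G P : C -> C) (g g' : R -> C) a b e M : a <= b -> 0 <= e ->
  contin (fun t => G (g t) * g' t)%C a b -> contin (fun t => P (g t) * g' t)%C a b ->
  (forall t, a <= t <= b -> Cmod (G (g t) - P (g t))%C <= e /\ Cmod (g' t) <= M) ->
  Cmod (path_integral G g g' a b - path_integral P g g' a b)%C <= e * M * (b - a).
Proof.
  intros Hab He A B D. unfold path_integral. rewrite <- CInt_minus; auto.
  apply CInt_bound; auto.
  - intros t Ht. apply pcont_minus; auto.
  - intros t Ht. destruct (D t Ht) as [X Y].
    replace (G (g t) * g' t - P (g t) * g' t)%C with ((G (g t) - P (g t)) * g' t)%C by ring.
    rewrite Cmod_mult. apply Rmult_le_compat; auto; apply Cmod_ge_0.
Qed.

Section Contraction.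

Variables (z0 : C) (c c' : R -> C) (M : R).
Hypothesis c_der : forall t, pder c t (c' t).
Hypothesis c'_cont : forall t, pcont c' t.
Hypothesis M_pos : 0 < M.
Hypothesis c_bound : forall t, Cmod (c t) <= M.
Hypothesis c'_bound : forall t, Cmod (c' t) <= M.

(** The parameter s contracts the curve z0 + c to the point z0. Rectangles are taken in the
    parameters (s, t) rather than in the plane, which compares two contracted curves directly. *)
Definition gam (s t : R) : C := (z0 + RtoC s * c t)%C.

Lemma c_lip x y : Cmod (c x - c y)%C <= M * Rabs (x - y).
Proof.
  assert (A : forall a b, a <= b -> Cmod (c b - c a)%C <= M * (b - a)).
  { intros a b Hab. rewrite <- (CInt_pder c c'); auto; [|intros t _; auto].
    apply CInt_bound; auto. intros t _; auto. }
  destruct (Rle_dec x y) as [Hl|Hl].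
  - specialize (A x y Hl). rewrite <- Cmod_opp.
    replace (- (c x - c y))%C with (c y - c x)%C by ring.
    rewrite Rabs_left1 by lra. lra.
  - specialize (A y x). rewrite Rabs_pos_eq by lra. lra.
Qed.

Lemma gam_dt s t : pder (gam s) t (RtoC s * c' t)%C.
Proof.
  destruct (c_der t) as [X Y]. unfold gam.
  split; simpl.
  - apply is_derive_ext with (fun u => Re z0 + s * Re (c u));
      [intros u; unfold Re, Im; simpl; ring|].
    replace (s * fst (c' t) - 0 * snd (c' t)) with (0 + s * Re (c' t)) by (unfold Re; ring).
    apply (is_derive_plus (K := R_AbsRing) (V := R_NormedModule)); [apply (is_derive_const (K := R_AbsRing) (V := R_NormedModule))|].
    apply is_derive_scal; auto.
  - apply is_derive_ext with (fun u => Im z0 + s * Im (c u));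
      [intros u; unfold Re, Im; simpl; ring|].
    replace (s * snd (c' t) + 0 * fst (c' t)) with (0 + s * Im (c' t)) by (unfold Im; ring).
    apply (is_derive_plus (K := R_AbsRing) (V := R_NormedModule)); [apply (is_derive_const (K := R_AbsRing) (V := R_NormedModule))|].
    apply is_derive_scal; auto.
Qed.

Lemma gam_ds s t : pder (fun s => gam s t) s (c t).
Proof.
  unfold gam. split; simpl.
  - apply is_derive_ext with (fun u => Re z0 + Re (c t) * u);
      [intros u; unfold Re, Im; simpl; ring|].
    auto_derive; auto. ring.
  - apply is_derive_ext with (fun u => Im z0 + Im (c t) * u);
      [intros u; unfold Re, Im; simpl; ring|].
    auto_derive; auto. ring.
Qed.

Lemma gam_lip s t x y : 0 <= x <= 1 ->
  Cmod (gam s t - gam x y)%C <= M * (Rabs (s - x) + Rabs (t - y)).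
Proof.
  intros Hx. unfold gam.
  replace (z0 + s * c t - (z0 + x * c y))%C with (RtoC (s - x) * c t + RtoC x * (c t - c y))%C
    by (rewrite RtoC_minus; ring).
  eapply Rle_trans; [apply Cmod_triangle|]. rewrite !Cmod_mult, !Cmod_R.
  rewrite (Rabs_pos_eq x) by lra.
  pose proof (c_lip t y). pose proof (c_bound t). pose proof (Rabs_pos (s - x)).
  pose proof (Cmod_ge_0 (c t - c y)). nra.
Qed.

Variables (G : C -> C) (a b p q : R).
Hypothesis Ha : 0 <= a.
Hypothesis Hab : a <= b.
Hypothesis Hb : b <= 1.
Hypothesis Hpq : p <= q.
Hypothesis G_der : forall s t, a <= s <= b -> p <= t <= q -> exists l, cder G (gam s t) l.

Let side_t (s p q : R) : C := path_integral G (gam s) (fun t => RtoC s * c' t)%C p q.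
Let side_s (t a b : R) : C := path_integral G (fun s => gam s t) (fun _ => c t) a b.

Lemma side_t_contin s p' q' : a <= s <= b -> p <= p' -> q' <= q ->
  contin (fun t => G (gam s t) * (RtoC s * c' t))%C p' q'.
Proof.
  intros Hs Hp Hq t Ht. destruct (G_der s t) as [l Hl]; [auto|lra|].
  apply pcont_mult.
  - apply (pcont_comp G (gam s) t l Hl). eapply pder_pcont, gam_dt.
  - apply pcont_mult; auto. apply pcont_const.
Qed.

Lemma side_s_contin t a' b' : p <= t <= q -> a <= a' -> b' <= b ->
  contin (fun s => G (gam s t) * c t)%C a' b'.
Proof.
  intros Ht Hp Hq s Hs. destruct (G_der s t) as [l Hl]; [lra|auto|].
  apply pcont_mult.
  - apply (pcont_comp G (fun s => gam s t) s l Hl). eapply pder_pcont, gam_ds.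
  - apply pcont_const.
Qed.

(** Near a point [G] is affine up to a small error; the affine part integrates to zero around the
    image of a small rectangle, and the error is of the order of the squared size. *)
Lemma goursat :
  (side_t b p q - side_t a p q - side_s q a b + side_s p a b)%C = RtoC 0.
Proof.
  apply (bisection_vanishing
    (fun a b p q => side_t b p q - side_t a p q - side_s q a b + side_s p a b)%C); auto.
  - intros a' m b' p' n q' H1 H2 H3 H4 H5 H6 H7 H8. unfold side_t, side_s.
    rewrite (path_integral_Chasles G (gam b') _ p' n q'), (path_integral_Chasles G (gam a') _ p' n q'); try lra;
      try (apply side_t_contin; lra).
    rewrite (path_integral_Chasles G (fun s => gam s p') _ a' m b'), (path_integral_Chasles G (fun s => gam s q') _ a' m b'); try lra;
      try (apply side_s_contin; lra).
    ring.
  - intros x y eps Hx Hy He.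
    destruct (G_der x y Hx Hy) as [l Hl].
    set (P := fun z => ((G (gam x y) - l * gam x y) + l * z)%C).
    (* The four error integrals add up to 2 M e w with e = eps / (2 M^2) * (M w), that is to eps
       w^2. *)
    assert (Q : 0 < eps / (2 * M * M)) by (apply Rdiv_lt_0_compat; nra).
    destruct (Hl _ Q) as (d & Hd & B).
    exists (d / (4 * M)). split; [apply Rdiv_lt_0_compat; lra|].
    intros a' b' p' q' H1 H2 H3 H4 H5 H6 H7 H8.
    set (w := (b' - a') + (q' - p')).
    assert (Hw : M * w < d).
    { assert (w < d / (2 * M)).
      { unfold w. replace (d / (2 * M)) with (d / (4 * M) + d / (4 * M)) by (field; lra). lra. }
      apply Rmult_lt_compat_l with (r := M) in H; [|lra].
      replace (M * (d / (2 * M))) with (d / 2) in H by (field; lra). lra. }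
    assert (Hcl : forall s t, a' <= s <= b' -> p' <= t <= q' ->
       Cmod (G (gam s t) - P (gam s t))%C <= eps / (2 * M * M) * (M * w)).
    { intros s t Hs Ht.
      assert (L : Cmod (gam s t - gam x y)%C <= M * w).
      { eapply Rle_trans; [apply gam_lip; lra|]. apply Rmult_le_compat_l; [lra|].
        unfold w. apply Rplus_le_compat; apply Rabs_le; lra. }
      specialize (B (gam s t - gam x y)%C).
      replace (gam x y + (gam s t - gam x y))%C with (gam s t) in B by ring.
      unfold P.
      replace (G (gam s t) - (G (gam x y) - l * gam x y + l * gam s t))%C with
        (G (gam s t) - G (gam x y) - l * (gam s t - gam x y))%C by ring.
      eapply Rle_trans; [apply B; lra|]. apply Rmult_le_compat_l; lra. }
    set (e := eps / (2 * M * M) * (M * w)) in *.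
    assert (Pe : 0 <= e) by (eapply Rle_trans; [apply Cmod_ge_0|apply (Hcl x y); lra]).
    assert (Pt : forall s, a' <= s <= b' -> Cmod (side_t s p' q' -
        path_integral P (gam s) (fun t => RtoC s * c' t)%C p' q')%C <= e * M * (q' - p')).
    { intros s Hs. unfold side_t.
      apply (path_integral_close G P (gam s) (fun t => RtoC s * c' t)%C p' q' e M);
        [clear - H5; lra|exact Pe| | |].
      - apply side_t_contin; lra.
      - intros t Ht. apply pcont_mult; [|apply pcont_mult; auto; apply pcont_const].
        unfold P. apply pcont_plus; [apply pcont_const|].
        apply pcont_mult; [apply pcont_const|]. eapply pder_pcont, gam_dt.
      - intros t Ht. split; [apply Hcl; auto|].
        rewrite Cmod_mult, Cmod_R, Rabs_pos_eq by lra. pose proof (c'_bound t).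
        pose proof (Cmod_ge_0 (c' t)). nra. }
    assert (Ps : forall t, p' <= t <= q' -> Cmod (side_s t a' b' -
        path_integral P (fun s => gam s t) (fun _ => c t)%C a' b')%C <= e * M * (b' - a')).
    { intros t Ht. unfold side_s.
      apply (path_integral_close G P (fun s => gam s t) (fun _ => c t)%C a' b' e M);
        [clear - H2; lra|exact Pe| | |].
      - apply side_s_contin; lra.
      - intros s Hs. apply pcont_mult; [|apply pcont_const].
        unfold P. apply pcont_plus; [apply pcont_const|].
        apply pcont_mult; [apply pcont_const|]. eapply pder_pcont, gam_ds.
      - intros s Hs. split; [apply Hcl; auto|apply c_bound]. }
    assert (At : forall s, path_integral P (gam s) (fun t => RtoC s * c' t)%C p' q' =
      (((G (gam x y) - l * gam x y) * gam s q' + l * (gam s q' * gam s q') / 2) -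
       ((G (gam x y) - l * gam x y) * gam s p' + l * (gam s p' * gam s p') / 2))%C).
    { intros s. apply path_integral_affine; [lra|intros; apply gam_dt|].
      intros t Ht. apply pcont_mult; auto. apply pcont_const. }
    assert (As : forall t, path_integral P (fun s => gam s t) (fun _ => c t)%C a' b' =
      (((G (gam x y) - l * gam x y) * gam b' t + l * (gam b' t * gam b' t) / 2) -
       ((G (gam x y) - l * gam x y) * gam a' t + l * (gam a' t * gam a' t) / 2))%C).
    { intros t. apply (path_integral_affine _ _ (fun s => gam s t)); [lra|intros; apply gam_ds|].
      intros s Hs. apply pcont_const. }
    pose proof (Pt b' ltac:(lra)) as T1. pose proof (Pt a' ltac:(lra)) as T2.
    pose proof (Ps q' ltac:(lra)) as T3. pose proof (Ps p' ltac:(lra)) as T4.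
    rewrite At in T1, T2. rewrite As in T3, T4.
    match type of T1 with Cmod ?u <= _ => set (u1 := u) in * end.
    match type of T2 with Cmod ?u <= _ => set (u2 := u) in * end.
    match type of T3 with Cmod ?u <= _ => set (u3 := u) in * end.
    match type of T4 with Cmod ?u <= _ => set (u4 := u) in * end.
    replace (side_t b' p' q' - side_t a' p' q' - side_s q' a' b' + side_s p' a' b')%C
      with (u1 + - u2 + - u3 + u4)%C by (unfold u1, u2, u3, u4; ring).
    apply Rle_trans with (e * M * (q' - p') + e * M * (q' - p') + e * M * (b' - a') + e * M * (b' - a')).
    + repeat (eapply Rle_trans; [apply Cmod_triangle|apply Rplus_le_compat]);
        rewrite ?Cmod_opp; auto.
    + apply Req_le. replace (e * M * (q' - p') + e * M * (q' - p') + e * M * (b' - a') + e * M * (b' - a'))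
        with (2 * e * M * w) by (unfold w; ring).
      unfold e. fold w. field. lra.
Qed.

End Contraction.

(** * Finite sums and partial sums of power series *)

Fixpoint csum (u : nat -> C) (n : nat) : C :=
  match n with O => RtoC 0 | S k => (csum u k + u k)%C end.

Lemma csum_ext u v n : (forall k, (k < n)%nat -> u k = v k) -> csum u n = csum v n.
Proof.
  induction n; intros E; simpl; auto. rewrite IHn, E; auto.
Qed.

Lemma csum_plus u v n : csum (fun k => u k + v k)%C n = (csum u n + csum v n)%C.
Proof. induction n; simpl; [|rewrite IHn]; ring. Qed.

Lemma csum_scal c u n : csum (fun k => c * u k)%C n = (c * csum u n)%C.
Proof. induction n; simpl; [|rewrite IHn]; ring. Qed.

Lemma csum_S_l u n : csum u (S n) = (u O + csum (fun k => u (S k)) n)%C.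
Proof. induction n; simpl in *; [ring|]. rewrite IHn. ring. Qed.

Lemma sum_n_csum u n : @sum_n C_AbelianMonoid u n = csum u (S n).
Proof.
  induction n.
  - rewrite sum_O. symmetry. apply Cplus_0_l.
  - rewrite sum_Sn, IHn. reflexivity.
Qed.

Lemma pow_n_Cpow (z : C) n : @pow_n C_Ring z n = (z ^ n)%C.
Proof. induction n; [reflexivity|]. rewrite Cpow_S, <- IHn. reflexivity. Qed.

Definition psum (a : nat -> C) (z : C) (n : nat) : C := csum (fun k => a k * z ^ k)%C n.

Lemma is_pseries_psum a z l : @is_pseries C_AbsRing C_NormedModule a z l <->
  (forall eps, 0 < eps -> exists N, forall n, (N <= n)%nat -> Cmod (psum a z n - l)%C <= eps).
Proof.
  assert (E : forall n, @sum_n C_AbelianMonoid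
     (fun k => @scal C_AbsRing C_NormedModule (pow_n (K := C_AbsRing) z k) (a k)) n = psum a z (S n)).
  { intros n. rewrite sum_n_csum. apply csum_ext. intros k _.
    change (@pow_n C_Ring z k * a k = a k * z ^ k)%C. rewrite pow_n_Cpow. ring. }
  split.
  - intros A eps He.
    assert (P : 0 < eps / 2) by lra.
    destruct (A (fun w => Cmod (w - l)%C <= eps)) as [N HN].
    { exists (mkposreal _ P). intros y Hy. apply ball_Cmod in Hy. simpl in Hy. lra. }
    exists (S N). intros [|n] Hn; [lia|]. specialize (HN n ltac:(lia)).
    cbv beta in HN.
    rewrite <- E. exact HN.
  - intros A Q [eps HQ].
    destruct (A (eps / 2)) as [N HN]; [pose proof (cond_pos eps); lra|].
    exists N. intros n Hn. apply HQ, Cmod_ball.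
    pose proof (cond_pos eps).
    apply Rle_lt_trans with (eps / 2); [|lra].
    specialize (HN (S n) ltac:(lia)). rewrite <- E in HN. exact HN.
Qed.

(** * Unit complex numbers and means over a circle *)

Definition cis (t : R) : C := (cos t, sin t).

Lemma cis_plus s t : cis (s + t) = (cis s * cis t)%C.
Proof.
  unfold cis. rewrite cos_plus, sin_plus. apply injective_projections; simpl; ring.
Qed.

Lemma Cmod_cis t : Cmod (cis t) = 1.
Proof.
  unfold Cmod, cis. simpl fst. simpl snd.
  replace (cos t ^ 2 + sin t ^ 2) with 1; [apply sqrt_1|].
  rewrite <- (sin2_cos2 t). unfold Rsqr. ring.
Qed.

Lemma cis_0 : cis 0 = RtoC 1.
Proof. unfold cis. rewrite cos_0, sin_0. reflexivity. Qed.

Lemma cis_neq_0 t : cis t <> RtoC 0.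
Proof. intros E. pose proof (Cmod_cis t) as A. rewrite E, Cmod_0 in A. lra. Qed.

Lemma cis_opp t : cis (- t) = (/ cis t)%C.
Proof.
  pose proof (cis_plus t (- t)) as E. rewrite Rplus_opp_r, cis_0 in E.
  replace (cis (- t)) with (/ cis t * (cis t * cis (- t)))%C by (field; apply cis_neq_0).
  rewrite <- E. ring.
Qed.

Lemma cis_pow t n : (cis t ^ n)%C = cis (INR n * t).
Proof.
  induction n.
  - rewrite Rmult_0_l, cis_0. reflexivity.
  - rewrite Cpow_S, IHn, <- cis_plus, S_INR. f_equal. ring.
Qed.

Lemma cis_2PI (k : nat) : cis (INR k * (2 * PI)) = RtoC 1.
Proof.
  rewrite <- cis_pow. replace (cis (2 * PI)) with (RtoC 1); [apply Cpow_1_l|].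
  unfold cis. rewrite cos_2PI, sin_2PI. reflexivity.
Qed.

Lemma cis_conj t : Cconj (cis t) = cis (- t).
Proof. unfold cis, Cconj; simpl. rewrite cos_neg, sin_neg. reflexivity. Qed.

Lemma cis_pder k t : pder (fun s => cis (k * s)) t (- k * sin (k * t), k * cos (k * t)).
Proof. unfold cis. split; simpl; auto_derive; auto; ring. Qed.

Lemma cis_pcont k t : pcont (fun s => cis (k * s)) t.
Proof. eapply pder_pcont, cis_pder. Qed.

Lemma cis_pcont1 t : pcont cis t.
Proof. apply pcont_ext with (fun s => cis (1 * s)); [intros; f_equal; ring|apply cis_pcont]. Qed.

Definition circle_mean (f : R -> C) : C := (/ RtoC (2 * PI) * CInt f 0 (2 * PI))%C.

Definition cont2pi (f : R -> C) : Prop := contin f 0 (2 * PI).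

Lemma twopi_pos : 0 < 2 * PI.
Proof. pose proof PI_RGT_0. lra. Qed.

Lemma twopi_neq : RtoC (2 * PI) <> RtoC 0.
Proof. intros E. apply RtoC_inj in E. pose proof PI_RGT_0. lra. Qed.

Lemma circle_mean_ext f g : (forall t, 0 <= t <= 2 * PI -> f t = g t) -> circle_mean f = circle_mean g.
Proof. intros E. unfold circle_mean. pose proof twopi_pos. rewrite (CInt_ext f g); auto. lra. Qed.

Lemma circle_mean_plus f g : cont2pi f -> cont2pi g -> circle_mean (fun t => f t + g t)%C = (circle_mean f + circle_mean g)%C.
Proof. intros A B. unfold circle_mean. pose proof twopi_pos. rewrite CInt_plus; auto; [ring|lra]. Qed.

Lemma circle_mean_scal c f : cont2pi f -> circle_mean (fun t => c * f t)%C = (c * circle_mean f)%C.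
Proof. intros A. unfold circle_mean. pose proof twopi_pos. rewrite CInt_scal; auto; [ring|lra]. Qed.

Lemma circle_mean_minus f g : cont2pi f -> cont2pi g -> circle_mean (fun t => f t - g t)%C = (circle_mean f - circle_mean g)%C.
Proof. intros A B. unfold circle_mean. pose proof twopi_pos. rewrite CInt_minus; auto; [ring|lra]. Qed.

Lemma circle_mean_const c : circle_mean (fun _ => c) = c.
Proof.
  unfold circle_mean. rewrite CInt_const. replace (2 * PI - 0) with (2 * PI) by ring.
  field. apply twopi_neq.
Qed.

Lemma circle_mean_bound f M : cont2pi f -> (forall t, 0 <= t <= 2 * PI -> Cmod (f t) <= M) -> Cmod (circle_mean f) <= M.
Proof.
  intros A B. pose proof twopi_pos. unfold circle_mean. rewrite Cmod_mult, Cmod_inv, Cmod_R, Rabs_pos_eq by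
    (try apply twopi_neq; lra).
  apply Rle_trans with (/ (2 * PI) * (M * (2 * PI - 0))).
  - apply Rmult_le_compat_l; [left; apply Rinv_0_lt_compat; auto|]. apply CInt_bound; auto. lra.
  - apply Req_le. field. lra.
Qed.

(** Orthogonality of characters: up to the factor - i n the integrand is the derivative of a
    function of period 2 PI. *)
Lemma circle_mean_cis_neg (n : nat) : (1 <= n)%nat -> circle_mean (fun t => / cis (INR n * t))%C = RtoC 0.
Proof.
  intros Hn.
  assert (Pn : 0 < INR n) by (apply lt_0_INR; lia). pose proof twopi_pos as P.
  assert (NI : RtoC (INR n) <> RtoC 0) by (intros E; apply RtoC_inj in E; lra).
  rewrite (circle_mean_ext _ (fun t => cis (- INR n * t))).
  2:{ intros t _. rewrite <- cis_opp. f_equal. ring. }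
  assert (A : CInt (fun t => (- Ci * RtoC (INR n)) * cis (- INR n * t))%C 0 (2 * PI) = RtoC 0).
  { rewrite (CInt_pder (fun t => cis (- INR n * t))).
    - replace (- INR n * (2 * PI)) with (- (INR n * (2 * PI))) by ring.
      rewrite cis_opp, cis_2PI, Rmult_0_r, cis_0. field.
    - lra.
    - intros t _. pose proof (cis_pder (- INR n) t) as D.
      replace (- Ci * RtoC (INR n) * cis (- INR n * t))%C with
        (- - INR n * sin (- INR n * t), - INR n * cos (- INR n * t)); auto.
      apply injective_projections; simpl; ring.
    - intros t _. apply pcont_mult; [apply pcont_const|apply cis_pcont]. }
  rewrite CInt_scal in A; [|lra|intros t _; apply cis_pcont].
  unfold circle_mean. apply Cmult_zero in A. destruct A as [A|A].
  - apply Cmult_zero in A. destruct A as [A|A]; [|contradiction].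
    exfalso. apply (f_equal Im) in A. simpl in A. lra.
  - rewrite A. ring.
Qed.

Definition circ (rho : R) (t : R) : C := (RtoC rho * cis t)%C.

Lemma Cmod_circ rho t : 0 <= rho -> Cmod (circ rho t) = rho.
Proof. intros Hr. unfold circ. rewrite Cmod_mult, Cmod_cis, Cmod_R, Rabs_pos_eq; lra. Qed.

Lemma circ_neq_0 rho t : 0 < rho -> circ rho t <> RtoC 0.
Proof. intros Hr E. pose proof (Cmod_circ rho t) as A. rewrite E, Cmod_0 in A. lra. Qed.

Lemma circ_pcont rho t : pcont (circ rho) t.
Proof. unfold circ. apply pcont_mult; [apply pcont_const|apply cis_pcont1]. Qed.

Lemma pcont_inv f t : f t <> RtoC 0 -> pcont f t -> pcont (fun s => / f s)%C t.
Proof. intros Hn A. eapply (pcont_comp (fun z => / z)%C f); eauto. apply cder_inv; auto. Qed.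

Lemma pcont_pow f n t : pcont f t -> pcont (fun s => f s ^ n)%C t.
Proof.
  intros A. induction n; [exact (pcont_const (RtoC 1) t)|].
  apply pcont_ext with (fun s => f s * f s ^ n)%C; [intros; now rewrite Cpow_S|].
  apply pcont_mult; auto.
Qed.

Lemma Cmod_circ_minus rho z t : 0 <= rho -> rho - Cmod z <= Cmod (circ rho t - z)%C.
Proof.
  intros Hr. pose proof (Cmod_triangle (circ rho t - z) z) as T.
  replace (circ rho t - z + z)%C with (circ rho t) in T by ring.
  rewrite Cmod_circ in T; lra.
Qed.

Definition coef (rho : R) (f : R -> C) (n : nat) : C := circle_mean (fun t => f t * (/ circ rho t) ^ n)%C.

(** A finite geometric sum turns the partial sum into a mean against the Cauchy kernel times 1 - (z
    / zeta)^N; the error is the term with (z / zeta)^N. *)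
Lemma cauchy_kernel_series (f : R -> C) (rho M : R) (z : C) (N : nat) :
  0 < rho -> Cmod z < rho -> cont2pi f -> (forall t, 0 <= t <= 2 * PI -> Cmod (f t) <= M) ->
  Cmod (psum (coef rho f) z N - circle_mean (fun t => f t * (circ rho t / (circ rho t - z))))%C
    <= M * ((Cmod z / rho) ^ N * (rho / (rho - Cmod z))).
Proof.
  intros Hr Hz Hf HM.
  assert (Nz : forall t, (circ rho t - z)%C <> RtoC 0).
  { intros t E. pose proof (Cmod_circ_minus rho z t) as A. rewrite E, Cmod_0 in A. lra. }
  pose proof (fun t => circ_neq_0 rho t Hr) as Nc.
  assert (Ci : forall t, pcont (fun s => / circ rho s)%C t)
    by (intros; apply pcont_inv; auto; apply circ_pcont).
  assert (Ck : forall t, pcont (fun s => circ rho s / (circ rho s - z))%C t).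
  { intros t. apply pcont_mult; [apply circ_pcont|]. apply pcont_inv; auto.
    apply pcont_minus; [apply circ_pcont|apply pcont_const]. }
  assert (E : forall n, psum (coef rho f) z n =
     circle_mean (fun t => f t * (circ rho t / (circ rho t - z)) * (1 - (z / circ rho t) ^ n))%C).
  { induction n.
    - unfold psum. simpl csum.
      rewrite (circle_mean_ext _ (fun _ => RtoC 0)); [now rewrite circle_mean_const|].
      intros t _. simpl. ring.
    - unfold psum in *. simpl csum. rewrite IHn. unfold coef.
      rewrite (Cmult_comm (circle_mean _)), <- circle_mean_scal, <- circle_mean_plus.
      + apply circle_mean_ext. intros t _. rewrite Cpow_S.
        unfold Cdiv. rewrite Cpow_mult_l. field. split; auto.
      + intros t Ht. apply pcont_mult; [apply pcont_mult; auto|].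
        apply pcont_minus; [apply pcont_const|]. apply pcont_pow.
        apply pcont_mult; [apply pcont_const|auto].
      + intros t Ht. apply pcont_mult; [apply pcont_const|]. apply pcont_mult; auto. apply pcont_pow; auto.
      + intros t Ht. apply pcont_mult; auto. apply pcont_pow; auto. }
  rewrite E, <- circle_mean_minus.
  - apply circle_mean_bound.
    + intros t Ht. apply pcont_minus; [apply pcont_mult; [apply pcont_mult; auto|]|apply pcont_mult; auto].
      apply pcont_minus; [apply pcont_const|]. apply pcont_pow.
      apply pcont_mult; [apply pcont_const|auto].
    + intros t Ht.
      replace (f t * (circ rho t / (circ rho t - z)) * (1 - (z / circ rho t) ^ N) -
        f t * (circ rho t / (circ rho t - z)))%C with
        (- (f t * ((z / circ rho t) ^ N * (circ rho t / (circ rho t - z)))))%C by ring.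
      rewrite Cmod_opp, !Cmod_mult, Cmod_pow, !Cmod_div, !Cmod_circ by (auto; lra).
      apply Rmult_le_compat; auto; try apply Cmod_ge_0.
      { apply Rmult_le_pos; [apply pow_le|]; apply Rdiv_le_0_compat; auto; try lra; try apply Cmod_ge_0.
        apply Cmod_gt_0; auto. }
      apply Rmult_le_compat_l; [apply pow_le; apply Rdiv_le_0_compat; [apply Cmod_ge_0|auto]|].
      apply Rmult_le_compat_l; [lra|]. apply Rinv_le_contravar; [lra|].
      apply Cmod_circ_minus; lra.
  - intros t Ht. apply pcont_mult; [apply pcont_mult; auto|].
    apply pcont_minus; [apply pcont_const|]. apply pcont_pow.
    apply pcont_mult; [apply pcont_const|auto].
  - intros t Ht. apply pcont_mult; auto.
Qed.

Lemma geom_vanish (C0 q : R) : 0 <= q < 1 -> forall eps, 0 < eps ->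
  exists N, forall n, (N <= n)%nat -> C0 * q ^ n <= eps.
Proof.
  intros Hq eps He.
  destruct (pow_lt_1_zero q) with (y := eps / (Rabs C0 + 1)) as [N HN].
  { rewrite Rabs_pos_eq; lra. }
  { apply Rdiv_lt_0_compat; auto. pose proof (Rabs_pos C0). lra. }
  exists N. intros n Hn. specialize (HN n Hn).
  rewrite Rabs_pos_eq in HN by (apply pow_le; lra).
  pose proof (Rabs_pos C0). pose proof (Rle_abs C0). pose proof (pow_le q n (proj1 Hq)).
  apply Rle_trans with ((Rabs C0 + 1) * q ^ n); [nra|].
  apply Rmult_lt_compat_l with (r := Rabs C0 + 1) in HN; [|lra].
  replace ((Rabs C0 + 1) * (eps / (Rabs C0 + 1))) with eps in HN by (field; lra). lra.
Qed.

Lemma cauchy_kernel_pseries (f : R -> C) (rho M : R) (z : C) :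
  0 < rho -> Cmod z < rho -> cont2pi f -> (forall t, 0 <= t <= 2 * PI -> Cmod (f t) <= M) ->
  @is_pseries C_AbsRing C_NormedModule (coef rho f) z
    (circle_mean (fun t => f t * (circ rho t / (circ rho t - z)))%C).
Proof.
  intros Hr Hz Hf HM. apply is_pseries_psum. intros eps He.
  assert (Q : 0 <= Cmod z / rho < 1).
  { split; [apply Rdiv_le_0_compat; auto; apply Cmod_ge_0|].
    apply Rmult_lt_reg_r with rho; auto. unfold Rdiv. rewrite Rmult_assoc, Rinv_l; lra. }
  destruct (geom_vanish (M * (rho / (rho - Cmod z))) _ Q eps He) as [N HN].
  exists N. intros n Hn. eapply Rle_trans; [apply (cauchy_kernel_series f rho M); auto|].
  specialize (HN n Hn). lra.
Qed.

Lemma continuous_bounded (f : R -> C) : cont2pi f ->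
  exists M, 0 <= M /\ forall t, 0 <= t <= 2 * PI -> Cmod (f t) <= M.
Proof.
  intros A. pose proof twopi_pos as P.
  assert (B : forall t, 0 <= t <= 2 * PI -> continuity_pt (fun t => Cmod (f t)) t).
  { intros t Ht eps He. destruct (pcont_elim _ _ (A t Ht) (eps / 2)) as (d & Hd & D); [lra|].
    exists d. split; auto. intros s [_ Hs]. simpl in *. unfold R_dist in *.
    specialize (D s Hs).
    pose proof (Cmod_triangle (f s - f t) (f t)) as T1.
    replace (f s - f t + f t)%C with (f s) in T1 by ring.
    pose proof (Cmod_triangle (- (f s - f t)) (f s)) as T2.
    replace (- (f s - f t) + f s)%C with (f t) in T2 by ring. rewrite Cmod_opp in T2.
    apply Rle_lt_trans with (eps / 2); [apply Rabs_le|]; lra. }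
  destruct (continuity_ab_maj _ 0 (2 * PI) ltac:(lra) B) as [x [Hx _]].
  exists (Cmod (f x)). split; [apply Cmod_ge_0|]. intros t Ht. apply Hx, Ht.
Qed.

Lemma circle_contin F rho : holo F -> 0 <= rho < 1 -> cont2pi (fun t => F (circ rho t)).
Proof.
  intros HF Hr t _. destruct (HF (circ rho t)) as [l Hl].
  { unfold unit_disc. rewrite Cmod_circ; lra. }
  apply (pcont_comp F (circ rho) t l Hl), circ_pcont.
Qed.

(** For the constant function 1 all coefficients but the first vanish, so every nonempty partial sum
    of the kernel expansion equals 1. *)
Lemma kernel_mean rho z : 0 < rho -> Cmod z < rho ->
  circle_mean (fun t => circ rho t / (circ rho t - z))%C = RtoC 1.
Proof.
  intros Hr Hz.
  assert (E : Cmod (RtoC 1 - circle_mean (fun t => circ rho t / (circ rho t - z)))%C <= 0).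
  { apply le_epsilon. intros eps He. rewrite Rplus_0_l.
    assert (Q : 0 <= Cmod z / rho < 1).
    { split; [apply Rdiv_le_0_compat; auto; apply Cmod_ge_0|].
      apply Rmult_lt_reg_r with rho; auto. unfold Rdiv. rewrite Rmult_assoc, Rinv_l; lra. }
    destruct (geom_vanish (1 * (rho / (rho - Cmod z))) _ Q eps He) as [N HN].
    pose proof (cauchy_kernel_series (fun _ => RtoC 1) rho 1 z (S N) Hr Hz) as A.
    rewrite (circle_mean_ext _ (fun t => circ rho t / (circ rho t - z))%C) in A by (intros; ring).
    assert (E1 : psum (coef rho (fun _ => RtoC 1)) z (S N) = RtoC 1).
    { unfold psum. rewrite csum_S_l.
      rewrite (csum_ext _ (fun _ => RtoC 0 * 0)%C).
      - rewrite csum_scal. unfold coef. rewrite (circle_mean_ext _ (fun _ => RtoC 1)) by (intros; simpl; ring).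
        rewrite circle_mean_const. simpl. ring.
      - intros k _. unfold coef. rewrite (circle_mean_ext _ (fun t => / (RtoC rho ^ S k) * / cis (INR (S k) * t))%C).
        + rewrite circle_mean_scal, circle_mean_cis_neg; [ring|lia|].
          intros t _. apply pcont_inv; [apply cis_neq_0|apply cis_pcont].
        + intros t _. unfold circ. rewrite <- cis_pow.
          assert (Nr : RtoC rho <> RtoC 0) by (apply RtoC_neq_0; lra).
          rewrite Cpow_inv by (apply Cmult_neq_0; auto; apply cis_neq_0).
          rewrite Cpow_mult_l. field. split; apply Cpow_nz; auto; apply cis_neq_0. }
    rewrite E1 in A. eapply Rle_trans; [apply A|].
    - intros t _. apply pcont_const.
    - intros t _. rewrite Cmod_1. lra.
    - specialize (HN (S N) ltac:(lia)). lra. }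
  assert (E0 : (RtoC 1 - circle_mean (fun t => circ rho t / (circ rho t - z)))%C = RtoC 0).
  { apply Cmod_eq_0. pose proof (Cmod_ge_0 (RtoC 1 - circle_mean (fun t => circ rho t / (circ rho t - z)))%C). lra. }
  replace (RtoC 1) with (circle_mean (fun t => circ rho t / (circ rho t - z)) +
    (RtoC 1 - circle_mean (fun t => circ rho t / (circ rho t - z))))%C by ring.
  rewrite E0. ring.
Qed.

(** The mean of [F] over the curve z + s (zeta - z), taken against the Cauchy kernel, does not
    depend on s in (0, 1]. At s = 1 it is the left-hand side; as s tends to 0 it tends to F z times
    the mean of the kernel, which is 1. *)
Lemma cauchy_formula F rho z : holo F -> 0 < rho < 1 -> Cmod z < rho ->
  circle_mean (fun t => F (circ rho t) * (circ rho t / (circ rho t - z)))%C = F z.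
Proof.
  intros HF Hr Hz. pose proof twopi_pos as P.
  set (c := fun t => (circ rho t - z)%C).
  set (c' := fun t => (Ci * circ rho t)%C).
  assert (Nc : forall t, c t <> RtoC 0).
  { intros t E. pose proof (Cmod_circ_minus rho z t) as A. unfold c in E. rewrite E, Cmod_0 in A. lra. }
  assert (Dc : forall t, pder c t (c' t)).
  { intros t. unfold c, c', circ, cis. split.
    - apply is_derive_ext with (fun s => rho * cos s - fst z);
        [intros s; match goal with |- ?x = ?y => change (@eq R x y) end; unfold Re; simpl; ring|].
      auto_derive; auto. unfold Re; simpl; ring.
    - apply is_derive_ext with (fun s => rho * sin s - snd z);
        [intros s; match goal with |- ?x = ?y => change (@eq R x y) end; unfold Im; simpl; ring|].
      auto_derive; auto. unfold Im; simpl; ring. }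
  assert (Cc' : forall t, pcont c' t) by (intros t; apply pcont_mult; [apply pcont_const|apply circ_pcont]).
  assert (Bc : forall t, Cmod (c t) <= 2).
  { intros t. unfold c, Cminus. eapply Rle_trans; [apply Cmod_triangle|].
    rewrite Cmod_opp, Cmod_circ; lra. }
  assert (Bc' : forall t, Cmod (c' t) <= 2).
  { intros t. unfold c'. rewrite Cmod_mult, Cmod_circ by lra.
    replace (Cmod Ci) with 1; [lra|]. unfold Cmod, Ci; simpl.
    replace (0 * (0 * 1) + 1 * (1 * 1)) with 1 by ring. now rewrite sqrt_1. }
  assert (In : forall s t, 0 <= s <= 1 -> unit_disc (gam z c s t)).
  { intros s t Hs. unfold unit_disc, gam, c.
    replace (z + s * (circ rho t - z))%C with (RtoC (1 - s) * z + RtoC s * circ rho t)%C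
      by (rewrite RtoC_minus; ring).
    eapply Rle_lt_trans; [apply Cmod_triangle|].
    rewrite !Cmod_mult, !Cmod_R, Cmod_circ, !Rabs_pos_eq by lra. nra. }
  assert (Fc : forall s, 0 <= s <= 1 -> cont2pi (fun t => F (gam z c s t))).
  { intros s Hs t _. destruct (HF (gam z c s t)) as [l Hl]; auto.
    apply (pcont_comp F (gam z c s) t l Hl).
    unfold gam, c. apply pcont_plus; [apply pcont_const|].
    apply pcont_mult; [apply pcont_const|]. apply pcont_minus; [apply circ_pcont|apply pcont_const]. }
  assert (Ck : forall t, pcont (fun s => circ rho s / (circ rho s - z))%C t).
  { intros t. apply pcont_mult; [apply circ_pcont|].
    apply (pcont_inv (fun s => circ rho s - z)%C); [apply Nc|].
    apply pcont_minus; [apply circ_pcont|apply pcont_const]. }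
  set (K := fun t => (circ rho t / (circ rho t - z))%C).
  set (Phi := fun s => circle_mean (fun t => F (gam z c s t) * K t)%C).
  assert (Const : forall a, 0 < a <= 1 -> Phi 1 = Phi a).
  { intros a Ha.
    assert (Gd : forall s t, a <= s <= 1 -> 0 <= t <= 2 * PI ->
       exists l, cder (fun w => F w * / (w - z))%C (gam z c s t) l).
    { intros s t Hs _. destruct (HF (gam z c s t)) as [l Hl]; [apply In; lra|].
      eexists. apply cder_mult; [exact Hl|].
      apply (cder_comp (fun w => / w)%C (fun w => w - z)%C).
      - apply (cder_plus (fun w => w) (fun _ => (- z)%C)); [apply cder_id|apply cder_const].
      - apply cder_inv. unfold gam.
        replace (z + s * c t - z)%C with (RtoC s * c t)%C by ring.
        apply Cmult_neq_0; auto. apply RtoC_neq_0; lra. }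
    (* The integrand F w / (w - z) is singular at s = 0 only, hence the range a <= s <= 1. The two
       sides in the direction of s agree by periodicity and cancel; on the other two the factor s of
       the velocity cancels against w - z = s c. *)
    pose proof (goursat z c c' 2 Dc Cc' ltac:(lra) Bc Bc'
      (fun w => F w * / (w - z))%C a 1 0 (2 * PI) ltac:(lra) ltac:(lra) ltac:(lra) ltac:(lra) Gd) as Gz.
    cbv beta zeta in Gz.
    assert (Per : c (2 * PI) = c 0).
    { unfold c, circ. replace (2 * PI) with (INR 1 * (2 * PI)) by (simpl; ring).
      rewrite cis_2PI, cis_0. auto. }
    assert (Ss : path_integral (fun w => F w * / (w - z))%C (fun s => gam z c s (2 * PI)) (fun _ => c (2 * PI)) a 1
      = path_integral (fun w => F w * / (w - z))%C (fun s => gam z c s 0) (fun _ => c 0) a 1).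
    { unfold gam. rewrite Per. reflexivity. }
    assert (St : forall s, a <= s <= 1 -> path_integral (fun w => F w * / (w - z))%C (gam z c s)
        (fun t => s * c' t)%C 0 (2 * PI) = (Ci * (RtoC (2 * PI) * Phi s))%C).
    { intros s Hs. unfold Phi, circle_mean.
      replace (RtoC (2 * PI) * (/ RtoC (2 * PI) * CInt (fun t : R => F (gam z c s t) * K t) 0 (2 * PI)))%C
        with (CInt (fun t : R => F (gam z c s t) * K t)%C 0 (2 * PI)) by (field; apply twopi_neq).
      rewrite <- CInt_scal; [|lra|].
      - apply CInt_ext; [lra|]. intros t Ht. unfold K, c', gam, c.
        replace (z + s * (circ rho t - z) - z)%C with (RtoC s * (circ rho t - z))%C by ring.
        field. split; [apply Nc|]. apply RtoC_neq_0; lra.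
      - intros t Ht. apply pcont_mult; auto. apply Fc; auto; lra. }
    rewrite Ss, !St in Gz by lra.
    assert (Z : (Ci * RtoC (2 * PI) * (Phi 1 - Phi a))%C = RtoC 0).
    { rewrite <- Gz. ring. }
    apply Cmult_zero in Z. destruct Z as [Z|Z].
    - apply Cmult_zero in Z. destruct Z as [Z|Z]; [|exfalso; apply twopi_neq; exact Z].
      exfalso. apply (f_equal Im) in Z. simpl in Z. lra.
    - replace (Phi 1) with (Phi 1 - Phi a + Phi a)%C by ring. rewrite Z. ring. }
  assert (E1 : circle_mean (fun t => F (circ rho t) * K t)%C = Phi 1).
  { apply circle_mean_ext. intros t _. do 2 f_equal. unfold gam, c. ring. }
  change (circle_mean (fun t => F (circ rho t) * K t)%C = F z). rewrite E1. destruct (HF z) as [l Hl]; [unfold unit_disc; lra|].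
  assert (BK : forall t, Cmod (K t) <= rho / (rho - Cmod z)).
  { intros t. unfold K. rewrite Cmod_div by (apply (Nc t)). rewrite Cmod_circ by lra.
    apply Rmult_le_compat_l; [lra|]. apply Rinv_le_contravar; [lra|]. apply Cmod_circ_minus; lra. }
  assert (E : Cmod (Phi 1 - F z)%C <= 0).
  { apply le_epsilon. intros eps He. rewrite Rplus_0_l.
    set (B := rho / (rho - Cmod z)) in *.
    assert (PB : 0 < B) by (apply Rdiv_lt_0_compat; lra).
    destruct (cder_bound _ _ _ Hl) as (d & Hd & Db).
    pose proof (Cmod_ge_0 l) as Pl.
    set (a := Rmin 1 (Rmin (d / 4) (eps / (2 * (Cmod l + 1) * B)))).
    assert (Pa : 0 < a).
    { repeat apply Rmin_pos; try lra. apply Rdiv_lt_0_compat; auto.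
      apply Rmult_lt_0_compat; lra. }
    assert (a <= 1) by apply Rmin_l.
    assert (a <= d / 4) by (eapply Rle_trans; [apply Rmin_r|apply Rmin_l]).
    assert (Ha2 : a <= eps / (2 * (Cmod l + 1) * B)) by (eapply Rle_trans; [apply Rmin_r|apply Rmin_r]).
    rewrite (Const a) by lra.
    replace (F z) with (F z * circle_mean K)%C.
    2:{ unfold K. rewrite kernel_mean by lra. ring. }
    unfold Phi. rewrite <- circle_mean_scal, <- circle_mean_minus.
    - apply circle_mean_bound.
      + intros t Ht. apply pcont_minus; apply pcont_mult; auto; [apply Fc; auto; lra|apply pcont_const].
      + intros t Ht.
        replace (F (gam z c a t) * K t - F z * K t)%C with ((F (gam z c a t) - F z) * K t)%C by ring.
        rewrite Cmod_mult. specialize (Db (a * c t)%C).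
        assert (Hm : Cmod (a * c t)%C <= 2 * a).
        { rewrite Cmod_mult, Cmod_R, Rabs_pos_eq by lra. specialize (Bc t). nra. }
        change (gam z c a t) with (z + a * c t)%C.
        apply Rle_trans with ((Cmod l + 1) * (2 * a) * B).
        * apply Rmult_le_compat; auto; try apply Cmod_ge_0.
          eapply Rle_trans; [apply Db; lra|]. apply Rmult_le_compat_l; lra.
        * apply Rmult_le_compat_r with (r := 2 * (Cmod l + 1) * B) in Ha2.
          2:{ apply Rmult_le_pos; lra. }
          replace (eps / (2 * (Cmod l + 1) * B) * (2 * (Cmod l + 1) * B)) with eps in Ha2
            by (field; split; lra). lra.
    - intros t Ht. apply pcont_mult; auto. apply Fc; auto; lra.
    - intros t Ht. apply pcont_mult; auto. apply pcont_const.
    - intros t Ht. apply Ck. }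
  replace (Phi 1) with (F z + (Phi 1 - F z))%C by ring.
  rewrite (Cmod_eq_0 (Phi 1 - F z)%C); [ring|].
  pose proof (Cmod_ge_0 (Phi 1 - F z)%C). lra.
Qed.

(** * Power series *)

Definition clim (u : nat -> C) (l : C) : Prop :=
  forall eps, 0 < eps -> exists N, forall n, (N <= n)%nat -> Cmod (u n - l)%C <= eps.

Lemma clim_unique u l m : clim u l -> clim u m -> l = m.
Proof.
  intros A B. assert (E : Cmod (l - m)%C <= 0).
  { apply le_epsilon. intros eps He.
    destruct (A (eps / 2)) as [N1 H1]; [lra|]. destruct (B (eps / 2)) as [N2 H2]; [lra|].
    specialize (H1 (N1 + N2)%nat ltac:(lia)). specialize (H2 (N1 + N2)%nat ltac:(lia)).
    replace (l - m)%C with (- (u (N1 + N2)%nat - l) + (u (N1 + N2)%nat - m))%C by ring.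
    eapply Rle_trans; [apply Cmod_triangle|]. rewrite Cmod_opp. lra. }
  replace l with (m + (l - m))%C by ring.
  rewrite (Cmod_eq_0 (l - m)%C); [ring|]. pose proof (Cmod_ge_0 (l - m)%C). lra.
Qed.

Lemma clim_le u l c B N : clim u l -> (forall n, (N <= n)%nat -> Cmod (u n - c)%C <= B) ->
  Cmod (l - c)%C <= B.
Proof.
  intros A H. apply le_epsilon. intros eps He.
  destruct (A eps He) as [N1 H1]. specialize (H1 (N + N1)%nat ltac:(lia)).
  specialize (H (N + N1)%nat ltac:(lia)).
  replace (l - c)%C with (- (u (N + N1)%nat - l) + (u (N + N1)%nat - c))%C by ring.
  eapply Rle_trans; [apply Cmod_triangle|]. rewrite Cmod_opp. lra.
Qed.

Lemma taylor_clim a F : taylor_on_disc a F <->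
  forall z, unit_disc z -> clim (psum a z) (F z).
Proof.
  split; intros A z Hz.
  - exact (proj1 (is_pseries_psum _ _ _) (A z Hz)).
  - exact (proj2 (is_pseries_psum _ _ _) (A z Hz)).
Qed.

Lemma csum_geom_diff (u : nat -> C) (C0 q : R) n m : 0 <= q < 1 -> (forall k, (n <= k)%nat -> Cmod (u k) <= C0 * q ^ k) ->
  Cmod (csum u (n + m) - csum u n)%C <= C0 * q ^ n * ((1 - q ^ m) / (1 - q)).
Proof.
  intros Hq A. induction m.
  - rewrite Nat.add_0_r. replace (csum u n - csum u n)%C with (RtoC 0) by ring. rewrite Cmod_0.
    simpl. unfold Rdiv. rewrite Rminus_diag, !Rmult_0_l, Rmult_0_r. lra.
  - rewrite Nat.add_succ_r. simpl csum.
    replace (csum u (n + m) + u (n + m)%nat - csum u n)%C with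
      ((csum u (n + m) - csum u n) + u (n + m)%nat)%C by ring.
    eapply Rle_trans; [apply Cmod_triangle|].
    apply Rle_trans with (C0 * q ^ n * ((1 - q ^ m) / (1 - q)) + C0 * q ^ (n + m)).
    + apply Rplus_le_compat; auto. apply A; lia.
    + apply Req_le. rewrite pow_add. simpl. field. lra.
Qed.

Lemma csum_geom (u : nat -> C) (C0 q : R) n m : 0 <= C0 -> 0 <= q < 1 ->
  (forall k, (n <= k)%nat -> Cmod (u k) <= C0 * q ^ k) ->
  (n <= m)%nat -> Cmod (csum u m - csum u n)%C <= C0 * q ^ n / (1 - q).
Proof.
  intros HC Hq A Hnm. replace m with (n + (m - n))%nat by lia.
  eapply Rle_trans; [apply csum_geom_diff; eauto|].
  replace (C0 * q ^ n / (1 - q)) with (C0 * q ^ n * (1 / (1 - q))) by (field; lra).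
  apply Rmult_le_compat_l.
  - apply Rmult_le_pos; auto. apply pow_le; lra.
  - apply Rmult_le_compat_r.
    + left. apply Rinv_0_lt_compat. lra.
    + pose proof (pow_le q (m - n) (proj1 Hq)). lra.
Qed.

Lemma clim_geom (u : nat -> C) (C0 q : R) : 0 <= C0 -> 0 <= q < 1 ->
  (forall k, Cmod (u k) <= C0 * q ^ k) -> exists l, clim (csum u) l.
Proof.
  intros HC Hq A.
  assert (G : forall eps, 0 < eps -> exists N, forall n m, (N <= n)%nat -> (N <= m)%nat ->
     Cmod (csum u m - csum u n)%C <= eps).
  { intros eps He. destruct (geom_vanish (C0 / (1 - q)) q Hq (eps / 2)) as [N HN]; [lra|].
    exists N. intros n m Hn Hm.
    pose proof (csum_geom u C0 q N n HC Hq (fun k _ => A k) Hn) as B1.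
    pose proof (csum_geom u C0 q N m HC Hq (fun k _ => A k) Hm) as B2.
    specialize (HN N (le_n _)).
    replace (csum u m - csum u n)%C with ((csum u m - csum u N) + - (csum u n - csum u N))%C by ring.
    eapply Rle_trans; [apply Cmod_triangle|]. rewrite Cmod_opp.
    replace (C0 / (1 - q) * q ^ N) with (C0 * q ^ N / (1 - q)) in HN by (unfold Rdiv; ring). lra. }
  assert (Pr : forall h : C -> R, (forall x y, h (x - y)%C = h x - h y) ->
     (forall x, Rabs (h x) <= Cmod x) -> exists l, Un_cv (fun n => h (csum u n)) l).
  { intros h Hm Hb. destruct (Rcomplete.R_complete (fun n => h (csum u n))) as [l Hl]; [|exists l; exact Hl].
    intros eps He. destruct (G (eps / 2)) as [N HN]; [lra|]. exists N. intros n m Hn Hm'.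
    unfold R_dist. rewrite <- Hm. eapply Rle_lt_trans; [apply Hb|].
    specialize (HN m n ltac:(lia) ltac:(lia)). lra. }
  destruct (Pr Re) as [l1 H1].
  { intros x y. unfold Re; simpl; ring. }
  { apply re_le_Cmod. }
  destruct (Pr Im) as [l2 H2].
  { intros x y. unfold Im; simpl; ring. }
  { intros x. pose proof (Rmax_Cmod x). pose proof (Rmax_r (Rabs (fst x)) (Rabs (snd x))). unfold Im. lra. }
  exists (l1, l2). intros eps He.
  destruct (H1 (eps / 2)) as [N1 A1]; [lra|]. destruct (H2 (eps / 2)) as [N2 A2]; [lra|].
  exists (N1 + N2)%nat. intros n Hn. specialize (A1 n ltac:(lia)). specialize (A2 n ltac:(lia)).
  unfold R_dist in *.
  replace (csum u n - (l1, l2))%C with (RtoC (Re (csum u n) - l1) + Ci * RtoC (Im (csum u n) - l2))%C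
    by (apply injective_projections; unfold Re, Im; simpl; ring).
  eapply Rle_trans; [apply Cmod_triangle|]. rewrite Cmod_mult, !Cmod_R.
  replace (Cmod Ci) with 1; [lra|]. unfold Cmod, Ci; simpl.
  replace (0 * (0 * 1) + 1 * (1 * 1)) with 1 by ring. now rewrite sqrt_1.
Qed.

Lemma eventually_bounded (v : nat -> R) M N : (forall n, (N <= n)%nat -> v n <= M) ->
  exists C0, 0 <= C0 /\ forall n, v n <= C0.
Proof.
  revert M. induction N; intros M A.
  - exists (Rmax M 0). split; [apply Rmax_r|]. intros n.
    eapply Rle_trans; [apply A; lia|apply Rmax_l].
  - apply (IHN (Rmax M (v N))). intros n Hn.
    destruct (Nat.eq_dec n N) as [->|Hne]; [apply Rmax_r|].
    eapply Rle_trans; [apply A; lia|apply Rmax_l].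
Qed.

(** Terms are differences of consecutive partial sums, which eventually lie within 1 of the
    limit. *)
Lemma clim_terms_bounded a z l : clim (psum a z) l ->
  exists C0, 0 <= C0 /\ forall k, Cmod (a k) * Cmod z ^ k <= C0.
Proof.
  intros A. destruct (A 1 Rlt_0_1) as [N HN].
  apply (eventually_bounded _ 2 N). intros n Hn.
  pose proof (HN n Hn) as H1. pose proof (HN (S n) ltac:(lia)) as H2.
  rewrite <- Cmod_pow, <- Cmod_mult. unfold psum in *. simpl csum in H2.
  replace (a n * z ^ n)%C with ((csum (fun k => a k * z ^ k) n + a n * z ^ n - l) -
    (csum (fun k => a k * z ^ k) n - l))%C by ring.
  unfold Cminus at 1. eapply Rle_trans; [apply Cmod_triangle|]. rewrite Cmod_opp. lra.
Qed.

Lemma coef_bound a F r : taylor_on_disc a F -> 0 < r < 1 ->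
  exists C0, 0 <= C0 /\ forall k, Cmod (a k) <= C0 * (/ r) ^ k.
Proof.
  intros T Hr. assert (U : unit_disc (RtoC r)).
  { unfold unit_disc. rewrite Cmod_R, Rabs_pos_eq; lra. }
  destruct (clim_terms_bounded a r (F r)) as (C0 & P & B).
  { exact (proj1 (taylor_clim a F) T _ U). }
  exists C0. split; auto. intros k. specialize (B k). rewrite Cmod_R, Rabs_pos_eq in B by lra.
  rewrite pow_inv. assert (0 < r ^ k) by (apply pow_lt; lra).
  apply Rmult_le_reg_r with (r ^ k); auto. rewrite Rmult_assoc, Rinv_l by lra. lra.
Qed.

Lemma psum_0 a n : (1 <= n)%nat -> psum a (RtoC 0) n = a O.
Proof.
  intros Hn. destruct n; [lia|]. unfold psum. rewrite csum_S_l.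
  rewrite (csum_ext _ (fun _ => RtoC 0 * 0)%C).
  - rewrite csum_scal. simpl. ring.
  - intros k _. rewrite Cpow_S. ring.
Qed.

Lemma psum_shift a z n : psum a z (S n) = (a O + z * psum (fun k => a (S k)) z n)%C.
Proof.
  unfold psum. rewrite csum_S_l, <- csum_scal. f_equal; [simpl; ring|].
  apply csum_ext. intros k _. rewrite Cpow_S. ring.
Qed.

Lemma pseries_at_0 a l : clim (psum a (RtoC 0)) l -> l = a O.
Proof.
  intros A. apply (clim_unique (psum a (RtoC 0))); auto. intros eps He. exists 1%nat.
  intros n Hn. rewrite psum_0 by auto. replace (a O - a O)%C with (RtoC 0) by ring. rewrite Cmod_0. lra.
Qed.

Lemma clim_shift a z l : z <> RtoC 0 -> clim (psum a z) l ->
  clim (psum (fun k => a (S k)) z) ((l - a O) / z)%C.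
Proof.
  intros Hz A eps He. assert (P : 0 < Cmod z) by (apply Cmod_gt_0; auto).
  destruct (A (eps * Cmod z)) as [N HN]; [apply Rmult_lt_0_compat; auto|].
  exists N. intros n Hn. specialize (HN (S n) ltac:(lia)). rewrite psum_shift in HN.
  replace (a O + z * psum (fun k => a (S k)) z n - l)%C with
    (z * (psum (fun k => a (S k)) z n - (l - a O) / z))%C in HN by (field; auto).
  rewrite Cmod_mult in HN. apply Rmult_le_reg_l with (Cmod z); auto. lra.
Qed.

(** The induction keeps the series arbitrary. After division by z the shifted series sums to 0 off
    the origin, and its value at 0, the coefficient a 1, is a limit of such values; so the
    hypothesis holds again on the full disc. *)
Lemma pseries_zero_unique n : forall a r, 0 < r ->
  (forall z, Cmod z < r -> clim (psum a z) (RtoC 0)) -> a n = RtoC 0.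
Proof.
  induction n; intros a r Hr A.
  - symmetry. apply (pseries_at_0 a). apply A. rewrite Cmod_0. lra.
  - assert (A0 : a O = RtoC 0).
    { symmetry. apply (pseries_at_0 a). apply A. rewrite Cmod_0. lra. }
    assert (B : forall z, Cmod z < r -> z <> RtoC 0 -> clim (psum (fun k => a (S k)) z) (RtoC 0)).
    { intros z Hz Hn. replace (RtoC 0) with ((0 - a O) / z)%C by (rewrite A0; field; auto).
      apply clim_shift; auto. }
    assert (A1 : a 1%nat = RtoC 0).
    { destruct (clim_terms_bounded (fun k => a (S k)) (RtoC (r / 2)) (RtoC 0)) as (C0 & P & Bd).
      { apply B; [rewrite Cmod_R, Rabs_pos_eq; lra|]. apply RtoC_neq_0; lra. }
      assert (E : Cmod (a 1%nat) <= 0).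
      { apply le_epsilon. intros eps He. rewrite Rplus_0_l.
        (* The tail beyond a 1 is at most C0 q / (1 - q) with q = 2 x / r <= 1 / 2, hence at most 4
           C0 x / r, which this x makes at most eps. *)
        set (x := Rmin (r / 4) (eps * r / (4 * (C0 + 1)))).
        assert (Px : 0 < x).
        { apply Rmin_pos; [lra|]. apply Rdiv_lt_0_compat; [nra|lra]. }
        assert (X1 : x <= r / 4) by apply Rmin_l.
        assert (X2 : x <= eps * r / (4 * (C0 + 1))) by apply Rmin_r.
        set (q := x / (r / 2)).
        assert (Hq : 0 <= q <= / 2).
        { unfold q. split; [apply Rdiv_le_0_compat; lra|].
          apply Rmult_le_reg_r with (r / 2); [lra|]. unfold Rdiv. rewrite Rmult_assoc, Rinv_l; lra. }
        assert (Hx : clim (psum (fun k => a (S k)) x) (RtoC 0)).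
        { apply B; [rewrite Cmod_R, Rabs_pos_eq; lra|]. apply RtoC_neq_0; lra. }
        pose proof (clim_le _ _ (a 1%nat) (C0 * q ^ 1 / (1 - q)) 1%nat Hx) as L.
        replace (0 - a 1%nat)%C with (- a 1%nat)%C in L by ring. rewrite Cmod_opp in L.
        eapply Rle_trans; [apply L|].
        - intros m Hm. unfold psum.
          pose proof (csum_geom (fun k => a (S k) * x ^ k)%C C0 q 1 m P ltac:(lra)) as G.
          replace (csum (fun k => a (S k) * x ^ k)%C 1) with (a 1%nat) in G by (simpl; ring).
          apply G; auto. intros k _. rewrite Cmod_mult, Cmod_pow, Cmod_R, Rabs_pos_eq by lra.
          specialize (Bd k). rewrite Cmod_R, Rabs_pos_eq in Bd by lra.
          unfold q, Rdiv. rewrite Rpow_mult_distr, pow_inv.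
          assert (0 < (r / 2) ^ k) by (apply pow_lt; lra).
          apply Rmult_le_reg_r with ((r / 2) ^ k); auto.
          replace (C0 * (x ^ k * / (r * / 2) ^ k) * (r / 2) ^ k) with (C0 * x ^ k)
            by (unfold Rdiv in *; field; lra).
          assert (0 <= x ^ k) by (apply pow_le; lra). nra.
        - rewrite pow_1. apply Rle_trans with (C0 * q / (1 / 2)).
          + unfold Rdiv. apply Rmult_le_compat_l; [apply Rmult_le_pos; lra|].
            apply Rinv_le_contravar; lra.
          + unfold q. replace (C0 * (x / (r / 2)) / (1 / 2)) with (4 * C0 / r * x) by (field; lra).
            apply Rle_trans with (4 * C0 / r * (eps * r / (4 * (C0 + 1)))).
            * apply Rmult_le_compat_l; auto. apply Rdiv_le_0_compat; lra.
            * replace (4 * C0 / r * (eps * r / (4 * (C0 + 1)))) with (eps * (C0 / (C0 + 1))) by (field; lra).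
              rewrite <- (Rmult_1_r eps) at 2. apply Rmult_le_compat_l; [lra|].
              apply Rmult_le_reg_r with (C0 + 1); [lra|]. unfold Rdiv. rewrite Rmult_assoc, Rinv_l; lra. }
      apply Cmod_eq_0. pose proof (Cmod_ge_0 (a 1%nat)). lra. }
    apply (IHn (fun k => a (S k)) r Hr). intros z Hz.
    destruct (classic (z = RtoC 0)) as [->|Hn]; auto.
    intros eps He. exists 1%nat. intros m Hm. rewrite psum_0 by auto. rewrite A1.
    replace (0 - 0)%C with (RtoC 0) by ring. rewrite Cmod_0. lra.
Qed.

Lemma clim_plus u v l m : clim u l -> clim v m -> clim (fun n => u n + v n)%C (l + m)%C.
Proof.
  intros A B eps He.
  destruct (A (eps / 2)) as [N1 H1]; [lra|]. destruct (B (eps / 2)) as [N2 H2]; [lra|].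
  exists (N1 + N2)%nat. intros n Hn. specialize (H1 n ltac:(lia)). specialize (H2 n ltac:(lia)).
  replace (u n + v n - (l + m))%C with ((u n - l) + (v n - m))%C by ring.
  eapply Rle_trans; [apply Cmod_triangle|]. lra.
Qed.

Lemma clim_scal c u l : clim u l -> clim (fun n => c * u n)%C (c * l)%C.
Proof.
  intros A eps He. pose proof (Cmod_ge_0 c).
  destruct (A (eps / (Cmod c + 1))) as [N HN]; [apply Rdiv_lt_0_compat; lra|].
  exists N. intros n Hn. specialize (HN n Hn).
  replace (c * u n - c * l)%C with (c * (u n - l))%C by ring. rewrite Cmod_mult.
  apply Rle_trans with ((Cmod c + 1) * (eps / (Cmod c + 1))).
  - apply Rmult_le_compat; try lra. apply Cmod_ge_0.
  - apply Req_le. field. lra.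
Qed.

Lemma clim_ext u v l : (forall n, u n = v n) -> clim u l -> clim v l.
Proof.
  intros E A eps He. destruct (A eps He) as [N HN]. exists N. intros n Hn.
  rewrite <- E. auto.
Qed.

Lemma pseries_unique a b r (F : C -> C) : 0 < r ->
  (forall z, Cmod z < r -> clim (psum a z) (F z)) ->
  (forall z, Cmod z < r -> clim (psum b z) (F z)) -> forall n, a n = b n.
Proof.
  intros Hr A B n.
  assert (E : (a n + - (1) * b n)%C = RtoC 0).
  { apply (pseries_zero_unique n (fun k => a k + - (1) * b k)%C r Hr). intros z Hz.
    apply clim_ext with (fun n => psum a z n + - (1) * psum b z n)%C.
    - intros m. unfold psum. rewrite <- csum_scal, <- csum_plus. apply csum_ext. intros; ring.
    - replace (RtoC 0) with (F z + - (1) * F z)%C by ring.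
      apply clim_plus; auto. apply clim_scal; auto. }
  replace (a n) with (a n + - (1) * b n + b n)%C by ring. rewrite E. ring.
Qed.

Lemma taylor_unique a b F : taylor_on_disc a F -> taylor_on_disc b F -> forall n, a n = b n.
Proof.
  intros A B. apply (pseries_unique a b 1 F); [lra| |]; intros z Hz;
    [apply (proj1 (taylor_clim a F) A)|apply (proj1 (taylor_clim b F) B)]; exact Hz.
Qed.

Lemma taylor_ext a b F G : (forall n, a n = b n) -> (forall z, unit_disc z -> F z = G z) ->
  taylor_on_disc a F -> taylor_on_disc b G.
Proof.
  intros E1 E2 A. apply taylor_clim. intros z Hz. rewrite <- E2 by auto.
  apply clim_ext with (psum a z); [|apply (proj1 (taylor_clim a F) A), Hz].
  intros n. apply csum_ext. intros k _. now rewrite E1.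
Qed.

Lemma taylor_plus a b F G : taylor_on_disc a F -> taylor_on_disc b G ->
  taylor_on_disc (fun n => a n + b n)%C (fun z => F z + G z)%C.
Proof.
  intros A B. apply taylor_clim. intros z Hz.
  apply clim_ext with (fun n => psum a z n + psum b z n)%C.
  - intros n. unfold psum. rewrite <- csum_plus. apply csum_ext. intros; ring.
  - apply clim_plus; [apply (proj1 (taylor_clim a F) A)|apply (proj1 (taylor_clim b G) B)]; auto.
Qed.

Lemma taylor_scal c a F : taylor_on_disc a F ->
  taylor_on_disc (fun n => c * a n)%C (fun z => c * F z)%C.
Proof.
  intros A. apply taylor_clim. intros z Hz.
  apply clim_ext with (fun n => c * psum a z n)%C.
  - intros n. unfold psum. rewrite <- csum_scal. apply csum_ext. intros; ring.
  - apply clim_scal, (proj1 (taylor_clim a F) A), Hz.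
Qed.

Lemma taylor_0 a F : taylor_on_disc a F -> a O = F (RtoC 0).
Proof.
  intros A. symmetry. apply pseries_at_0, (proj1 (taylor_clim a F) A).
  unfold unit_disc. rewrite Cmod_0. lra.
Qed.

(** Cauchy's coefficients are defined on one circle. Two radii give series with the same sum on |z|
    < 1 / 2, so uniqueness identifies them and the coefficients at radius 1 / 2 serve on the whole
    disc. *)
Lemma taylor_exists F : holo F -> exists a, taylor_on_disc a F.
Proof.
  intros HF.
  assert (S : forall rho z, 0 < rho < 1 -> Cmod z < rho ->
     clim (psum (coef rho (fun t => F (circ rho t))) z) (F z)).
  { intros rho z Hr Hz.
    destruct (continuous_bounded _ (circle_contin F rho HF ltac:(lra))) as (M & _ & HM).
    pose proof (cauchy_kernel_pseries (fun t => F (circ rho t)) rho M z ltac:(lra) Hz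
      (circle_contin F rho HF ltac:(lra)) HM) as A.
    cbv beta in A. rewrite (cauchy_formula F rho z HF Hr Hz) in A. exact (proj1 (is_pseries_psum _ _ _) A). }
  exists (coef (1 / 2) (fun t => F (circ (1 / 2) t))).
  apply taylor_clim. intros z Hz. unfold unit_disc in Hz. pose proof (Cmod_ge_0 z).
  set (rho := Rmax (1 / 2) ((1 + Cmod z) / 2)).
  assert (Hr : 1 / 2 <= rho < 1).
  { split; [apply Rmax_l|]. apply Rmax_lub_lt; lra. }
  assert (Hz2 : Cmod z < rho) by (eapply Rlt_le_trans; [|apply Rmax_r]; lra).
  apply clim_ext with (psum (coef rho (fun t => F (circ rho t))) z).
  - intros n. apply csum_ext. intros k _. f_equal.
    apply (pseries_unique _ _ (1 / 2) F); [lra| |]; intros w Hw; apply S; lra.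
  - apply S; lra.
Qed.

Lemma taylor_coef a F rho : holo F -> taylor_on_disc a F -> 0 < rho < 1 ->
  forall n, a n = coef rho (fun t => F (circ rho t)) n.
Proof.
  intros HF A Hr.
  destruct (continuous_bounded _ (circle_contin F rho HF ltac:(lra))) as (M & _ & HM).
  apply (pseries_unique _ _ rho F); [lra| |]; intros z Hz.
  - apply (proj1 (taylor_clim a F) A). unfold unit_disc. lra.
  - pose proof (cauchy_kernel_pseries (fun t => F (circ rho t)) rho M z ltac:(lra) Hz
      (circle_contin F rho HF ltac:(lra)) HM) as B.
    cbv beta in B. rewrite (cauchy_formula F rho z HF Hr Hz) in B. exact (proj1 (is_pseries_psum _ _ _) B).
Qed.

Lemma mean_value F rho : holo F -> 0 < rho < 1 -> circle_mean (fun t => F (circ rho t)) = F (RtoC 0).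
Proof.
  intros HF Hr. rewrite <- (cauchy_formula F rho (RtoC 0) HF Hr) by (rewrite Cmod_0; lra).
  apply circle_mean_ext. intros t _. field. replace (circ rho t - 0)%C with (circ rho t) by ring.
  apply circ_neq_0. lra.
Qed.

Lemma binomial_two_terms (r d : R) k : 0 <= r -> 0 <= d ->
  r ^ S k + INR (S k) * r ^ k * d <= (r + d) ^ S k.
Proof.
  intros Hr Hd. induction k.
  - simpl. lra.
  - replace ((r + d) ^ S (S k)) with ((r + d) * (r + d) ^ S k) by reflexivity.
    apply Rle_trans with ((r + d) * (r ^ S k + INR (S k) * r ^ k * d)).
    + rewrite (S_INR (S k)). assert (0 <= r ^ k) by (apply pow_le; auto).
      pose proof (pos_INR (S k)). simpl pow.
      assert (0 <= INR (S k) * r ^ k * (d * d)) by (repeat apply Rmult_le_pos; auto). nra.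
    + apply Rmult_le_compat_l; lra.
Qed.

(** The second-order remainders of a power at z and at r obey the same recursion, with increments h
    and d; the complex one is majorised by the real one scaled by |h|^2 / d^2. *)
Lemma Cpow_second_difference (z h : C) (r d : R) k : 0 <= d -> Cmod z <= r -> Cmod (z + h)%C <= r ->
  Cmod ((z + h) ^ S k - z ^ S k - RtoC (INR (S k)) * z ^ k * h)%C * (d * d)
    <= Cmod h * Cmod h * ((r + d) ^ S k - r ^ S k - INR (S k) * r ^ k * d).
Proof.
  intros Hd Hz Hzh. pose proof (Cmod_ge_0 z). pose proof (Cmod_ge_0 h). induction k.
  - replace ((z + h) ^ 1 - z ^ 1 - RtoC (INR 1) * z ^ 0 * h)%C with (RtoC 0)
      by (simpl; ring).
    rewrite Cmod_0. simpl. nra.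
  - set (e := ((z + h) ^ S k - z ^ S k - RtoC (INR (S k)) * z ^ k * h)%C) in *.
    replace ((z + h) ^ S (S k) - z ^ S (S k) - RtoC (INR (S (S k))) * z ^ S k * h)%C
      with ((z + h) * e + RtoC (INR (S k)) * z ^ k * (h * h))%C.
    2:{ unfold e. rewrite (S_INR (S k)), RtoC_plus, !Cpow_S. ring. }
    apply Rle_trans with ((r * Cmod e + INR (S k) * r ^ k * (Cmod h * Cmod h)) * (d * d)).
    + apply Rmult_le_compat_r; [nra|]. eapply Rle_trans; [apply Cmod_triangle|].
      rewrite !Cmod_mult, Cmod_R, Cmod_pow, Rabs_pos_eq by apply pos_INR.
      apply Rplus_le_compat.
      * apply Rmult_le_compat_r; auto. apply Cmod_ge_0.
      * apply Rmult_le_compat_r; [nra|]. apply Rmult_le_compat_l; [apply pos_INR|].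
        apply pow_incr; auto.
    + assert (Hr : 0 <= r) by lra.
      pose proof (binomial_two_terms r d k Hr Hd) as Bn.
      set (X := (r + d) ^ S k) in *.
      replace ((r + d) ^ S (S k)) with ((r + d) * X) by reflexivity.
      set (Y := r ^ k) in *. replace (r ^ S (S k)) with (r * (r * Y)) by reflexivity.
      replace (r ^ S k) with (r * Y) in * by reflexivity.
      rewrite (S_INR (S k)). set (n := INR (S k)) in *.
      set (hh := Cmod h * Cmod h) in *. assert (0 <= hh) by (unfold hh; nra).
      apply Rle_trans with (r * (hh * (X - r * Y - n * Y * d)) + n * Y * hh * (d * d)); [nra|].
      assert (0 <= hh * d * (X - r * Y - n * Y * d)) by (apply Rmult_le_pos; [nra|lra]). nra.
Qed.

(** Coefficients are bounded on radius r + 2 d, while the derived series and the second-order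
    remainder are both controlled on radius r + d; one geometric majorant then justifies termwise
    differentiation. *)
Lemma taylor_derivative a F : taylor_on_disc a F -> forall z, unit_disc z ->
  exists l, clim (psum (fun k => RtoC (INR (S k)) * a (S k))%C z) l /\ cder F z l.
Proof.
  intros T z Hz. unfold unit_disc in Hz. pose proof (Cmod_ge_0 z) as Pz.
  set (r := (1 + Cmod z) / 2). set (d := (1 - r) / 3).
  assert (Hr : Cmod z < r < 1) by (unfold r; lra).
  assert (Hd : 0 < d) by (unfold d; lra).
  assert (HR : 0 < r + 2 * d < 1) by (unfold d; lra).
  destruct (coef_bound a F (r + 2 * d) T HR) as (C0 & PC & Bd).
  set (q := (r + d) / (r + 2 * d)).
  assert (Hq : 0 <= q < 1).
  { unfold q. split; [apply Rdiv_le_0_compat; lra|].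
    apply Rmult_lt_reg_r with (r + 2 * d); [lra|]. unfold Rdiv. rewrite Rmult_assoc, Rinv_l; lra. }
  assert (Eq : forall k, (r + d) ^ k * (/ (r + 2 * d)) ^ k = q ^ k).
  { intros k. rewrite <- Rpow_mult_distr. reflexivity. }
  assert (Bq : forall k x, 0 <= x -> x <= (r + d) ^ S k -> Cmod (a (S k)) * x <= C0 * q * q ^ k).
  { intros k x Px Hx. apply Rle_trans with (C0 * (/ (r + 2 * d)) ^ S k * (r + d) ^ S k).
    - apply Rmult_le_compat; auto. apply Cmod_ge_0.
    - apply Req_le. rewrite Rmult_assoc, (Rmult_comm (_ ^ _)), Eq. simpl. ring. }
  destruct (clim_geom (fun k => RtoC (INR (S k)) * a (S k) * z ^ k)%C (C0 * q / d) q) as [l Hl]; auto.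
  { apply Rdiv_le_0_compat; auto. apply Rmult_le_pos; lra. }
  { intros k. rewrite !Cmod_mult, Cmod_R, Cmod_pow, Rabs_pos_eq by apply pos_INR.
    apply Rmult_le_reg_r with d; auto.
    replace (C0 * q / d * q ^ k * d) with (C0 * q * q ^ k) by (field; lra).
    replace (INR (S k) * Cmod (a (S k)) * Cmod z ^ k * d) with
      (Cmod (a (S k)) * (INR (S k) * Cmod z ^ k * d)) by ring.
    apply Bq.
    - repeat apply Rmult_le_pos; try lra; [apply pos_INR|apply pow_le; lra].
    - pose proof (binomial_two_terms r d k ltac:(lra) ltac:(lra)).
      assert (Cmod z ^ k <= r ^ k) by (apply pow_incr; lra).
      assert (0 <= r ^ S k) by (apply pow_le; lra).
      assert (INR (S k) * Cmod z ^ k * d <= INR (S k) * r ^ k * d).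
      { apply Rmult_le_compat_r; [lra|]. apply Rmult_le_compat_l; auto. apply pos_INR. }
      lra. }
  exists l. split; [exact Hl|].
  set (B := C0 * q / (d * d) / (1 - q)).
  assert (PB : 0 <= B).
  { unfold B. repeat apply Rdiv_le_0_compat; try nra. }
  intros eps He. exists (Rmin ((1 - Cmod z) / 2) (eps / (B + 1))).
  split; [apply Rmin_pos; [lra|apply Rdiv_lt_0_compat; lra]|]. intros h Hh.
  assert (H1 : Cmod h < (1 - Cmod z) / 2) by (eapply Rlt_le_trans; [exact Hh|apply Rmin_l]).
  assert (H2 : Cmod h < eps / (B + 1)) by (eapply Rlt_le_trans; [exact Hh|apply Rmin_r]).
  assert (Hzh : Cmod (z + h)%C <= r).
  { eapply Rle_trans; [apply Cmod_triangle|]. unfold r. lra. }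
  pose proof (Cmod_ge_0 h) as Ph.
  assert (Lim : clim (fun n => psum a (z + h)%C (S n) + (- (1) * psum a z (S n) + - h * csum (fun k => RtoC (INR (S k)) * a (S k) * z ^ k) n))%C
     (F (z + h) + (- (1) * F z + - h * l))%C).
  { assert (Sh : forall u m, clim u m -> clim (fun n => u (S n)) m).
    { intros u m A e Pe. destruct (A e Pe) as [N HN]. exists N. intros n Hn. apply HN. lia. }
    apply clim_plus; [|apply clim_plus; apply clim_scal; auto].
    - apply (Sh (psum a (z + h)%C)). apply (proj1 (taylor_clim a F) T (z + h)%C). unfold unit_disc. lra.
    - apply (Sh (psum a z)). exact (proj1 (taylor_clim a F) T z Hz). }
  assert (Fin : Cmod (F (z + h) - F z - l * h)%C <= B * (Cmod h * Cmod h)).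
  { replace (F (z + h)%C - F z - l * h)%C with ((F (z + h) + (- (1) * F z + - h * l)) - 0)%C by ring.
    apply (clim_le _ _ (RtoC 0) _ 0%nat Lim). intros n _.
    set (e := fun k => (a (S k) * ((z + h) ^ S k - z ^ S k - RtoC (INR (S k)) * z ^ k * h))%C).
    assert (Es : forall n, (psum a (z + h)%C (S n) + (- (1) * psum a z (S n) + - h * csum (fun k => RtoC (INR (S k)) * a (S k) * z ^ k) n))%C
       = csum e n).
    { intros m. unfold psum. induction m.
      - simpl. ring.
      - change (csum e (S m)) with (csum e m + e m)%C. rewrite <- IHm.
        cbn [csum]. unfold e. ring. }
    rewrite Es. change (RtoC 0) with (csum e 0).
    assert (PC1 : 0 <= C0 * q / (d * d) * (Cmod h * Cmod h)).
    { apply Rmult_le_pos; [apply Rdiv_le_0_compat; [apply Rmult_le_pos; lra|nra]|nra]. }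
    assert (Be : forall k, (0 <= k)%nat -> Cmod (e k) <= C0 * q / (d * d) * (Cmod h * Cmod h) * q ^ k).
    { intros k _. unfold e. rewrite Cmod_mult.
      apply Rmult_le_reg_r with (d * d); [nra|].
      replace (C0 * q / (d * d) * (Cmod h * Cmod h) * q ^ k * (d * d)) with
        (C0 * q * q ^ k * (Cmod h * Cmod h)) by (field; lra).
      rewrite Rmult_assoc.
      apply Rle_trans with (Cmod (a (S k)) * (Cmod h * Cmod h * (r + d) ^ S k)).
      + apply Rmult_le_compat_l; [apply Cmod_ge_0|].
        eapply Rle_trans; [apply (Cpow_second_difference z h r d k); lra|].
        apply Rmult_le_compat_l; [nra|].
        assert (0 <= r ^ S k) by (apply pow_le; lra).
        assert (0 <= INR (S k) * r ^ k * d)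
          by (repeat apply Rmult_le_pos; try lra; [apply pos_INR|apply pow_le; lra]). lra.
      + replace (Cmod (a (S k)) * (Cmod h * Cmod h * (r + d) ^ S k)) with
          (Cmod (a (S k)) * (r + d) ^ S k * (Cmod h * Cmod h)) by ring.
        apply Rmult_le_compat_r; [nra|]. apply Bq; [apply pow_le; lra|lra]. }
    eapply Rle_trans; [apply (csum_geom e _ q 0 n PC1 Hq Be); lia|].
    apply Req_le. unfold B. simpl. field. split; lra. }
  eapply Rle_trans; [exact Fin|]. rewrite <- Rmult_assoc. apply Rmult_le_compat_r; auto.
  apply Rle_trans with ((B + 1) * (eps / (B + 1))); [apply Rmult_le_compat; lra|].
  apply Req_le. field. lra.
Qed.

Lemma taylor_holo a F : taylor_on_disc a F -> holo F.
Proof. intros T z Hz. destruct (taylor_derivative a F T z Hz) as (l & _ & D). now exists l. Qed.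

Lemma holo_C_derive F : holo F -> forall z, unit_disc z -> cder F z (C_derive F z).
Proof.
  intros HF z Hz. destruct (HF z Hz) as [l Hl].
  rewrite (is_C_derive_unique F z l); auto. apply cder_is_derive, Hl.
Qed.

Lemma taylor_C_derive a F : taylor_on_disc a F ->
  taylor_on_disc (fun k => RtoC (INR (S k)) * a (S k))%C (C_derive F).
Proof.
  intros T. apply taylor_clim. intros z Hz.
  destruct (taylor_derivative a F T z Hz) as (l & A & D).
  rewrite (is_C_derive_unique F z l); auto. apply cder_is_derive, D.
Qed.

Lemma C_derive_unique F z l : cder F z l -> C_derive F z = l.
Proof. intros D. apply is_C_derive_unique, cder_is_derive, D. Qed.

Lemma holo_derive F : holo F -> holo (C_derive F).
Proof.
  intros HF. destruct (taylor_exists F HF) as [a T]. eapply taylor_holo, taylor_C_derive, T.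
Qed.

(** The quotient (F z - a 0) / z is completed at the origin by its limit a 1. Iterated, this divides
    out zeros at 0. *)
Lemma taylor_shift a F : taylor_on_disc a F ->
  exists F1, taylor_on_disc (fun k => a (S k)) F1 /\
    forall z, unit_disc z -> F z = (a O + z * F1 z)%C.
Proof.
  intros T.
  exists (fun z => match excluded_middle_informative (z = RtoC 0) with
                   | left _ => a 1%nat | right _ => ((F z - a O) / z)%C end).
  split.
  - apply taylor_clim. intros z Hz. destruct (excluded_middle_informative _) as [->|Hn].
    + intros eps He. exists 1%nat. intros n Hn. rewrite psum_0 by auto.
      replace (a 1%nat - a 1%nat)%C with (RtoC 0) by ring. rewrite Cmod_0; lra.
    + apply clim_shift; auto. exact (proj1 (taylor_clim a F) T z Hz).
  - intros z Hz. destruct (excluded_middle_informative _) as [->|Hn].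
    + rewrite (taylor_0 a F T). ring.
    + field; auto.
Qed.

Lemma taylor_zmul a F : taylor_on_disc a F ->
  taylor_on_disc (fun n => match n with O => RtoC 0 | S k => a k end) (fun z => z * F z)%C.
Proof.
  intros T. apply taylor_clim. intros z Hz.
  assert (A := clim_scal z _ _ (proj1 (taylor_clim a F) T z Hz)).
  intros eps He. destruct (A eps He) as [N HN]. exists (S N). intros [|n] Hn; [lia|].
  rewrite psum_shift. rewrite Cplus_0_l. apply HN. lia.
Qed.

Definition cauchy_prod (a b : nat -> C) (n : nat) : C := csum (fun k => a k * b (n - k)%nat)%C (S n).

(** Splitting F = a 0 + z F1 lowers the index by one, since the coefficient of z F1 G at n + 1 is
    that of F1 G at n. No double series is rearranged. *)
Lemma taylor_mult_coef n : forall a F b G c,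
  taylor_on_disc a F -> taylor_on_disc b G -> taylor_on_disc c (fun z => F z * G z)%C ->
  c n = cauchy_prod a b n.
Proof.
  induction n; intros a F b G c TF TG TC.
  - unfold cauchy_prod. simpl. rewrite (taylor_0 _ _ TC), (taylor_0 _ _ TF), (taylor_0 _ _ TG). ring.
  - destruct (taylor_shift a F TF) as (F1 & T1 & E1).
    destruct (taylor_exists (fun z => F1 z * G z)%C) as [c' Tc'].
    { apply holo_mult; eapply taylor_holo; eauto. }
    pose proof (taylor_plus _ _ _ _ (taylor_scal (a O) _ _ TG) (taylor_zmul _ _ Tc')) as T2.
    assert (T3 : taylor_on_disc (fun n => a O * b n + match n with O => RtoC 0 | S k => c' k end)%C
      (fun z => F z * G z)%C).
    { refine (taylor_ext _ _ _ _ (fun n => eq_refl) _ T2).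
      intros z Hz. rewrite (E1 z Hz). ring. }
    rewrite (taylor_unique _ _ _ TC T3 (S n)).
    rewrite (IHn _ _ _ _ _ T1 TG Tc').
    unfold cauchy_prod. rewrite (csum_S_l _ (S n)). simpl Nat.sub. reflexivity.
Qed.

Lemma taylor_mult a F b G : taylor_on_disc a F -> taylor_on_disc b G ->
  taylor_on_disc (cauchy_prod a b) (fun z => F z * G z)%C.
Proof.
  intros TF TG. destruct (taylor_exists (fun z => F z * G z)%C) as [c Tc].
  { apply holo_mult; eapply taylor_holo; eauto. }
  apply taylor_ext with c (fun z => F z * G z)%C; auto.
  intros n. eapply taylor_mult_coef; eauto.
Qed.

(** Division of the coefficients by k + 1 does not enlarge them, so the integrated series converges
    on the disc; its sum is selected by choice. *)
Lemma primitive_exists G : holo G -> exists P, holo P /\ P (RtoC 0) = RtoC 0 /\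
  forall z, unit_disc z -> cder P z (G z).
Proof.
  intros HG. destruct (taylor_exists G HG) as [b Tb].
  set (p := fun n => match n with O => RtoC 0 | S k => (b k / RtoC (INR (S k)))%C end).
  assert (Ex : forall z, unit_disc z -> exists l, clim (psum p z) l).
  { intros z Hz. unfold unit_disc in Hz. pose proof (Cmod_ge_0 z).
    set (r := (1 + Cmod z) / 2). assert (Hr : 0 < r < 1) by (unfold r; lra).
    destruct (coef_bound b G r Tb Hr) as (C0 & PC & Bd).
    apply (clim_geom (fun k => p k * z ^ k)%C (C0 * r) (Cmod z / r)).
    - nra.
    - split; [apply Rdiv_le_0_compat; lra|].
      apply Rmult_lt_reg_r with r; [lra|]. unfold Rdiv. rewrite Rmult_assoc, Rinv_l; unfold r; lra.
    - intros k. rewrite Cmod_mult, Cmod_pow.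
      assert (Pr : 0 < r ^ k) by (apply pow_lt; lra).
      assert (Pzk : 0 <= Cmod z ^ k) by (apply pow_le; lra).
      replace (C0 * r * (Cmod z / r) ^ k) with (C0 * r * / r ^ k * Cmod z ^ k)
        by (unfold Rdiv; rewrite Rpow_mult_distr, pow_inv; ring).
      apply Rmult_le_compat_r; auto.
      destruct k as [|k].
      + simpl. rewrite Cmod_0. rewrite Rinv_1. nra.
      + unfold p. assert (PI : 0 < INR (S k)) by (apply lt_0_INR; lia).
        rewrite Cmod_div by (apply RtoC_neq_0; lra). rewrite Cmod_R, Rabs_pos_eq by lra.
        apply Rle_trans with (Cmod (b k)).
        * apply Rmult_le_reg_r with (INR (S k)); auto. unfold Rdiv. rewrite Rmult_assoc, Rinv_l by lra.
          apply Rmult_le_compat_l; [apply Cmod_ge_0|]. rewrite S_INR. pose proof (pos_INR k). lra.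
        * eapply Rle_trans; [apply Bd|]. rewrite pow_inv. simpl in *.
          assert (0 < r ^ k) by (apply pow_lt; lra). apply Req_le. field. split; lra. }
  set (P := fun z => epsilon (inhabits (RtoC 0)) (fun l => clim (psum p z) l)).
  assert (TP : taylor_on_disc p P).
  { apply taylor_clim. intros z Hz. unfold P. apply epsilon_spec, Ex, Hz. }
  exists P. split; [eapply taylor_holo; eauto|]. split.
  - rewrite <- (taylor_0 _ _ TP). reflexivity.
  - intros z Hz. destruct (taylor_derivative p P TP z Hz) as (l & A & D).
    replace (G z) with l; auto. eapply clim_unique; [exact A|].
    apply clim_ext with (psum b z); [|exact (proj1 (taylor_clim b G) Tb _ Hz)].
    intros n. apply csum_ext. intros k _. unfold p.
    assert (PI : 0 < INR (S k)) by (apply lt_0_INR; lia). field. apply RtoC_neq_0; lra.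
Qed.

(** * Logarithms, the maximum principle and open mapping *)

Definition cexp (z : C) : C := (RtoC (exp (Re z)) * cis (Im z))%C.

Lemma cexp_plus z w : cexp (z + w) = (cexp z * cexp w)%C.
Proof.
  unfold cexp. replace (Re (z + w)%C) with (Re z + Re w) by reflexivity.
  replace (Im (z + w)%C) with (Im z + Im w) by reflexivity.
  rewrite exp_plus, cis_plus, RtoC_mult. ring.
Qed.

Lemma cexp_0 : cexp (RtoC 0) = RtoC 1.
Proof. unfold cexp. simpl. rewrite exp_0, cis_0. ring. Qed.

Lemma Cmod_cexp z : Cmod (cexp z) = exp (Re z).
Proof.
  unfold cexp. rewrite Cmod_mult, Cmod_cis, Cmod_R, Rabs_pos_eq; [ring|].
  left; apply exp_pos.
Qed.

Lemma cexp_neq_0 z : cexp z <> RtoC 0.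
Proof.
  intros E. pose proof (Cmod_cexp z) as A. rewrite E, Cmod_0 in A.
  pose proof (exp_pos (Re z)). lra.
Qed.

Lemma cexp_opp z : cexp (- z) = (/ cexp z)%C.
Proof.
  pose proof (cexp_plus z (- z)) as E. replace (z + - z)%C with (RtoC 0) in E by ring.
  rewrite cexp_0 in E. replace (cexp (- z)) with (/ cexp z * (cexp z * cexp (- z)))%C
    by (field; apply cexp_neq_0). rewrite <- E. ring.
Qed.

Lemma small_increment (f : R -> R) (l eps : R) : derivable_pt_lim f 0 l -> 0 < eps ->
  exists d, 0 < d /\ forall x, Rabs x < d -> Rabs (f x - f 0 - l * x) <= eps * Rabs x.
Proof.
  intros D He. destruct (D eps He) as [d Hd]. exists d. split; [apply cond_pos|].
  intros x Hx. destruct (Req_dec x 0) as [->|Hn].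
  - rewrite Rmult_0_r, Rabs_R0. replace (f 0 - f 0 - 0) with 0 by ring. rewrite Rabs_R0. lra.
  - specialize (Hd x Hn Hx). rewrite Rplus_0_l in Hd.
    replace (f x - f 0 - l * x) with (((f x - f 0) / x - l) * x) by (field; auto).
    rewrite Rabs_mult. apply Rmult_le_compat_r; [apply Rabs_pos|lra].
Qed.

Lemma Cmod_le_sum (z : C) : Cmod z <= Rabs (Re z) + Rabs (Im z).
Proof.
  replace z with (RtoC (Re z) + Ci * RtoC (Im z))%C at 1
    by (apply injective_projections; unfold Re, Im; simpl; ring).
  eapply Rle_trans; [apply Cmod_triangle|]. rewrite Cmod_mult, !Cmod_R.
  replace (Cmod Ci) with 1; [lra|]. unfold Cmod, Ci; simpl.
  replace (0 * (0 * 1) + 1 * (1 * 1)) with 1 by ring. now rewrite sqrt_1.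
Qed.

Lemma Im_le_Cmod z : Rabs (Im z) <= Cmod z.
Proof.
  pose proof (Rmax_Cmod z). pose proof (Rmax_r (Rabs (fst z)) (Rabs (snd z))). unfold Im. lra.
Qed.

(** The increments of exp, sin and cos at 0 are all controlled by the same e; combined in real and
    imaginary parts they cost at most 6 e |h|. *)
Lemma cder_cexp_0 : cder cexp (RtoC 0) (RtoC 1).
Proof.
  intros eps He.
  set (e := Rmin 1 (eps / 8)).
  assert (Pe : 0 < e) by (apply Rmin_pos; lra).
  assert (e <= 1) by apply Rmin_l. assert (e <= eps / 8) by apply Rmin_r.
  destruct (small_increment exp 1 e derivable_pt_lim_exp_0 Pe) as (d1 & Hd1 & H1).
  assert (Ds : derivable_pt_lim sin 0 1) by (rewrite <- cos_0; apply derivable_pt_lim_sin).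
  assert (Dc : derivable_pt_lim cos 0 0).
  { replace 0 with (- sin 0) at 2 by (rewrite sin_0; ring). apply derivable_pt_lim_cos. }
  destruct (small_increment sin 1 e Ds Pe) as (d2 & Hd2 & H2).
  destruct (small_increment cos 0 e Dc Pe) as (d3 & Hd3 & H3).
  exists (Rmin (e / 2) (Rmin d1 (Rmin d2 d3))). split; [repeat apply Rmin_pos; lra|].
  intros h Hh.
  assert (A0 : Cmod h < e / 2) by (eapply Rlt_le_trans; [exact Hh|apply Rmin_l]).
  assert (A1 : Cmod h < d1) by (eapply Rlt_le_trans; [exact Hh|
    eapply Rle_trans; [apply Rmin_r|apply Rmin_l]]).
  assert (A2 : Cmod h < d2) by (eapply Rlt_le_trans; [exact Hh|
    eapply Rle_trans; [apply Rmin_r|eapply Rle_trans; [apply Rmin_r|apply Rmin_l]]]).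
  assert (A3 : Cmod h < d3) by (eapply Rlt_le_trans; [exact Hh|
    eapply Rle_trans; [apply Rmin_r|eapply Rle_trans; [apply Rmin_r|apply Rmin_r]]]).
  pose proof (re_le_Cmod h) as Bx. pose proof (Im_le_Cmod h) as By.
  set (x := Re h) in *. set (y := Im h) in *.
  specialize (H1 x ltac:(lra)). specialize (H2 y ltac:(lra)). specialize (H3 y ltac:(lra)).
  rewrite exp_0 in H1. rewrite sin_0 in H2. rewrite cos_0 in H3.
  assert (Ex : Rabs (exp x - 1) <= 2 * Rabs x).
  { replace (exp x - 1) with ((exp x - 1 - 1 * x) + x) by ring.
    eapply Rle_trans; [apply Rabs_triang|]. pose proof (Rabs_pos x). nra. }
  assert (Ex2 : Rabs (exp x) <= 2).
  { replace (exp x) with ((exp x - 1) + 1) by ring. eapply Rle_trans; [apply Rabs_triang|].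
    rewrite Rabs_R1. lra. }
  rewrite cexp_0. replace (0 + h)%C with h by ring.
  eapply Rle_trans; [apply Cmod_le_sum|].
  replace (Re (cexp h - 1 - 1 * h)%C) with ((exp x - 1 - 1 * x) + exp x * (cos y - 1 - 0 * y))
    by (unfold cexp, cis; fold x y; unfold x, y, Re, Im; simpl; ring).
  replace (Im (cexp h - 1 - 1 * h)%C) with (exp x * (sin y - 0 - 1 * y) + (exp x - 1) * y)
    by (unfold cexp, cis; fold x y; unfold x, y, Re, Im; simpl; ring).
  pose proof (Rabs_pos x). pose proof (Rabs_pos y).
  assert (B1 : Rabs (exp x * (cos y - 1 - 0 * y)) <= 2 * (e * Rabs y)).
  { rewrite Rabs_mult. apply Rmult_le_compat; auto; apply Rabs_pos. }
  assert (B2 : Rabs (exp x * (sin y - 0 - 1 * y)) <= 2 * (e * Rabs y)).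
  { rewrite Rabs_mult. apply Rmult_le_compat; auto; apply Rabs_pos. }
  assert (B3 : Rabs ((exp x - 1) * y) <= e * Rabs y).
  { rewrite Rabs_mult. apply Rmult_le_compat_r; lra. }
  pose proof (Rabs_triang (exp x - 1 - 1 * x) (exp x * (cos y - 1 - 0 * y))).
  pose proof (Rabs_triang (exp x * (sin y - 0 - 1 * y)) ((exp x - 1) * y)).
  apply Rle_trans with (6 * e * Cmod h); [nra|].
  apply Rmult_le_compat_r; [apply Cmod_ge_0|lra].
Qed.

Lemma cder_cexp z : cder cexp z (cexp z).
Proof.
  intros eps He.
  destruct (cder_cexp_0 (eps / (Cmod (cexp z) + 1))) as (d & Hd & B).
  { apply Rdiv_lt_0_compat; auto. pose proof (Cmod_ge_0 (cexp z)); lra. }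
  exists d. split; auto. intros h Hh. specialize (B h Hh).
  rewrite cexp_0 in B. replace (0 + h)%C with h in B by ring.
  rewrite cexp_plus.
  replace (cexp z * cexp h - cexp z - cexp z * h)%C with (cexp z * (cexp h - 1 - 1 * h))%C by ring.
  rewrite Cmod_mult. pose proof (Cmod_ge_0 (cexp z)). pose proof (Cmod_ge_0 h).
  apply Rle_trans with ((Cmod (cexp z) + 1) * (eps / (Cmod (cexp z) + 1) * Cmod h)).
  - apply Rmult_le_compat; try lra. apply Cmod_ge_0.
  - apply Req_le. field. lra.
Qed.

Lemma holo_cexp F : holo F -> holo (fun z => cexp (F z)).
Proof.
  intros HF z Hz. destruct (HF z Hz) as [l Hl]. eexists.
  apply (cder_comp cexp F z); [exact Hl|apply cder_cexp].
Qed.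

Lemma unit_disc_0 : unit_disc (RtoC 0).
Proof. unfold unit_disc. rewrite Cmod_0. lra. Qed.

Lemma zero_derivative_constant F : (forall z, unit_disc z -> cder F z (RtoC 0)) ->
  forall z, unit_disc z -> F z = F (RtoC 0).
Proof.
  intros D z Hz. assert (HF : holo F) by (intros w Hw; eexists; apply D, Hw).
  destruct (taylor_exists F HF) as [a T].
  pose proof (taylor_C_derive a F T) as T'.
  assert (T0 : taylor_on_disc (fun _ => RtoC 0) (C_derive F)).
  { apply taylor_clim. intros w Hw. rewrite (C_derive_unique F w (RtoC 0)) by auto.
    intros eps He. exists O. intros n _. unfold psum. rewrite (csum_ext _ (fun _ => RtoC 0 * 0)%C).
    - rewrite csum_scal. replace (0 * csum (fun _ => 0) n - 0)%C with (RtoC 0) by ring.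
      rewrite Cmod_0; lra.
    - intros; ring. }
  assert (A : forall k, a (S k) = RtoC 0).
  { intros k. pose proof (taylor_unique _ _ _ T' T0 k) as E. cbv beta in E.
    apply Cmult_zero in E. destruct E as [E|E]; auto.
    exfalso. revert E. apply RtoC_neq_0. apply not_0_INR. lia. }
  rewrite <- (taylor_0 a F T).
  apply (clim_unique (psum a z)); [exact (proj1 (taylor_clim a F) T z Hz)|].
  intros eps He. exists 1%nat. intros [|n] Hn; [lia|].
  rewrite psum_shift. unfold psum. rewrite (csum_ext _ (fun _ => RtoC 0 * 0)%C).
  - rewrite csum_scal. replace (a O + z * (0 * csum (fun _ => 0) n) - a O)%C with (RtoC 0) by ring.
    rewrite Cmod_0; lra.
  - intros k _. rewrite A. ring.
Qed.

(** [L] is the primitive of F' / F that vanishes at 0; then F exp (- L) has derivative zero. *)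
Lemma analytic_log F : holo F -> (forall z, unit_disc z -> F z <> RtoC 0) ->
  exists L, holo L /\ L (RtoC 0) = RtoC 0 /\
    forall z, unit_disc z -> F z = (F (RtoC 0) * cexp (L z))%C.
Proof.
  intros HF Hn.
  destruct (primitive_exists (fun z => C_derive F z * / F z)%C) as (L & HL & L0 & DL).
  { apply holo_mult; [apply holo_derive; auto|apply holo_inv; auto]. }
  exists L. split; auto. split; auto. intros z Hz.
  assert (E : (F z * cexp (- (1) * L z))%C = (F (RtoC 0) * cexp (- (1) * L (RtoC 0)))%C).
  { apply (zero_derivative_constant (fun z => F z * cexp (- (1) * L z))%C); auto.
    intros w Hw.
    replace (RtoC 0) with (C_derive F w * cexp (- (1) * L w) +
       F w * (cexp (- (1) * L w) * (- (1) * (C_derive F w * / F w))))%C by (field; auto).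
    apply (cder_mult F (fun z => cexp (- (1) * L z)%C)); [apply holo_C_derive; auto|].
    apply (cder_comp cexp (fun w => - (1) * L w)%C w (cexp (- (1) * L w))); [|apply cder_cexp].
    apply (cder_comp (fun w => - (1) * w)%C L); [apply DL; auto|apply cder_cmul]. }
  rewrite L0 in E. replace (- (1) * 0)%C with (RtoC 0) in E by ring. rewrite cexp_0, Cmult_1_r in E.
  rewrite <- E. replace (- (1) * L z)%C with (- L z)%C by ring. rewrite cexp_opp.
  field. apply cexp_neq_0.
Qed.

(* Landau's trick: Cauchy's formula applied to the powers of [F] has a bounded loss. *)
Lemma maximum_principle F rho M z : holo F -> 0 < rho < 1 -> Cmod z < rho -> 0 <= M ->
  (forall t, Cmod (F (circ rho t)) <= M) -> Cmod (F z) <= M.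
Proof.
  intros HF Hr Hz PM HM.
  set (B := rho / (rho - Cmod z)).
  assert (PB : 0 < B) by (apply Rdiv_lt_0_compat; lra).
  assert (P : forall k, Cmod (F z) ^ k <= M ^ k * B).
  { intros k. rewrite <- Cmod_pow.
    rewrite <- (cauchy_formula (fun z => F z ^ k)%C rho z) by (auto; apply holo_pow; auto).
    assert (Nz : forall t, (circ rho t - z)%C <> RtoC 0).
    { intros t E. pose proof (Cmod_circ_minus rho z t) as A. rewrite E, Cmod_0 in A. lra. }
    apply circle_mean_bound.
    - intros t Ht. apply pcont_mult.
      + apply (circle_contin (fun z => F z ^ k)%C rho); auto; [apply holo_pow; auto|lra].
      + apply pcont_mult; [apply circ_pcont|]. apply (pcont_inv (fun s => circ rho s - z)%C); auto.
        apply pcont_minus; [apply circ_pcont|apply pcont_const].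
    - intros t _. rewrite Cmod_mult, Cmod_pow, Cmod_div by auto. rewrite Cmod_circ by lra.
      apply Rmult_le_compat.
      + apply pow_le, Cmod_ge_0.
      + apply Rdiv_le_0_compat; [lra|]. apply Cmod_gt_0; auto.
      + apply pow_incr. split; [apply Cmod_ge_0|auto].
      + apply Rmult_le_compat_l; [lra|]. apply Rinv_le_contravar; [lra|].
        apply Cmod_circ_minus; lra. }
  apply Rnot_lt_le. intros Hlt.
  destruct (Req_dec M 0) as [E|E].
  - specialize (P 1%nat). rewrite E in P, Hlt. simpl in P. lra.
  - assert (0 < M) by lra.
    assert (Hx : 1 < Cmod (F z) / M).
    { apply Rmult_lt_reg_r with M; auto. unfold Rdiv. rewrite Rmult_assoc, Rinv_l; lra. }
    destruct (Pow_x_infinity (Cmod (F z) / M)) with (b := B + 1) as [N HN].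
    { rewrite Rabs_pos_eq; lra. }
    specialize (HN N (le_n _)). rewrite Rabs_pos_eq in HN by (apply pow_le; lra).
    specialize (P N). unfold Rdiv in HN. rewrite Rpow_mult_distr, pow_inv in HN.
    assert (PMN : 0 < M ^ N) by (apply pow_lt; auto).
    assert (Cmod (F z) ^ N * / M ^ N <= B).
    { apply Rmult_le_reg_r with (M ^ N); auto. rewrite Rmult_assoc, Rinv_l by lra. lra. }
    lra.
Qed.

Lemma taylor_shift_n m : forall a F, taylor_on_disc a F -> (forall k, (k < m)%nat -> a k = RtoC 0) ->
  exists G, taylor_on_disc (fun k => a (m + k)%nat) G /\
    forall z, unit_disc z -> F z = (z ^ m * G z)%C.
Proof.
  induction m; intros a F T A.
  - exists F. split; auto. intros; simpl; ring.
  - destruct (taylor_shift a F T) as (F1 & T1 & E1).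
    destruct (IHm _ _ T1) as (G & TG & EG); [intros k Hk; apply A; lia|].
    exists G. split; auto. intros z Hz. rewrite E1, EG, A, Cpow_S by (auto; lia). ring.
Qed.

(** The quotient by z^m is at most rho^(- m) on the circle of radius rho, hence inside it by the
    maximum principle. Then rho tends to 1, with Bernoulli's inequality for the rate. *)
Lemma schwarz a w m : holo w -> (forall z, unit_disc z -> Cmod (w z) <= 1) ->
  taylor_on_disc a w -> (forall k, (k < m)%nat -> a k = RtoC 0) ->
  forall z, unit_disc z -> Cmod (w z) <= Cmod z ^ m.
Proof.
  intros Hw B T A z Hz. destruct (taylor_shift_n m a w T A) as (G & TG & EG).
  rewrite EG by auto. rewrite Cmod_mult, Cmod_pow.
  rewrite <- (Rmult_1_r (Cmod z ^ m)) at 2.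
  apply Rmult_le_compat_l; [apply pow_le, Cmod_ge_0|].
  pose proof (Cmod_ge_0 z) as Pz. unfold unit_disc in Hz.
  assert (P : forall rho, Cmod z < rho < 1 -> Cmod (G z) * rho ^ m <= 1).
  { intros rho Hr. assert (Pr : 0 < rho ^ m) by (apply pow_lt; lra).
    apply Rmult_le_reg_r with (/ rho ^ m); [apply Rinv_0_lt_compat; auto|].
    rewrite Rmult_assoc, Rinv_r, Rmult_1_r, Rmult_1_l by lra.
    apply (maximum_principle G rho); try lra.
    - eapply taylor_holo; eauto.
    - left; apply Rinv_0_lt_compat; auto.
    - intros t. assert (U : unit_disc (circ rho t)) by (unfold unit_disc; rewrite Cmod_circ; lra).
      specialize (B _ U). rewrite EG in B by auto.
      rewrite Cmod_mult, Cmod_pow, Cmod_circ in B by lra.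
      apply Rmult_le_reg_l with (rho ^ m); auto. rewrite Rinv_r by lra. exact B. }
  apply le_epsilon. intros eps He.
  set (G0 := Cmod (G z)) in *. assert (0 <= G0) by apply Cmod_ge_0.
  assert (Bern : forall d k, 0 <= d <= 1 -> 1 - INR k * d <= (1 - d) ^ k).
  { intros d k Hd. induction k; [simpl; lra|]. rewrite S_INR. simpl.
    assert ((1 - d) * (1 - INR k * d) <= (1 - d) * (1 - d) ^ k) by (apply Rmult_le_compat_l; lra).
    pose proof (pos_INR k). nra. }
  pose proof (pos_INR m).
  set (d := Rmin ((1 - Cmod z) / 2) (eps / ((G0 + 1) * (INR m + 1)))).
  assert (0 < (G0 + 1) * (INR m + 1)) by nra.
  assert (Hd : 0 < d) by (apply Rmin_pos; [lra|apply Rdiv_lt_0_compat; auto]).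
  assert (d <= (1 - Cmod z) / 2) by apply Rmin_l.
  assert (Hd2 : d <= eps / ((G0 + 1) * (INR m + 1))) by apply Rmin_r.
  specialize (P (1 - d) ltac:(lra)). specialize (Bern d m ltac:(lra)).
  apply Rmult_le_compat_r with (r := (G0 + 1) * (INR m + 1)) in Hd2; [|lra].
  unfold Rdiv in Hd2. rewrite Rmult_assoc, Rinv_l, Rmult_1_r in Hd2 by lra.
  assert (G0 * (1 - INR m * d) <= G0 * (1 - d) ^ m) by (apply Rmult_le_compat_l; auto).
  assert (0 <= INR m * d) by nra. assert (0 <= G0 * d) by nra. nra.
Qed.

(** If a value p near F z0 were missed, 1 / (F - p) would be holomorphic and larger at the centre
    than on the circle, against the mean value property. The radius is half the distance from F z0
    to the image of the circle. *)
Lemma open_mapping F z0 s : holo F -> 0 < s -> (forall w, Cmod (w - z0)%C < s -> unit_disc w) ->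
  (forall w, Cmod (w - z0)%C < s -> F w = F z0 -> w = z0) ->
  exists d, 0 < d /\ forall p, Cmod (p - F z0)%C < d -> exists w, Cmod (w - z0)%C < s /\ F w = p.
Proof.
  intros HF Hs In Inj.
  assert (In' : forall z, unit_disc z -> Cmod (z0 + RtoC s * z - z0)%C < s).
  { intros z Hz. replace (z0 + s * z - z0)%C with (RtoC s * z)%C by ring.
    rewrite Cmod_mult, Cmod_R, Rabs_pos_eq by lra. unfold unit_disc in Hz. nra. }
  set (G := fun z => F (z0 + RtoC s * z)%C).
  assert (HG : holo G).
  { intros z Hz. destruct (HF (z0 + RtoC s * z)%C) as [l Hl]; [apply In, In', Hz|].
    eexists. apply (cder_comp F (fun z => z0 + RtoC s * z)%C z l); [|exact Hl].
    apply (cder_plus (fun _ => z0) (fun z => RtoC s * z)%C); [apply cder_const|apply cder_cmul]. }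
  assert (U : forall t, unit_disc (circ (1 / 2) t)) by (intros t; unfold unit_disc; rewrite Cmod_circ; lra).
  pose proof (circle_contin G (1 / 2) HG ltac:(lra)) as Cg.
  pose proof twopi_pos as P2.
  assert (Hc : forall t, 0 <= t <= 2 * PI -> continuity_pt (fun t => Cmod (G (circ (1 / 2) t) - F z0)%C) t).
  { intros t Ht eps He.
    destruct (pcont_elim _ _ (Cg t Ht) (eps / 2)) as (d & Hd & D); [lra|].
    exists d. split; auto. intros x [_ Hx]. simpl in *. unfold R_dist in *.
    specialize (D x Hx). set (A := G (circ (1 / 2) x)) in *. set (B := G (circ (1 / 2) t)) in *.
    pose proof (Cmod_triangle (A - B) (B - F z0)) as T1.
    replace (A - B + (B - F z0))%C with (A - F z0)%C in T1 by ring.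
    pose proof (Cmod_triangle (- (A - B)) (A - F z0)) as T2.
    replace (- (A - B) + (A - F z0))%C with (B - F z0)%C in T2 by ring. rewrite Cmod_opp in T2.
    apply Rle_lt_trans with (eps / 2); [apply Rabs_le|]; lra. }
  destruct (continuity_ab_min _ 0 (2 * PI) ltac:(lra) Hc) as [t0 [Hm _]].
  set (mu := Cmod (G (circ (1 / 2) t0) - F z0)%C) in *.
  assert (Pm : 0 < mu).
  { apply Cmod_gt_0. intros E. assert (E' : G (circ (1 / 2) t0) = F z0).
    { replace (F z0) with (F z0 + 0)%C by ring. rewrite <- E. ring. }
    apply Inj in E'; [|apply In', U].
    assert (Z : (RtoC s * circ (1 / 2) t0)%C = RtoC 0).
    { replace (RtoC s * circ (1 / 2) t0)%C with ((z0 + RtoC s * circ (1 / 2) t0) - z0)%C by ring.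
      rewrite E'. ring. }
    apply Cmult_zero in Z. destruct Z as [Z|Z].
    - revert Z. apply RtoC_neq_0. lra.
    - revert Z. apply circ_neq_0. lra. }
  exists (mu / 2). split; [lra|]. intros p Hp.
  apply NNPP. intros Hno.
  assert (Nz : forall z, unit_disc z -> (G z - p)%C <> RtoC 0).
  { intros z Hz E. apply Hno. exists (z0 + RtoC s * z)%C. split; [apply In', Hz|].
    fold (G z). replace p with (p + 0)%C by ring. rewrite <- E. ring. }
  assert (HK : holo (fun z => / (G z - p))%C).
  { apply (holo_inv (fun z => G z - p)%C); auto. apply holo_minus; auto. apply holo_const. }
  pose proof (mean_value _ (1 / 2) HK ltac:(lra)) as MV. cbv beta in MV.
  assert (Bd : Cmod (circle_mean (fun t => / (G (circ (1 / 2) t) - p))%C) <= / (mu / 2)).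
  { apply circle_mean_bound; [apply (circle_contin _ _ HK); lra|]. intros t Ht.
    rewrite Cmod_inv by (apply Nz, U). apply Rinv_le_contravar; [lra|].
    specialize (Hm t Ht). cbv beta in Hm.
    pose proof (Cmod_triangle (G (circ (1 / 2) t) - p) (p - F z0)) as T.
    replace (G (circ (1 / 2) t) - p + (p - F z0))%C with (G (circ (1 / 2) t) - F z0)%C in T by ring.
    lra. }
  rewrite MV in Bd. unfold G in Bd at 1. replace (z0 + s * 0)%C with z0 in Bd by ring.
  assert (Nz0 : (F z0 - p)%C <> RtoC 0).
  { pose proof (Nz (RtoC 0) unit_disc_0) as N0. unfold G in N0.
    replace (z0 + s * 0)%C with z0 in N0 by ring. exact N0. }
  rewrite Cmod_inv in Bd by auto.
  assert (Q : 0 < Cmod (F z0 - p)%C) by (apply Cmod_gt_0; auto).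
  rewrite <- Cmod_opp in Hp. replace (- (p - F z0))%C with (F z0 - p)%C in Hp by ring.
  apply Rinv_lt_contravar in Hp; [lra|]. apply Rmult_lt_0_compat; lra.
Qed.

(** * Coefficients of ((1 - xi z) / (1 - z))^al *)

(* Coefficients of [(1 - z) ^ al]. *)
Fixpoint neg_binom (al : R) (k : nat) : R :=
  match k with O => 1 | S j => neg_binom al j * ((INR j - al) / (INR j + 1)) end.

Lemma neg_binom_S al k : (INR k + 1) * neg_binom al (S k) = (INR k - al) * neg_binom al k.
Proof. simpl neg_binom. pose proof (pos_INR k). field. lra. Qed.

(** These are the coefficients in (1 - z)^al (1 - z)^(- al) = 1 and in z ((1 - z)^al)' (1 - z)^(-
    al) = - al z / (1 - z). The proof is algebraic: [W] and [T] weight by the two indices, each has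
    a one-step recursion, and W n + T n = n Z n. *)
Lemma neg_binom_conv_moments al n :
  sum_f_R0 (fun k => neg_binom al k * neg_binom (- al) (S n - k)) (S n) = 0 /\
  sum_f_R0 (fun k => INR k * (neg_binom al k * neg_binom (- al) (S n - k))) (S n) = - al.
Proof.
  set (Z := fun n => sum_f_R0 (fun k => neg_binom al k * neg_binom (- al) (n - k)) n).
  set (W := fun n => sum_f_R0 (fun k => INR k * (neg_binom al k * neg_binom (- al) (n - k))) n).
  set (T := fun n => sum_f_R0 (fun k => INR (n - k) * (neg_binom al k * neg_binom (- al) (n - k))) n).
  assert (HW : forall n, W (S n) = W n - al * Z n).
  { intros m. unfold W, Z. rewrite decomp_sum by lia. simpl pred.
    rewrite Rmult_0_l, Rplus_0_l, (scal_sum _ _ al), <- minus_sum.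
    apply sum_eq. intros k Hk. rewrite S_INR. replace (S m - S k)%nat with (m - k)%nat by lia.
    transitivity ((INR k + 1) * neg_binom al (S k) * neg_binom (- al) (m - k)); [ring|].
    rewrite neg_binom_S. ring. }
  assert (HT : forall n, T (S n) = T n + al * Z n).
  { intros m. unfold T, Z. rewrite tech5. replace (S m - S m)%nat with O by lia. simpl INR at 2.
    rewrite Rmult_0_l, Rplus_0_r, (scal_sum _ _ al), <- plus_sum.
    apply sum_eq. intros k Hk. replace (S m - k)%nat with (S (m - k)) by lia. rewrite S_INR.
    transitivity (((INR (m - k) + 1) * neg_binom (- al) (S (m - k))) * neg_binom al k); [ring|].
    rewrite neg_binom_S. ring. }
  assert (HS : forall n, W n + T n = INR n * Z n).
  { intros m. unfold W, T, Z. rewrite scal_sum, <- plus_sum. apply sum_eq. intros k Hk.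
    rewrite minus_INR by lia. ring. }
  assert (HZ : forall n, Z (S n) = 0).
  { intros m. pose proof (HS (S m)) as E. rewrite HW, HT, S_INR in E.
    pose proof (pos_INR m).
    assert (E2 : (INR m + 1) * Z (S m) = INR m * Z m) by (rewrite <- (HS m); lra).
    clear E. induction m.
    - simpl INR in E2. lra.
    - rewrite IHm in E2; [|apply pos_INR|].
      + pose proof (pos_INR (S m)). nra.
      + pose proof (HS (S m)) as E. rewrite HW, HT, S_INR in E. rewrite <- (HS m). lra. }
  split; [exact (HZ n)|]. change (W (S n) = - al). induction n.
  - rewrite HW. unfold W, Z. simpl. ring.
  - rewrite HW, IHn, HZ. ring.
Qed.

(** The n-th Taylor coefficient of ((1 - xi z) / (1 - z))^al, as a polynomial in xi. *)
Definition kernel_coef (al : R) (n : nat) (xi : C) : C :=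
  csum (fun k => RtoC (neg_binom al k * neg_binom (- al) (n - k)) * xi ^ k)%C (S n).

Lemma RtoC_sum f n : RtoC (sum_f_R0 f n) = csum (fun k => RtoC (f k)) (S n).
Proof.
  induction n.
  - simpl. ring.
  - rewrite tech5, RtoC_plus, IHn. reflexivity.
Qed.

(** The remainder of xi^k after its first-order expansion at xi = 1; it vanishes for k = 0 and k =
    1. *)
Definition kernel_term (k : nat) (xi : C) : C := (xi ^ k - RtoC (INR k) * xi + RtoC (INR k - 1))%C.

(** The first two moments of the weights are known, so the first-order parts of all xi^k sum up
    explicitly. What remains starts at k = 2, where the weights are nonnegative for 1 <= al <= 2. *)
Lemma kernel_coef_decomposition al n xi : kernel_coef al (S n) xi =
  (RtoC al * (1 - xi) + csum (fun k => RtoC (neg_binom al k * neg_binom (- al) (S n - k)) * kernel_term k xi) (S (S n)))%C.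
Proof.
  destruct (neg_binom_conv_moments al n) as [Z W].
  apply (f_equal RtoC) in Z. apply (f_equal RtoC) in W. rewrite RtoC_sum in Z, W.
  unfold kernel_coef. set (w := fun k => neg_binom al k * neg_binom (- al) (S n - k)) in *.
  change (csum (fun k => RtoC (w k)) (S (S n)) = RtoC 0) in Z.
  change (csum (fun k => RtoC (INR k * w k)) (S (S n)) = RtoC (- al)) in W.
  change (csum (fun k => RtoC (w k) * xi ^ k)%C (S (S n)) =
    (RtoC al * (1 - xi) + csum (fun k => RtoC (w k) * kernel_term k xi) (S (S n)))%C).
  rewrite (csum_ext (fun k => RtoC (w k) * kernel_term k xi)%C
    (fun k => RtoC (w k) * xi ^ k + ((1 - xi) * RtoC (INR k * w k) + (- (1)) * RtoC (w k)))%C).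
  - rewrite !csum_plus, !csum_scal, Z, W, RtoC_opp. ring.
  - intros k _. unfold kernel_term. rewrite RtoC_minus, RtoC_mult. ring.
Qed.

(** * The trigonometric estimate for kernel coefficients *)

Section KernelBound.

Variables (al phi : R) (n : nat).
Hypothesis Hal : 1 <= al <= 2.

Let w (k : nat) : R := neg_binom al k * neg_binom (- al) (n - k).
(** With xi = - cis phi the extremal point xi = -1 is phi = 0; [e] and [y] measure the deviation
    from it. *)
Let e (k : nat) : R := 1 - cos (INR k * phi).
Let y : R := 1 - cos phi.

Lemma neg_binom_neg_pos k : 0 < neg_binom (- al) k.
Proof.
  induction k; simpl; [lra|]. pose proof (pos_INR k). apply Rmult_lt_0_compat; auto.
  apply Rdiv_lt_0_compat; lra.
Qed.

Lemma neg_binom_pos k : 0 <= neg_binom al (S (S k)).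
Proof.
  induction k.
  - simpl. replace (1 * ((0 - al) / (0 + 1)) * ((1 - al) / (1 + 1))) with (al * (al - 1) / 2) by field. nra.
  - change (0 <= neg_binom al (S (S k)) * ((INR (S (S k)) - al) / (INR (S (S k)) + 1))).
    apply Rmult_le_pos; auto. rewrite !S_INR. pose proof (pos_INR k). apply Rdiv_le_0_compat; lra.
Qed.

Lemma w_pos k : 0 <= w (S (S k)).
Proof. unfold w. apply Rmult_le_pos; [apply neg_binom_pos|left; apply neg_binom_neg_pos]. Qed.

(** Consecutive first factors have the ratio (j - al) / (j + 1), and the second factors grow with
    their index; both comparisons rest on al >= 1. *)
Lemma w_decrease k : (S (S (S k)) <= n)%nat ->
  w (S (S (S k))) <= w (S (S k)) * ((INR (S (S k)) - 1) / (INR (S (S k)) + 1)).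
Proof.
  intros Hk. unfold w. set (j := S (S k)) in *.
  replace (n - j)%nat with (S (n - S j)) by lia.
  change (neg_binom al (S j)) with (neg_binom al j * ((INR j - al) / (INR j + 1))).
  assert (P1 : 0 <= neg_binom al j) by apply neg_binom_pos.
  pose proof (neg_binom_neg_pos (n - S j)) as P2. pose proof (neg_binom_neg_pos (S (n - S j))) as P3.
  assert (P4 : neg_binom (- al) (n - S j) <= neg_binom (- al) (S (n - S j))).
  { set (i := (n - S j)%nat) in *. simpl. pose proof (pos_INR i).
    rewrite <- (Rmult_1_r (neg_binom (- al) i)) at 1. apply Rmult_le_compat_l; [lra|].
    apply Rmult_le_reg_r with (INR i + 1); [lra|]. unfold Rdiv. rewrite Rmult_assoc, Rinv_l; lra. }
  assert (Hj : 2 <= INR j) by (unfold j; rewrite !S_INR; pose proof (pos_INR k); lra).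
  assert (D : (INR j - al) / (INR j + 1) <= (INR j - 1) / (INR j + 1)).
  { unfold Rdiv. apply Rmult_le_compat_r; [left; apply Rinv_0_lt_compat|]; lra. }
  assert (D0 : 0 <= (INR j - al) / (INR j + 1)) by (apply Rdiv_le_0_compat; lra).
  apply Rle_trans with (neg_binom al j * ((INR j - 1) / (INR j + 1)) * neg_binom (- al) (S (n - S j))).
  - apply Rmult_le_compat; try lra; [apply Rmult_le_pos; auto|apply Rmult_le_compat_l; auto].
  - apply Req_le. ring.
Qed.

(** The tangent bound sqrt (A^2 + B) <= A + B / (2 A), which turns identities for squared moduli
    into bounds for moduli. *)
Lemma le_first_order (x A B : R) : 0 < A -> 0 <= x -> x * x <= A * A + B -> x <= A + B / (2 * A).
Proof.
  intros HA Hx Hq. apply Rmult_le_reg_r with (2 * A); [lra|].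
  replace ((A + B / (2 * A)) * (2 * A)) with (2 * (A * A) + B) by (field; lra).
  pose proof (Rle_0_sqr (x - A)) as Q. unfold Rsqr in Q. lra.
Qed.

Lemma kernel_term_circle k :
  Cmod (kernel_term (S k) (- cis phi)%C) * Cmod (kernel_term (S k) (- cis phi)%C) =
   (INR (S k) - 1) ^ 2 + INR (S k) ^ 2 + 1 + 2 * INR (S k) * (INR (S k) - 1) * (1 - y) +
   (-1) ^ S k * (2 * (INR (S k) - 1) * (1 - e (S k)) + 2 * INR (S k) * (1 - e k)).
Proof.
  rewrite Cmod_sqr. unfold kernel_term.
  assert (E : ((- cis phi) ^ S k)%C = (RtoC ((-1) ^ S k) * cis (INR (S k) * phi))%C).
  { rewrite <- cis_pow, RtoC_pow, <- Cpow_mult_l. f_equal.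
    apply injective_projections; simpl; ring. }
  rewrite E. set (s := (-1) ^ S k).
  assert (Hs : s * s = 1).
  { unfold s. rewrite <- Rpow_mult_distr. replace (-1 * -1) with 1 by ring. apply pow1. }
  unfold e, y. set (K := INR (S k)) in *.
  assert (Ec : cos (INR k * phi) = cos (K * phi) * cos phi + sin (K * phi) * sin phi).
  { rewrite <- cos_minus. f_equal. unfold K. rewrite S_INR. ring. }
  rewrite Ec. unfold cis, Re, Im; simpl.
  pose proof (sin2_cos2 phi) as S1. pose proof (sin2_cos2 (K * phi)) as S2. unfold Rsqr in *.
  set (c1 := cos phi) in *. set (s1 := sin phi) in *. set (ck := cos (K * phi)) in *.
  set (sk := sin (K * phi)) in *.
  replace ((s * ck - 0 * sk + - (K * - c1 - 0 * - s1) + (K - 1)) *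
    (s * ck - 0 * sk + - (K * - c1 - 0 * - s1) + (K - 1)) +
    (s * sk + 0 * ck + - (K * - s1 + 0 * - c1) + 0) * (s * sk + 0 * ck + - (K * - s1 + 0 * - c1) + 0))
    with (s * s * (sk * sk + ck * ck) + K * K * (s1 * s1 + c1 * c1) + (K - 1) * (K - 1) +
      2 * s * K * (ck * c1 + sk * s1) + 2 * s * (K - 1) * ck + 2 * K * (K - 1) * c1) by ring.
  rewrite Hs, S1, S2. ring.
Qed.

Lemma e_nonneg k : 0 <= e k.
Proof. unfold e. pose proof (COS_bound (INR k * phi)). lra. Qed.

Lemma y_nonneg : 0 <= y.
Proof. unfold y. pose proof (COS_bound phi). lra. Qed.

(** In half angles this compares sin^2 (th + phi) with sin^2 th and sin^2 phi. The weights are those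
    for which, with a = sin th cos phi and b = cos th sin phi, the slack is half the square of 2 a -
    (m + 1) b. *)
Lemma e_growth k : INR (S k) * e (S (S (S k))) <= (INR k + 3) * (e (S k) + 2 * INR (S k) * y).
Proof.
  unfold e, y. set (th := INR (S k) * phi / 2).
  assert (E1 : 1 - cos (INR (S k) * phi) = 2 * (sin th * sin th)).
  { replace (INR (S k) * phi) with (2 * th) by (unfold th; field). rewrite cos_2a_sin. ring. }
  assert (E2 : 1 - cos (INR (S (S (S k))) * phi) = 2 * (sin (th + phi) * sin (th + phi))).
  { replace (INR (S (S (S k))) * phi) with (2 * (th + phi)).
    - rewrite cos_2a_sin. ring.
    - unfold th. rewrite !S_INR. field. }
  rewrite E1, E2, sin_plus. pose proof (sin2_cos2 th) as S1. pose proof (sin2_cos2 phi) as S2.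
  unfold Rsqr in *. rewrite (S_INR k). pose proof (pos_INR k) as Pk. set (m := INR k) in *.
  set (s := sin th) in *. set (c := cos th) in *. set (d := sin phi) in *. set (f := cos phi) in *.
  pose proof (COS_bound phi) as Bf. fold f in Bf.
  assert (X : (m + 1) * ((s * f + c * d) * (s * f + c * d)) <=
     (m + 3) * (s * f * (s * f)) + (m + 1) * (m + 3) / 2 * (c * d * (c * d))).
  { pose proof (Rle_0_sqr (2 * (s * f) - (m + 1) * (c * d))) as Q. unfold Rsqr in Q. nra. }
  assert (Y1 : s * f * (s * f) <= s * s) by nra.
  assert (Y2 : c * d * (c * d) <= d * d) by nra.
  assert (Y3 : d * d <= 2 * (1 - f)) by nra.
  assert (0 <= (m + 1) * (m + 3)) by nra. nra.
Qed.

(** A term of odd index can exceed its value at xi = -1. Its excess, at most [df], is paid by the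
    deficit, at least [sl], of the even term before it, since the weights drop by the factor (m + 1)
    / (m + 3). Both moduli equal 2 (m + 2) at xi = -1, so the tangent bound is taken at the same
    point. *)
Lemma pair_bound (k : nat) : (S (S k) <= n)%nat -> Nat.Even k ->
  let b j := Cmod (kernel_term j (- cis phi)%C) - (2 * INR j - 1 + (-1) ^ j) in
  w (S (S k)) * b (S (S k)) <= 0 /\
  ((S (S (S k)) <= n)%nat -> w (S (S k)) * b (S (S k)) + w (S (S (S k))) * b (S (S (S k))) <= 0).
Proof.
  intros Hk [h Hh] b.
  assert (Se : (-1) ^ S (S k) = 1).
  { rewrite Hh. replace (S (S (2 * h))) with (2 * S h)%nat by lia. apply pow_1_even. }
  assert (So : (-1) ^ S (S (S k)) = -1) by (simpl in *; lra).
  pose proof (kernel_term_circle (S k)) as T1. pose proof (kernel_term_circle (S (S k))) as T2.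
  rewrite Se in T1. rewrite So in T2.
  pose proof (e_nonneg (S k)) as E1. pose proof (e_nonneg (S (S k))) as E2.
  pose proof (e_nonneg (S (S (S k)))) as E3. pose proof y_nonneg as Py.
  pose proof (e_growth k) as Gr.
  assert (Kk : INR (S (S (S k))) = INR k + 3) by (rewrite !S_INR; ring).
  assert (Kk2 : INR (S (S k)) = INR k + 2) by (rewrite !S_INR; ring).
  assert (Kk1 : INR (S k) = INR k + 1) by (rewrite !S_INR; ring).
  rewrite ?Kk, ?Kk2, ?Kk1 in *. pose proof (pos_INR k) as Pk. set (m := INR k) in *.
  set (x1 := Cmod (kernel_term (S (S k)) (- cis phi)%C)) in *.
  set (x2 := Cmod (kernel_term (S (S (S k))) (- cis phi)%C)) in *.
  set (sl := (m + 1) * y / 2 + (m + 1) / (2 * (m + 2)) * e (S (S k)) + e (S k) / 2).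
  set (df := - (m + 3) * y / 2 + e (S (S (S k))) / 2 + (m + 3) / (2 * (m + 2)) * e (S (S k))).
  assert (Psl : 0 <= sl).
  { unfold sl. assert (0 <= (m + 1) / (2 * (m + 2))) by (apply Rdiv_le_0_compat; lra).
    assert (0 <= (m + 1) / (2 * (m + 2)) * e (S (S k))) by (apply Rmult_le_pos; auto). nra. }
  assert (B1 : b (S (S k)) <= - sl).
  { unfold b. fold x1. rewrite Se, Kk2.
    assert (x1 <= 2 * (m + 2) + (- (2 * (m + 2) * (m + 1) * y) - 2 * (m + 1) * e (S (S k)) -
      2 * (m + 2) * e (S k)) / (2 * (2 * (m + 2)))).
    { apply le_first_order; [lra|apply Cmod_ge_0|]. rewrite T1. apply Req_le. ring. }
    replace ((- (2 * (m + 2) * (m + 1) * y) - 2 * (m + 1) * e (S (S k)) -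
      2 * (m + 2) * e (S k)) / (2 * (2 * (m + 2)))) with (- sl) in H by (unfold sl; field; lra). lra. }
  assert (B2 : b (S (S (S k))) <= df).
  { unfold b. fold x2. rewrite So, Kk.
    assert (x2 <= 2 * (m + 2) + (- (2 * (m + 3) * (m + 2) * y) + 2 * (m + 2) * e (S (S (S k))) +
      2 * (m + 3) * e (S (S k))) / (2 * (2 * (m + 2)))).
    { apply le_first_order; [lra|apply Cmod_ge_0|]. rewrite T2. apply Req_le. ring. }
    replace ((- (2 * (m + 3) * (m + 2) * y) + 2 * (m + 2) * e (S (S (S k))) +
      2 * (m + 3) * e (S (S k))) / (2 * (2 * (m + 2)))) with df in H by (unfold df; field; lra). lra. }
  pose proof (w_pos k) as Pw. pose proof (w_pos (S k)) as Pw2.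
  split; [nra|]. intros Hk2. pose proof (w_decrease k Hk2) as Dw. rewrite Kk2 in Dw.
  replace ((m + 2 - 1) / (m + 2 + 1)) with ((m + 1) / (m + 3)) in Dw by (field; lra).
  set (w1 := w (S (S k))) in *. set (w2 := w (S (S (S k)))) in *.
  (* The contributions of e (k + 2) agree on the two sides; what is left is exactly [e_growth]. *)
  assert (C1 : (m + 1) / (m + 3) * df <= sl).
  { apply Rmult_le_reg_r with (m + 3); [lra|].
    replace ((m + 1) / (m + 3) * df * (m + 3)) with ((m + 1) * df) by (field; lra).
    unfold sl, df.
    replace ((m + 1) * (- (m + 3) * y / 2 + e (S (S (S k))) / 2 + (m + 3) / (2 * (m + 2)) * e (S (S k))))
      with ((m + 1) * e (S (S (S k))) / 2 - (m + 1) * (m + 3) * y / 2 +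
        (m + 1) * (m + 3) / (2 * (m + 2)) * e (S (S k))) by (field; lra).
    replace (((m + 1) * y / 2 + (m + 1) / (2 * (m + 2)) * e (S (S k)) + e (S k) / 2) * (m + 3))
      with ((m + 1) * (m + 3) * y / 2 + (m + 3) * e (S k) / 2 +
        (m + 1) * (m + 3) / (2 * (m + 2)) * e (S (S k))) by (field; lra).
    nra. }
  destruct (Rle_dec 0 df) as [Pd|Pd].
  - assert (w2 * df <= w1 * sl).
    { apply Rle_trans with (w1 * ((m + 1) / (m + 3)) * df); [apply Rmult_le_compat_r; auto|].
      rewrite Rmult_assoc. apply Rmult_le_compat_l; auto. }
    nra.
  - nra.
Qed.

(** Indices 0 and 1 contribute nothing, so the pairs start at 2. When the last index is even, its
    term stays alone and is nonpositive by itself. *)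
Lemma pair_sum N : (N <= n)%nat ->
  sum_f_R0 (fun j => w j * (Cmod (kernel_term j (- cis phi)%C) - (2 * INR j - 1 + (-1) ^ j))) N <= 0.
Proof.
  set (t := fun j => w j * (Cmod (kernel_term j (- cis phi)%C) - (2 * INR j - 1 + (-1) ^ j))).
  assert (T0 : t O = 0).
  { unfold t, kernel_term. simpl. replace (1 - 0 * - cis phi + RtoC (0 - 1))%C with (RtoC 0).
    - rewrite Cmod_0. ring.
    - rewrite RtoC_minus. ring. }
  assert (T1 : t 1%nat = 0).
  { unfold t, kernel_term. simpl. replace (- cis phi * 1 - 1 * - cis phi + RtoC (1 - 1))%C with (RtoC 0).
    - rewrite Cmod_0. ring.
    - rewrite RtoC_minus. ring. }
  assert (A : forall h, (S (2 * h) <= n)%nat -> sum_f_R0 t (S (2 * h)) <= 0).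
  { induction h; intros Hh.
    - simpl Nat.mul. rewrite tech5. simpl sum_f_R0. rewrite T0, T1. lra.
    - replace (S (2 * S h)) with (S (S (S (2 * h)))) in * by lia. rewrite !(tech5 t).
      destruct (pair_bound (2 * h) ltac:(lia)) as [_ P]; [exists h; lia|].
      specialize (P ltac:(lia)). specialize (IHh ltac:(lia)). rewrite tech5 in IHh.
      unfold t in *. lra. }
  intros HN. destruct (Nat.Even_or_Odd N) as [[h ->]|[h ->]].
  - destruct h; [simpl; fold (t O); rewrite T0; lra|].
    replace (2 * S h)%nat with (S (S (2 * h))) in * by lia. rewrite tech5.
    destruct (pair_bound (2 * h) ltac:(lia)) as [P _]; [exists h; lia|].
    specialize (A h ltac:(lia)). fold (t (S (S (2 * h)))) in P. lra.
  - replace (2 * h + 1)%nat with (S (2 * h)) in * by lia. apply A; auto.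
Qed.

End KernelBound.

Lemma Cmod_csum u n : Cmod (csum u (S n)) <= sum_f_R0 (fun k => Cmod (u k)) n.
Proof.
  induction n.
  - simpl. rewrite Cplus_0_l. lra.
  - rewrite tech5. change (csum u (S (S n))) with (csum u (S n) + u (S n))%C.
    eapply Rle_trans; [apply Cmod_triangle|]. lra.
Qed.

(** The n-th coefficient of ((1 + z) / (1 - z))^al, that is [kernel_coef] at xi = -1. *)
Definition extremal_coef (al : R) (n : nat) : R :=
  sum_f_R0 (fun k => neg_binom al k * neg_binom (- al) (n - k) * (-1) ^ k) n.

Lemma kernel_coef_m1 al n : kernel_coef al n (RtoC (-1)) = RtoC (extremal_coef al n).
Proof.
  unfold extremal_coef, kernel_coef. rewrite RtoC_sum. apply csum_ext. intros k _. now rewrite <- RtoC_pow, <- RtoC_mult.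
Qed.

Lemma kernel_term_m1 k : kernel_term k (RtoC (-1)) = RtoC (2 * INR k - 1 + (-1) ^ k).
Proof.
  unfold kernel_term. rewrite <- RtoC_pow, <- RtoC_mult, <- RtoC_minus, <- RtoC_plus. f_equal. ring.
Qed.

(** The first-order part is at most 2 al, its value at xi = -1, and the rest is bounded by the
    paired sum. The weight of index 1 is negative, but [kernel_term] vanishes there. *)
Lemma kernel_coef_bound al phi n : 1 <= al <= 2 -> (1 <= n)%nat ->
  Cmod (kernel_coef al n (- cis phi)%C) <= extremal_coef al n.
Proof.
  intros Hal Hn. destruct n as [|n]; [lia|].
  assert (EB : extremal_coef al (S n) = 2 * al + sum_f_R0 (fun k => neg_binom al k * neg_binom (- al) (S n - k) *
     (2 * INR k - 1 + (-1) ^ k)) (S n)).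
  { apply RtoC_inj. rewrite <- kernel_coef_m1, kernel_coef_decomposition, RtoC_plus, RtoC_sum. f_equal.
    - rewrite RtoC_mult. replace (1 - RtoC (-1))%C with (RtoC 2); [ring|].
      rewrite <- RtoC_minus. f_equal. ring.
    - apply csum_ext. intros k _. rewrite kernel_term_m1, <- RtoC_mult. reflexivity. }
  rewrite EB, kernel_coef_decomposition. eapply Rle_trans; [apply Cmod_triangle|].
  apply Rplus_le_compat.
  - rewrite Cmod_mult, Cmod_R, Rabs_pos_eq by lra.
    assert (Cmod (1 - - cis phi)%C <= 2).
    { unfold Cminus. eapply Rle_trans; [apply Cmod_triangle|].
      rewrite !Cmod_opp, Cmod_cis, Cmod_1. lra. }
    nra.
  - eapply Rle_trans; [apply Cmod_csum|].
    pose proof (pair_sum al phi (S n) Hal (S n) (le_n _)) as P.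
    apply Rminus_le. rewrite <- minus_sum. eapply Rle_trans; [|exact P].
    apply sum_Rle. intros k Hk. rewrite Cmod_mult, Cmod_R.
    set (wk := neg_binom al k * neg_binom (- al) (S n - k)).
    assert (Hw : Rabs wk * Cmod (kernel_term k (- cis phi)%C) = wk * Cmod (kernel_term k (- cis phi)%C)).
    { destruct k as [|[|k]].
      - replace (kernel_term 0 (- cis phi)%C) with (RtoC 0); [rewrite Cmod_0; ring|].
        unfold kernel_term. simpl. rewrite RtoC_minus. ring.
      - replace (kernel_term 1 (- cis phi)%C) with (RtoC 0); [rewrite Cmod_0; ring|].
        unfold kernel_term. simpl. rewrite RtoC_minus. ring.
      - rewrite Rabs_pos_eq; auto. apply (w_pos al (S n) Hal). }
    rewrite Hw. apply Req_le. ring.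
Qed.

Lemma extremal_coef_nonneg al n : 1 <= al <= 2 -> (1 <= n)%nat -> 0 <= extremal_coef al n.
Proof.
  intros Ha Hn. eapply Rle_trans; [apply Cmod_ge_0|apply (kernel_coef_bound al 0 n Ha Hn)].
Qed.

(** * Coefficients of powers of functions with values in a half-plane *)

Lemma polar (z : C) : exists t, z = (RtoC (Cmod z) * cis t)%C.
Proof.
  destruct (Req_dec (Cmod z) 0) as [E|E].
  { exists 0. rewrite E. rewrite (Cmod_eq_0 z E). ring. }
  assert (P : 0 < Cmod z) by (pose proof (Cmod_ge_0 z); lra).
  pose proof (Cmod_sqr z) as Q. set (r := Cmod z) in *.
  set (x := Re z / r). set (v := Im z / r).
  assert (S : x * x + v * v = 1).
  { unfold x, v. replace (Re z / r * (Re z / r) + Im z / r * (Im z / r)) with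
      ((Re z * Re z + Im z * Im z) / (r * r)) by (field; lra). rewrite <- Q. field. lra. }
  assert (Bx : -1 <= x <= 1) by (split; nra).
  assert (Sq : sqrt (1 - x * x) = Rabs v).
  { replace (1 - x * x) with (Rsqr v) by (unfold Rsqr; lra). apply sqrt_Rsqr_abs. }
  assert (Fin : forall t, cos t = x -> sin t = v -> z = (RtoC r * cis t)%C).
  { intros t Ec Es. unfold cis. rewrite Ec, Es. unfold x, v.
    apply injective_projections; unfold Re, Im; simpl; field; lra. }
  destruct (Rle_dec 0 v) as [Hv|Hv].
  - exists (acos x). apply Fin; [apply cos_acos; auto|]. rewrite sin_acos by auto.
    unfold Rsqr. rewrite Sq. apply Rabs_pos_eq; auto.
  - exists (- acos x). apply Fin; [rewrite cos_neg; apply cos_acos; auto|].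
    rewrite sin_neg, sin_acos by auto. unfold Rsqr. rewrite Sq, Rabs_left by lra. ring.
Qed.

(** Along the radius to z the imaginary part is a continuous real function that cannot cross a or
    b. *)
Lemma Im_stays_between L a b : holo L -> a < Im (L (RtoC 0)) < b ->
  (forall z, unit_disc z -> Im (L z) <> a /\ Im (L z) <> b) ->
  forall z, unit_disc z -> a < Im (L z) < b.
Proof.
  intros HL H0 Hne z Hz.
  assert (In : forall s, 0 <= s <= 1 -> unit_disc (RtoC s * z)%C).
  { intros s Hs. unfold unit_disc in *. rewrite Cmod_mult, Cmod_R, Rabs_pos_eq by lra.
    pose proof (Cmod_ge_0 z). nra. }
  set (h := fun s => Im (L (RtoC s * z)%C)).
  assert (Hc : forall s, 0 <= s <= 1 -> continuity_pt h s).
  { intros s Hs. destruct (HL _ (In s Hs)) as [l Hl].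
    assert (Pg : pcont (fun s => RtoC s * z)%C s).
    { apply pcont_mult; [|apply pcont_const]. split; [apply continuous_id|apply continuous_const]. }
    destruct (pcont_comp L (fun s => RtoC s * z)%C s l Hl Pg) as [_ A].
    apply continuity_pt_filterlim, A. }
  assert (h0 : h 0 = Im (L (RtoC 0))) by (unfold h; now rewrite Cmult_0_l).
  assert (h1 : h 1 = Im (L z)) by (unfold h; now rewrite Cmult_1_l).
  assert (Cc : forall k s, 0 <= s <= 1 -> continuity_pt (fun s => h s - k) s).
  { intros k s Hs. apply continuity_pt_minus; auto. apply continuity_pt_const. intros ? ?; auto. }
  split; apply Rnot_le_lt; intros Hle.
  - destruct (Hne z Hz) as [N _].
    destruct (IVT_interv (fun s => a - h s) 0 1) as (s & Hs & Es); try lra.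
    { intros s Hs. apply continuity_pt_minus; auto. apply continuity_pt_const. intros ? ?; auto. }
    apply (proj1 (Hne _ (In s Hs))). unfold h in Es. lra.
  - destruct (Hne z Hz) as [_ N].
    destruct (IVT_interv (fun s => h s - b) 0 1) as (s & Hs & Es); try lra; auto.
    apply (proj2 (Hne _ (In s Hs))). unfold h in Es. lra.
Qed.

(** The logarithm, rather than exp lam, is the datum, so that real powers carry no branch ambiguity;
    exp lam is 1 at the origin and has its values in the half-plane around the direction psi. *)
Definition strip (psi : R) (lam : C -> C) : Prop :=
  holo lam /\ lam (RtoC 0) = RtoC 0 /\
  forall z, unit_disc z -> psi - PI / 2 < Im (lam z) < psi + PI / 2.

Definition epow (al : R) (lam : C -> C) (z : C) : C := cexp (RtoC al * lam z)%C.

Lemma holo_epow al lam : holo lam -> holo (epow al lam).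
Proof. intros A. apply holo_cexp, holo_cmul, A. Qed.

Lemma epow_1 lam z : epow 1 lam z = cexp (lam z).
Proof. unfold epow. f_equal. ring. Qed.

Lemma cder_epow al lam z l : cder lam z l ->
  cder (epow al lam) z (epow al lam z * (RtoC al * l))%C.
Proof.
  intros A. apply (cder_comp cexp (fun w => RtoC al * lam w)%C); [|apply cder_cexp].
  apply (cder_comp (fun w => RtoC al * w)%C lam); auto. apply cder_cmul.
Qed.

(* The differential equation [q b' = al q' b] between [q] and [b = q ^ al]. *)
Definition power_rec (al : R) (q b : nat -> C) : Prop :=
  b O = RtoC 1 /\ forall n, (RtoC (INR (S n)) * b (S n))%C =
    csum (fun j => RtoC (al * INR (S j) - INR (n - j)) * q (S j) * b (n - j)%nat)%C (S n).

Lemma epow_power_rec al lam q b : holo lam -> lam (RtoC 0) = RtoC 0 ->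
  taylor_on_disc q (epow 1 lam) -> taylor_on_disc b (epow al lam) -> power_rec al q b.
Proof.
  intros HL L0 Tq Tb.
  assert (q0 : q O = RtoC 1).
  { rewrite (taylor_0 _ _ Tq). unfold epow. rewrite L0, Cmult_0_r. apply cexp_0. }
  assert (b0 : b O = RtoC 1).
  { rewrite (taylor_0 _ _ Tb). unfold epow. rewrite L0, Cmult_0_r. apply cexp_0. }
  split; auto. intros n.
  pose proof (taylor_mult _ _ _ _ Tq (taylor_C_derive _ _ Tb)) as T1.
  pose proof (taylor_scal (RtoC al) _ _ (taylor_mult _ _ _ _ (taylor_C_derive _ _ Tq) Tb)) as T2.
  assert (E : taylor_on_disc (fun n => RtoC al * cauchy_prod (fun k => RtoC (INR (S k)) * q (S k)) b n)%C
     (fun z => epow 1 lam z * C_derive (epow al lam) z)%C).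
  { refine (taylor_ext _ _ _ _ (fun k => eq_refl) _ T2).
    intros z Hz. pose proof (holo_C_derive lam HL z Hz) as D.
    rewrite (C_derive_unique _ _ _ (cder_epow al lam z _ D)), (C_derive_unique _ _ _ (cder_epow 1 lam z _ D)).
    ring. }
  pose proof (taylor_unique _ _ _ T1 E n) as E'. clear E. rename E' into E. cbv beta in E.
  unfold cauchy_prod in E. rewrite csum_S_l, q0, Nat.sub_0_r in E.
  replace (RtoC (INR (S n)) * b (S n))%C with
    (RtoC al * csum (fun k => RtoC (INR (S k)) * q (S k) * b (n - k)%nat) (S n) -
     csum (fun k => q (S k) * (RtoC (INR (S (n - S k))) * b (S (n - S k)))) n)%C.
  2:{ rewrite <- E. ring. }
  set (c := fun k => (q (S k) * (RtoC (INR (n - k)) * b (n - k)%nat))%C).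
  assert (Ec : csum (fun k => q (S k) * (RtoC (INR (S (n - S k))) * b (S (n - S k))))%C n = csum c (S n)).
  { change (csum c (S n)) with (csum c n + c n)%C. unfold c at 2. rewrite Nat.sub_diag. change (INR 0) with 0.
    rewrite Cmult_0_l, Cmult_0_r, Cplus_0_r. apply csum_ext. intros k Hk. unfold c.
    replace (S (n - S k)) with (n - k)%nat by lia. reflexivity. }
  rewrite Ec, <- csum_scal.
  replace (csum c (S n)) with (- (1) * (- (1) * csum c (S n)))%C by ring.
  rewrite <- csum_scal.
  replace (csum (fun k => RtoC al * (RtoC (INR (S k)) * q (S k) * b (n - k)%nat)) (S n) -
     - (1) * csum (fun k => - (1) * c k) (S n))%C with
     (csum (fun k => RtoC al * (RtoC (INR (S k)) * q (S k) * b (n - k)%nat)) (S n) +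
       csum (fun k => - (1) * c k) (S n))%C by ring.
  rewrite <- csum_plus. apply csum_ext. intros k Hk. unfold c.
  rewrite RtoC_minus, RtoC_mult. ring.
Qed.

Lemma csum_bound u M n : (forall k, (k < n)%nat -> Cmod (u k) <= M) -> Cmod (csum u n) <= INR n * M.
Proof.
  induction n; intros A.
  - simpl. rewrite Cmod_0. lra.
  - simpl csum. rewrite S_INR. eapply Rle_trans; [apply Cmod_triangle|].
    pose proof (IHn (fun k Hk => A k ltac:(lia))). pose proof (A n ltac:(lia)). lra.
Qed.

Lemma csum_minus u v n : (csum u n - csum v n)%C = csum (fun k => u k - v k)%C n.
Proof. induction n; simpl; [ring|]. rewrite <- IHn. ring. Qed.

(** The recursion is bilinear in q and b and uses finitely many coefficients, so induction yields a
    constant that depends on al and n alone. It converts closeness of exp lam to a kernel into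
    closeness of the powers. *)
Lemma power_rec_lipschitz al n : 0 <= al <= 2 -> exists K, 0 <= K /\ forall q b q' b',
  power_rec al q b -> power_rec al q' b' ->
  (forall j, Cmod (q (S j)) <= 2) -> (forall j, Cmod (q' (S j)) <= 2) ->
  forall i, (i <= n)%nat -> Cmod (b i) <= K /\
  forall d, 0 <= d -> (forall j, (j < n)%nat -> Cmod (q (S j) - q' (S j))%C <= d) ->
    Cmod (b i - b' i)%C <= K * d.
Proof.
  intros Ha. induction n as [|n (K & PK & IH)].
  - exists 1. split; [lra|]. intros q b q' b' [B0 _] [B0' _] _ _ i Hi.
    assert (i = O) by lia. subst i. rewrite B0, B0', Cmod_1. split; [lra|].
    intros d Hd _. replace (RtoC 1 - 1)%C with (RtoC 0) by ring. rewrite Cmod_0. lra.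
  - assert (Pn : 0 < INR (S n)) by (apply lt_0_INR; lia).
    (* The factors al (j + 1) - (n - j) are at most 3 (n + 1) in modulus, and each product q b
       varies by at most 2 K d + d K. *)
    exists (K + 9 * INR (S n) * K). split; [nra|].
    intros q b q' b' R R' Hq Hq' i Hi.
    assert (Cf : forall j, (j < S n)%nat -> Rabs (al * INR (S j) - INR (n - j)) <= 3 * INR (S n)).
    { intros j Hj. assert (INR (S j) <= INR (S n)) by (apply le_INR; lia).
      assert (INR (n - j) <= INR (S n)) by (apply le_INR; lia).
      pose proof (pos_INR (S j)). pose proof (pos_INR (n - j)). apply Rabs_le. nra. }
    assert (Sc : forall x M, Cmod (RtoC (INR (S n)) * x)%C <= INR (S n) * M -> Cmod x <= M).
    { intros x M A. rewrite Cmod_mult, Cmod_R, Rabs_pos_eq in A by lra.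
      apply Rmult_le_reg_l with (INR (S n)); auto. }
    destruct (Nat.eq_dec i (S n)) as [->|Hne].
    + destruct R as [R0 R1], R' as [R0' R1'].
      assert (IHb := IH q b q' b' (conj R0 R1) (conj R0' R1') Hq Hq').
      assert (IHb' := IH q' b' q b (conj R0' R1') (conj R0 R1) Hq' Hq).
      split.
      * apply Rle_trans with (3 * INR (S n) * (2 * K)); [|nra]. apply Sc. rewrite R1.
        apply csum_bound. intros j Hj. rewrite !Cmod_mult, Cmod_R, Rmult_assoc.
        apply Rmult_le_compat; [apply Rabs_pos|apply Rmult_le_pos; apply Cmod_ge_0|auto|].
        apply Rmult_le_compat; auto; try apply Cmod_ge_0. apply (IHb (n - j)%nat); lia.
      * intros d Hd Hqd.
        apply Rle_trans with (3 * INR (S n) * (2 * (K * d) + d * K));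
          [|assert (0 <= K * d) by nra; nra].
        apply Sc. replace (RtoC (INR (S n)) * (b (S n) - b' (S n)))%C with
          (RtoC (INR (S n)) * b (S n) - RtoC (INR (S n)) * b' (S n))%C by ring.
        rewrite R1, R1', csum_minus. apply csum_bound. intros j Hj.
        set (cj := RtoC (al * INR (S j) - INR (n - j))).
        replace (cj * q (S j) * b (n - j)%nat - cj * q' (S j) * b' (n - j)%nat)%C with
          (cj * (q (S j) * (b (n - j)%nat - b' (n - j)%nat) + (q (S j) - q' (S j)) * b' (n - j)%nat))%C by ring.
        rewrite Cmod_mult. unfold cj. rewrite Cmod_R.
        apply Rmult_le_compat; [apply Rabs_pos|apply Cmod_ge_0|auto|].
        eapply Rle_trans; [apply Cmod_triangle|]. rewrite !Cmod_mult.
        apply Rplus_le_compat; (apply Rmult_le_compat; auto; try apply Cmod_ge_0).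
        -- apply (IHb (n - j)%nat); auto; lia.
        -- apply (IHb' (n - j)%nat); lia.
    + destruct (IH q b q' b' R R' Hq Hq' i ltac:(lia)) as [A B]. split; [nra|].
      intros d Hd Hqd. specialize (B d Hd (fun j Hj => Hqd j ltac:(lia))).
      assert (0 <= INR (S n) * K * d) by (repeat apply Rmult_le_pos; lra). nra.
Qed.

Lemma taylor_dilate a F rho : 0 <= rho <= 1 -> taylor_on_disc a F ->
  taylor_on_disc (fun k => a k * RtoC rho ^ k)%C (fun z => F (RtoC rho * z)%C).
Proof.
  intros Hr T. apply taylor_clim. intros z Hz.
  apply clim_ext with (psum a (RtoC rho * z)%C).
  - intros n. apply csum_ext. intros k _. rewrite Cpow_mult_l. ring.
  - apply (proj1 (taylor_clim a F) T). unfold unit_disc in *.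
    rewrite Cmod_mult, Cmod_R, Rabs_pos_eq by lra. pose proof (Cmod_ge_0 z). nra.
Qed.

(** Differentiating exp L = 1 - c z gives (1 - c z) L' = - c, hence a two-term recursion for the
    coefficients of exp (al L), which is that of [neg_binom]. *)
Lemma binomial_series al c L a : Cmod c <= 1 -> holo L -> L (RtoC 0) = RtoC 0 ->
  (forall z, unit_disc z -> cexp (L z) = (1 - c * z)%C) ->
  taylor_on_disc a (epow al L) -> forall k, a k = (RtoC (neg_binom al k) * c ^ k)%C.
Proof.
  intros Hc HL L0 E T.
  assert (Nz : forall z, unit_disc z -> (1 - c * z)%C <> RtoC 0).
  { intros z Hz. rewrite <- E by auto. apply cexp_neq_0. }
  assert (DL : forall z, unit_disc z -> (C_derive L z * (1 - c * z))%C = (- c)%C).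
  { intros z Hz. rewrite <- E by auto. rewrite Cmult_comm.
    rewrite <- (C_derive_unique (fun z => cexp (L z)) z (cexp (L z) * C_derive L z)%C).
    - apply C_derive_unique. destruct (unit_disc_open z Hz) as (d & Hd & Hb).
      apply (cder_ext (fun z => 1 + (- c) * z)%C _ z _ d Hd).
      + intros w Hw. rewrite E by auto. ring.
      + pose proof (cder_plus (fun _ => RtoC 1) (fun z => - c * z)%C z _ _ (cder_const _ _) (cder_cmul _ _)) as D.
        rewrite Cplus_0_l in D. exact D.
    - apply (cder_comp cexp L); [apply holo_C_derive; auto|apply cder_cexp]. }
  pose proof (taylor_C_derive _ _ T) as T'.
  pose proof (taylor_plus _ _ _ _ T' (taylor_scal (- c) _ _ (taylor_zmul _ _ T'))) as T1.
  pose proof (taylor_scal (- RtoC al * c) _ _ T) as T2.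
  assert (Eq : forall z, unit_disc z -> (- RtoC al * c * epow al L z)%C =
     (C_derive (epow al L) z + - c * (z * C_derive (epow al L) z))%C).
  { intros z Hz. rewrite (C_derive_unique _ _ _ (cder_epow al L z _ (holo_C_derive L HL z Hz))).
    transitivity (epow al L z * (RtoC al * (C_derive L z * (1 - c * z))))%C; [|ring].
    rewrite (DL z Hz). ring. }
  pose proof (taylor_unique _ _ _ T1 (taylor_ext _ _ _ _ (fun k => eq_refl) Eq T2)) as U.
  cbv beta in U.
  assert (Rec : forall k, (RtoC (INR (S k)) * a (S k))%C = (c * RtoC (INR k - al) * a k)%C).
  { intros k. specialize (U k). rewrite RtoC_minus. destruct k as [|k].
    - replace (RtoC (INR 1) * a 1%nat)%C with (RtoC (INR 1) * a 1%nat + - c * 0)%C by ring.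
      rewrite U. simpl INR. ring.
    - replace (RtoC (INR (S (S k))) * a (S (S k)))%C with
        (RtoC (INR (S (S k))) * a (S (S k)) + - c * (RtoC (INR (S k)) * a (S k)) +
         c * (RtoC (INR (S k)) * a (S k)))%C by ring.
      rewrite U. ring. }
  intros k. induction k as [|k IH].
  - rewrite (taylor_0 _ _ T). unfold epow. rewrite L0, Cmult_0_r, cexp_0. simpl. ring.
  - assert (N : RtoC (INR (S k)) <> RtoC 0) by (apply RtoC_neq_0, not_0_INR; lia).
    replace (a (S k)) with (RtoC (INR (S k)) * a (S k) / RtoC (INR (S k)))%C by (field; auto).
    rewrite Rec, IH. pose proof (neg_binom_S al k) as B. rewrite <- S_INR in B.
    replace (RtoC (neg_binom al (S k))) with (RtoC (INR (S k)) * RtoC (neg_binom al (S k)) / RtoC (INR (S k)))%C by (field; auto).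
    rewrite <- RtoC_mult, B, RtoC_mult, Cpow_S. field; auto.
Qed.

(* The logarithm of the kernel [(1 - xi x z) / (1 - x z)], [xi = - cis (2 psi)], [x = cis s]. *)
Lemma kernel_log (psi s : R) : - (PI / 2) < psi < PI / 2 ->
  exists kap, strip psi kap /\
    (forall z, unit_disc z -> cexp (kap z) =
      ((1 - - cis (2 * psi) * cis s * z) / (1 - cis s * z))%C) /\
    (forall al a, taylor_on_disc a (epow al kap) ->
       forall n, a n = (cis s ^ n * kernel_coef al n (- cis (2 * psi)))%C).
Proof.
  intros Hpsi.
  assert (Nz : forall c z, Cmod c <= 1 -> unit_disc z -> (1 - c * z)%C <> RtoC 0).
  { intros c z Hc Hz E. assert (A : (c * z)%C = RtoC 1).
    { replace (c * z)%C with (1 - (1 - c * z))%C by ring. rewrite E. ring. }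
    apply (f_equal Cmod) in A. rewrite Cmod_mult, Cmod_1 in A. unfold unit_disc in Hz.
    pose proof (Cmod_ge_0 c). pose proof (Cmod_ge_0 z). nra. }
  assert (Lg : forall c, Cmod c <= 1 -> exists L, holo L /\ L (RtoC 0) = RtoC 0 /\
    forall z, unit_disc z -> cexp (L z) = (1 - c * z)%C).
  { intros c Hc. destruct (analytic_log (fun z => 1 - c * z)%C) as (L & HL & L0 & EL).
    - apply holo_minus; [apply holo_const|apply holo_cmul, holo_id].
    - auto.
    - exists L. repeat split; auto. intros z Hz. rewrite EL by auto.
      replace (1 - c * 0)%C with (RtoC 1) by ring. ring. }
  set (xi := (- cis (2 * psi))%C).
  assert (C1 : Cmod (xi * cis s)%C <= 1).
  { unfold xi. rewrite Cmod_mult, Cmod_opp, !Cmod_cis. lra. }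
  assert (C2 : Cmod (cis s) <= 1) by (rewrite Cmod_cis; lra).
  destruct (Lg _ C1) as (L1 & HL1 & L10 & E1). destruct (Lg _ C2) as (L2 & HL2 & L20 & E2).
  assert (Hk : holo (fun z => L1 z - L2 z)%C) by (apply holo_minus; auto).
  assert (Ek : forall z, unit_disc z -> cexp (L1 z - L2 z) = ((1 - xi * cis s * z) / (1 - cis s * z))%C).
  { intros z Hz. unfold Cminus at 1. rewrite cexp_plus, cexp_opp, E1, E2 by auto. reflexivity. }
  exists (fun z => L1 z - L2 z)%C. split; [|split; auto].
  - assert (K0 : (L1 0 - L2 0)%C = RtoC 0) by (rewrite L10, L20; ring).
    split; auto. split; auto.
    apply Im_stays_between; auto.
    { rewrite K0. simpl. lra. }
    intros z Hz.
    (* For w = x z, the real part of the kernel turned by - psi, multiplied by |1 - w|^2, is cos psi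
       (1 - |w|^2) > 0. Hence the imaginary part of the logarithm never meets an edge of the
       strip. *)
    assert (P : 0 < cos (Im (L1 z - L2 z)%C - psi)).
    { set (w := (cis s * z)%C).
      assert (Hw : Cmod w < 1) by (unfold w; rewrite Cmod_mult, Cmod_cis; unfold unit_disc in Hz; lra).
      assert (Nw : (1 - w)%C <> RtoC 0) by (apply Nz; auto).
      pose proof (Ek z Hz) as E. unfold Cdiv in E.
      replace (xi * cis s * z)%C with (xi * w)%C in E by (unfold w; ring). fold w in E.
      assert (E' : (cexp (L1 z - L2 z) * (cis (- psi) * RtoC (Cmod (1 - w) * Cmod (1 - w))))%C
        = ((cis (- psi) + cis psi * w) * Cconj (1 - w))%C).
      { rewrite E.
        assert (Q : RtoC (Cmod (1 - w) * Cmod (1 - w)) = ((1 - w) * Cconj (1 - w))%C).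
        { rewrite Cmod_sqr. apply injective_projections; unfold Re, Im; simpl; ring. }
        rewrite Q. unfold xi. replace (2 * psi) with (psi + psi) by ring.
        rewrite cis_plus, cis_opp. field. split; auto. apply cis_neq_0. }
      apply (f_equal Re) in E'.
      assert (Rl : Re (cexp (L1 z - L2 z) * (cis (- psi) * RtoC (Cmod (1 - w) * Cmod (1 - w))))%C =
        exp (Re (L1 z - L2 z)%C) * (Cmod (1 - w) * Cmod (1 - w)) * cos (Im (L1 z - L2 z)%C - psi)).
      { unfold cexp. rewrite cos_minus. unfold cis. rewrite cos_neg, sin_neg.
        set (A := exp _). set (B := Cmod (1 - w) * Cmod (1 - w)). set (V := Im _).
        unfold Re; simpl. ring. }
      assert (Rr : Re ((cis (- psi) + cis psi * w) * Cconj (1 - w))%C = cos psi * (1 - Cmod w * Cmod w)).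
      { rewrite Cmod_sqr. unfold cis. rewrite cos_neg, sin_neg. unfold Re, Im; simpl. ring. }
      rewrite Rl, Rr in E'.
      assert (0 < cos psi) by (apply cos_gt_0; lra).
      assert (0 < Cmod (1 - w)%C) by (apply Cmod_gt_0; auto).
      pose proof (exp_pos (Re (L1 z - L2 z)%C)). pose proof (Cmod_ge_0 w).
      assert (0 < cos psi * (1 - Cmod w * Cmod w)) by (apply Rmult_lt_0_compat; nra).
      apply Rmult_lt_reg_l with (exp (Re (L1 z - L2 z)%C) * (Cmod (1 - w) * Cmod (1 - w))).
      - repeat apply Rmult_lt_0_compat; auto.
      - rewrite Rmult_0_r. lra. }
    split; intros EI; rewrite EI in P.
    + replace (psi - PI / 2 - psi) with (- (PI / 2)) in P by ring. rewrite cos_neg, cos_PI2 in P. lra.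
    + replace (psi + PI / 2 - psi) with (PI / 2) in P by ring. rewrite cos_PI2 in P. lra.
  - intros al a T n.
    destruct (taylor_exists _ (holo_epow al L1 HL1)) as [a1 T1].
    destruct (taylor_exists _ (holo_epow (- al) L2 HL2)) as [a2 T2].
    pose proof (binomial_series al _ L1 a1 C1 HL1 L10 E1 T1) as B1.
    pose proof (binomial_series (- al) _ L2 a2 C2 HL2 L20 E2 T2) as B2.
    rewrite (taylor_mult_coef n _ _ _ _ a T1 T2).
    + unfold cauchy_prod, kernel_coef. rewrite <- csum_scal. apply csum_ext. intros k Hkn.
      rewrite B1, B2. replace (cis s ^ n)%C with (cis s ^ k * cis s ^ (n - k))%C.
      * rewrite RtoC_mult, Cpow_mult_l. fold xi. ring.
      * rewrite <- Cpow_add_r. f_equal. lia.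
    + refine (taylor_ext _ _ _ _ (fun k => eq_refl) _ T).
      intros z Hz. unfold epow. rewrite <- cexp_plus. f_equal. rewrite RtoC_opp. ring.
Qed.

(** * Herglotz' representation *)

Lemma Re_circle_mean_le f g : cont2pi f -> cont2pi g -> (forall t, Re (f t) <= Re (g t)) ->
  Re (circle_mean f) <= Re (circle_mean g).
Proof.
  intros A B Hle. pose proof twopi_pos as P.
  destruct (contin_ex f 0 (2 * PI) ltac:(lra) A) as [X _].
  destruct (contin_ex g 0 (2 * PI) ltac:(lra) B) as [Y _].
  assert (E : forall h, Re (circle_mean h) = / (2 * PI) * RInt (fun t => Re (h t)) 0 (2 * PI)).
  { intros h. unfold circle_mean, CInt. rewrite <- RtoC_inv by lra. unfold Re; simpl. ring. }
  rewrite !E. apply Rmult_le_compat_l; [left; apply Rinv_0_lt_compat; auto|].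
  apply RInt_le; auto; lra.
Qed.

Lemma circle_mean_conj f : cont2pi f -> circle_mean (fun t => Cconj (f t)) = Cconj (circle_mean f).
Proof.
  intros A. pose proof twopi_pos as P.
  destruct (contin_ex f 0 (2 * PI) ltac:(lra) A) as [X Y].
  unfold circle_mean, CInt. rewrite <- RtoC_inv by lra.
  assert (E : RInt (fun t => Im (Cconj (f t))) 0 (2 * PI) = - RInt (fun t => Im (f t)) 0 (2 * PI)).
  { replace (- RInt (fun t => Im (f t)) 0 (2 * PI)) with (-1 * RInt (fun t => Im (f t)) 0 (2 * PI)) by ring.
    rewrite <- RInt_Rscal by auto. apply RInt_ext. intros t _. unfold Im; simpl. ring. }
  rewrite E. apply injective_projections; simpl; unfold Re; simpl; ring.
Qed.

Lemma circle_mean_csum (f : nat -> R -> C) n : (forall j, cont2pi (f j)) ->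
  cont2pi (fun t => csum (fun j => f j t) n) /\
  circle_mean (fun t => csum (fun j => f j t) n) = csum (fun j => circle_mean (f j)) n.
Proof.
  intros A. induction n as [|n [IC IH]].
  - split; [intros t _; apply pcont_const|exact (circle_mean_const (RtoC 0))].
  - split; simpl.
    + intros t Ht. apply pcont_plus; [apply IC, Ht|apply A, Ht].
    + rewrite circle_mean_plus, IH; auto.
Qed.

(* Twice the geometric factor [(1 - xi) / 2], [xi = - cis (2 psi)], of the half-plane
   [Re (cis (- psi) w) > 0] seen from [1]. *)
Definition opening (psi : R) : C := (1 - - cis (2 * psi))%C.

Lemma opening_polar psi : opening psi = (RtoC (2 * cos psi) * cis psi)%C.
Proof.
  unfold opening. replace (2 * psi) with (psi + psi) by ring. rewrite cis_plus.
  pose proof (sin2_cos2 psi) as S. unfold Rsqr in S.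
  apply injective_projections; unfold cis; simpl; [|ring].
  transitivity ((sin psi * sin psi + cos psi * cos psi) + (cos psi * cos psi - sin psi * sin psi)); [rewrite S|]; ring.
Qed.

Lemma Cmod_opening psi : - (PI / 2) < psi < PI / 2 -> Cmod (opening psi) = 2 * cos psi.
Proof.
  intros Hp. rewrite opening_polar, Cmod_mult, Cmod_cis, Cmod_R, Rabs_pos_eq; [ring|].
  pose proof (cos_gt_0 psi). lra.
Qed.

(* Herglotz' representation: the dilated coefficients of [exp lam] are averages of the
   coefficients of the kernels, hence obey every linear inequality that the kernels obey. *)
Lemma herglotz psi lam q (D : nat -> C) n rho tau :
  - (PI / 2) < psi < PI / 2 -> strip psi lam -> taylor_on_disc q (epow 1 lam) -> 0 < rho < 1 ->
  (forall s, Re (csum (fun j => D j * opening psi * cis s ^ S j)%C n) <= tau) ->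
  Re (csum (fun j => D j * q (S j) * RtoC rho ^ S j)%C n) <= tau.
Proof.
  intros Hpsi (HL & L0 & HS) Tq Hr HT.
  pose proof (holo_epow 1 lam HL) as HF. set (F := epow 1 lam) in *.
  assert (Pc : 0 < cos psi) by (apply cos_gt_0; lra).
  set (P := fun t => (cis (- psi) * F (circ rho t))%C).
  assert (CP : cont2pi P).
  { intros t Ht. apply pcont_mult; [apply pcont_const|]. apply (circle_contin F rho HF); auto; lra. }
  assert (PP : forall t, 0 < Re (P t)).
  { intros t. assert (U : unit_disc (circ rho t)) by (unfold unit_disc; rewrite Cmod_circ; lra).
    specialize (HS _ U). unfold P, F. rewrite epow_1.
    set (v := lam (circ rho t)) in *.
    replace (Re (cis (- psi) * cexp v)%C) with (exp (Re v) * cos (Im v - psi)).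
    - apply Rmult_lt_0_compat; [apply exp_pos|]. apply cos_gt_0; lra.
    - rewrite cos_minus. unfold cexp, cis. rewrite cos_neg, sin_neg. unfold Re; simpl. ring. }
  assert (Ci : forall k t, pcont (fun s => (/ cis s) ^ k)%C t).
  { intros k t. apply pcont_pow, pcont_inv; [apply cis_neq_0|apply cis_pcont1]. }
  assert (Nr : RtoC rho <> RtoC 0) by (apply RtoC_neq_0; lra).
  assert (M1 : forall k, circle_mean (fun t => P t * (/ cis t) ^ k)%C = (cis (- psi) * (q k * RtoC rho ^ k))%C).
  { intros k. rewrite (taylor_coef q F rho HF Tq Hr k). unfold coef.
    rewrite (Cmult_comm (circle_mean _)), <- circle_mean_scal, <- circle_mean_scal.
    - apply circle_mean_ext. intros t _. unfold P, circ.
      pose proof (cis_neq_0 t). rewrite !Cpow_inv by (auto; apply Cmult_neq_0; auto).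
      rewrite Cpow_mult_l. field. split; apply Cpow_nz; auto.
    - intros t Ht. apply pcont_mult; [apply pcont_const|].
      apply pcont_mult; [apply (circle_contin F rho HF); auto; lra|].
      apply pcont_pow, pcont_inv; [apply circ_neq_0; lra|apply circ_pcont].
    - intros t Ht. apply pcont_mult; [apply (circle_contin F rho HF); auto; lra|].
      apply pcont_pow, pcont_inv; [apply circ_neq_0; lra|apply circ_pcont]. }
  assert (Cc : forall k, cont2pi (fun t => P t * cis t ^ k)%C).
  { intros k t Ht. apply pcont_mult; auto. apply pcont_pow, cis_pcont1. }
  (* The conjugate boundary values have no coefficient of index k >= 1 here, so the positive
     function Re P carries half the coefficients of [P]; index 0 fixes its total mass. *)
  assert (M2 : forall k, circle_mean (fun t => Cconj (P t) * (/ cis t) ^ k)%C =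
     match k with O => cis psi | _ => RtoC 0 end).
  { intros k. rewrite (circle_mean_ext _ (fun t => Cconj (P t * cis t ^ k))%C).
    2:{ intros t _. rewrite Cmult_conj, Cpow_conj, cis_conj, cis_opp. reflexivity. }
    rewrite circle_mean_conj by auto.
    assert (E : (RtoC rho ^ k * circle_mean (fun t => P t * cis t ^ k))%C =
       (cis (- psi) * ((RtoC 0) ^ k * F (RtoC 0)))%C).
    { rewrite <- circle_mean_scal by auto.
      rewrite <- (mean_value (fun z => cis (- psi) * (z ^ k * F z))%C rho); auto.
      - apply circle_mean_ext. intros t _. unfold P, circ. rewrite Cpow_mult_l. ring.
      - apply holo_cmul, holo_mult; auto. apply holo_pow, holo_id. }
    destruct k.
    - simpl in E. rewrite !Cmult_1_l in E. simpl. rewrite E. unfold F, epow. rewrite L0, Cmult_0_r, cexp_0.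
      rewrite Cmult_1_r, cis_conj. f_equal. ring.
    - rewrite (Cpow_S (RtoC 0)), !Cmult_0_l, Cmult_0_r in E. apply Cmult_zero in E.
      destruct E as [E|E]; [exfalso; revert E; apply Cpow_nz; auto|]. rewrite E.
      apply injective_projections; simpl; ring. }
  (* Density of the representing measure. The mean of Re P is cos psi, so [W] has mean 1. *)
  set (W := fun t => Re (P t) / cos psi).
  assert (EW : forall t, RtoC (W t) = (RtoC (/ (2 * cos psi)) * (P t + Cconj (P t)))%C).
  { intros t. unfold W, Re. apply injective_projections; simpl; [field; lra|ring]. }
  assert (CW : forall k, cont2pi (fun t => RtoC (W t) * (/ cis t) ^ k)%C).
  { intros k t Ht. apply pcont_ext with (fun t => RtoC (/ (2 * cos psi)) * (P t + Cconj (P t)) * (/ cis t) ^ k)%C.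
    - intros s. now rewrite EW.
    - apply pcont_mult; auto. apply pcont_mult; [apply pcont_const|]. apply pcont_plus; auto.
      apply pcont_conj; auto. }
  assert (M3 : forall k, circle_mean (fun t => RtoC (W t) * (/ cis t) ^ k)%C = (RtoC (/ (2 * cos psi)) *
     (cis (- psi) * (q k * RtoC rho ^ k) + match k with O => cis psi | _ => RtoC 0 end))%C).
  { intros k. rewrite <- M1, <- M2, <- circle_mean_plus, <- circle_mean_scal.
    - apply circle_mean_ext. intros t _. rewrite EW. ring.
    - intros t Ht. apply pcont_plus; apply pcont_mult; auto. apply pcont_conj; auto.
    - intros t Ht. apply pcont_mult; auto.
    - intros t Ht. apply pcont_mult; auto. apply pcont_conj; auto. }
  assert (N2 : RtoC (2 * cos psi) <> RtoC 0) by (apply RtoC_neq_0; lra).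
  assert (M4 : forall j, circle_mean (fun t => D j * opening psi * (RtoC (W t) * (/ cis t) ^ S j))%C =
     (D j * q (S j) * RtoC rho ^ S j)%C).
  { intros j. rewrite circle_mean_scal by auto. rewrite M3, opening_polar, cis_opp, RtoC_inv by lra. field.
    split; auto. apply cis_neq_0. }
  destruct (circle_mean_csum (fun j t => D j * opening psi * (RtoC (W t) * (/ cis t) ^ S j))%C n) as [Cs Es].
  { intros j t Ht. apply pcont_mult; [apply pcont_const|]. apply CW, Ht. }
  assert (C1 : cont2pi (fun t => RtoC tau * (RtoC (W t) * (/ cis t) ^ 0))%C).
  { intros t Ht. apply pcont_mult; [apply pcont_const|apply CW, Ht]. }
  rewrite <- (csum_ext _ _ n (fun j _ => M4 j)), <- Es.
  apply Rle_trans with (Re (circle_mean (fun t => RtoC tau * (RtoC (W t) * (/ cis t) ^ 0))%C)).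
  - apply Re_circle_mean_le; auto. intros t.
    rewrite (csum_ext _ (fun j => RtoC (W t) * (D j * opening psi * cis (- t) ^ S j))%C).
    2:{ intros j _. rewrite cis_opp. ring. }
    rewrite csum_scal. set (X := csum _ n).
    replace (Re (RtoC (W t) * X)%C) with (W t * Re X) by (unfold Re; simpl; ring).
    replace (Re (RtoC tau * (RtoC (W t) * (/ cis t) ^ 0))%C) with (W t * tau) by (unfold Re; simpl; ring).
    apply Rmult_le_compat_l; [|apply HT]. unfold W. left. apply Rdiv_lt_0_compat; auto.
  - rewrite circle_mean_scal by (apply (CW O)). rewrite M3. rewrite (taylor_0 _ _ Tq).
    replace (F (RtoC 0)) with (RtoC 1) by (unfold F, epow; rewrite L0, Cmult_0_r; now rewrite cexp_0).
    unfold cis. rewrite cos_neg, sin_neg. unfold Re; simpl. apply Req_le. field. lra.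
Qed.

Lemma le_at_1 (f : R -> R) tau : continuity_pt f 1 -> (forall rho, 0 < rho < 1 -> f rho <= tau) -> f 1 <= tau.
Proof.
  intros Hc A. apply le_epsilon. intros eps He. destruct (Hc eps He) as (d & Hd & B).
  set (x := Rmax (1 / 2) (1 - d / 2)).
  assert (1 / 2 <= x) by apply Rmax_l. assert (1 - d / 2 <= x) by apply Rmax_r.
  assert (x < 1) by (apply Rmax_lub_lt; lra).
  specialize (A x ltac:(lra)). specialize (B x). simpl in B. unfold R_dist in B.
  assert (Q : Rabs (f x - f 1) < eps).
  { apply B. split; [split; [exact I|lra]|]. rewrite Rabs_left; lra. }
  apply Rabs_def2 in Q. lra.
Qed.

Lemma Re_csum_pow_continuous (E : nat -> C) n :
  continuity_pt (fun rho => Re (csum (fun j => E j * RtoC rho ^ S j)%C n)) 1.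
Proof.
  induction n.
  - apply continuity_pt_const. intros ? ?. reflexivity.
  - apply continuity_pt_ext with (fun rho => Re (csum (fun j => E j * RtoC rho ^ S j)%C n) + Re (E n) * rho ^ S n).
    + intros x. change (csum (fun j => E j * RtoC x ^ S j)%C (S n)) with
        (csum (fun j => E j * RtoC x ^ S j)%C n + E n * RtoC x ^ S n)%C.
      rewrite <- RtoC_pow. unfold Re; simpl. ring.
    + apply continuity_pt_plus; auto. apply continuity_pt_mult; [apply continuity_pt_const; intros ? ?; auto|].
      apply derivable_continuous_pt, derivable_pt_pow.
Qed.

Lemma herglotz_limit psi lam q (D : nat -> C) n tau :
  - (PI / 2) < psi < PI / 2 -> strip psi lam -> taylor_on_disc q (epow 1 lam) ->
  (forall s, Re (csum (fun j => D j * opening psi * cis s ^ S j)%C n) <= tau) ->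
  Re (csum (fun j => D j * q (S j))%C n) <= tau.
Proof.
  intros Hp HS Tq HT.
  pose proof (le_at_1 _ tau (Re_csum_pow_continuous (fun j => D j * q (S j))%C n)) as L.
  cbv beta in L. rewrite (csum_ext _ (fun j => D j * q (S j))%C) in L.
  - apply L. intros rho Hr. eapply herglotz; eauto.
  - intros k _. rewrite Cpow_1_l. ring.
Qed.

Lemma csum_single (v : C) m n : (m < n)%nat ->
  csum (fun j => if Nat.eq_dec j m then v else RtoC 0) n = v.
Proof.
  induction n; intros Hm; [lia|]. simpl. destruct (Nat.eq_dec n m) as [->|Hne].
  - rewrite (csum_ext _ (fun _ => RtoC 0 * 0)%C).
    + rewrite csum_scal. ring.
    + intros k Hk. destruct (Nat.eq_dec k m); [lia|ring].
  - rewrite IHn by lia. ring.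
Qed.

Lemma Cmod_le_of_phases (v : C) M : 0 <= M -> (forall t, Re (cis t * v)%C <= M) -> Cmod v <= M.
Proof.
  intros PM A. destruct (polar v) as [t E]. specialize (A (- t)). rewrite E in A at 1.
  replace (cis (- t) * (RtoC (Cmod v) * cis t))%C with (RtoC (Cmod v)) in A; [exact A|].
  rewrite cis_opp. field. apply cis_neq_0.
Qed.

Lemma cis_power_distance s t j : Cmod (cis s ^ j - cis t ^ j)%C <= INR j * Cmod (cis s - cis t)%C.
Proof.
  induction j.
  - simpl. replace (1 - 1)%C with (RtoC 0) by ring. rewrite Cmod_0. lra.
  - rewrite !Cpow_S, S_INR.
    replace (cis s * cis s ^ j - cis t * cis t ^ j)%C with
      (cis s * (cis s ^ j - cis t ^ j) + (cis s - cis t) * cis t ^ j)%C by ring.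
    eapply Rle_trans; [apply Cmod_triangle|]. rewrite !Cmod_mult, Cmod_pow, !Cmod_cis, pow1. lra.
Qed.

(** neg_binom 1 vanishes from index 2 on, so only the first-order part survives. *)
Lemma kernel_coef_1_S n xi : kernel_coef 1 (S n) xi = (1 - xi)%C.
Proof.
  assert (N : forall k, neg_binom 1 (S (S k)) = 0).
  { induction k; [simpl; field|].
    change (neg_binom 1 (S (S k)) * ((INR (S (S k)) - 1) / (INR (S (S k)) + 1)) = 0). rewrite IHk. ring. }
  rewrite kernel_coef_decomposition, (csum_ext _ (fun _ => RtoC 0 * 0)%C).
  - rewrite csum_scal. ring.
  - intros [|[|k]] _; [| |rewrite N, Rmult_0_l; ring]; unfold kernel_term; simpl; rewrite RtoC_minus; ring.
Qed.

(** * The extremal problem for powers of half-plane functions *)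

Section Hull.

Variables (al psi : R).
Hypothesis Hal : 1 <= al <= 2.
Hypothesis Hpsi : - (PI / 2) < psi < PI / 2.

Let u := opening psi.

(** For each phase the functional picks one coefficient, and on every kernel it is at most |u|. *)
Lemma coef_le_opening lam q j : strip psi lam -> taylor_on_disc q (epow 1 lam) ->
  Cmod (q (S j)) <= Cmod u.
Proof.
  intros HS Tq. apply Cmod_le_of_phases; [apply Cmod_ge_0|]. intros t.
  pose proof (herglotz_limit psi lam q (fun i => if Nat.eq_dec i j then cis t else RtoC 0) (S j) (Cmod u)
    Hpsi HS Tq) as A.
  rewrite (csum_ext _ (fun i => if Nat.eq_dec i j then cis t * q (S j) else RtoC 0)%C) in A.
  - rewrite csum_single in A by lia. apply A. intros s.
    rewrite (csum_ext _ (fun i => if Nat.eq_dec i j then cis t * u * cis s ^ S j else RtoC 0)%C).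
    + rewrite csum_single by lia. eapply Rle_trans; [apply Re_le_Cmod|].
      rewrite !Cmod_mult, Cmod_pow, !Cmod_cis, pow1. lra.
    + intros k _. destruct (Nat.eq_dec k j) as [->|]; [reflexivity|ring].
  - intros k _. destruct (Nat.eq_dec k j) as [->|]; [reflexivity|ring].
Qed.

Lemma opening_le_2 : 0 < Cmod u <= 2.
Proof.
  unfold u. rewrite Cmod_opening by auto. pose proof (cos_gt_0 psi). pose proof (COS_bound psi). lra.
Qed.

(* If [|q 1|] almost attains its maximal value [|u|], the representing measure is
   concentrated near a single point [cis s0] of the circle. *)
Lemma coef_concentration lam q : strip psi lam -> taylor_on_disc q (epow 1 lam) ->
  exists s0, forall j K, 0 < K -> Cmod (q (S j) - u * cis s0 ^ S j)%C <=
     Cmod u * (INR (S j) ^ 2 / (4 * K) + 2 * K * (1 - Cmod (q 1%nat) / Cmod u)).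
Proof.
  intros HS Tq. pose proof opening_le_2 as Hu.
  assert (Nu : u <> RtoC 0) by (apply Cmod_gt_0; lra).
  destruct (polar (q 1%nat / u)%C) as [s0 E0]. rewrite Cmod_div in E0 by auto.
  set (r := Cmod (q 1%nat) / Cmod u) in *.
  assert (Eq : q 1%nat = (RtoC r * u * cis s0)%C).
  { replace (q 1%nat) with (u * (q 1%nat / u))%C by (field; auto). rewrite E0. ring. }
  exists s0. intros j K PK.
  pose proof (coef_le_opening lam q 0 HS Tq) as B1.
  assert (Hr : r <= 1).
  { unfold r. apply Rmult_le_reg_r with (Cmod u); [lra|]. unfold Rdiv. rewrite Rmult_assoc, Rinv_l; lra. }
  replace (q (S j) - u * cis s0 ^ S j)%C with (u * (q (S j) / u - cis s0 ^ S j))%C by (field; auto).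
  rewrite Cmod_mult. apply Rmult_le_compat_l; [lra|].
  set (m := INR (S j)).
  assert (P4 : 0 <= m ^ 2 / (4 * K)) by (apply Rdiv_le_0_compat; [apply pow2_ge_0|lra]).
  apply Cmod_le_of_phases; [nra|].
  intros t.
  (* The weight 2 K on the first coefficient penalises mass away from s0. *)
  set (D := fun i : nat => ((if Nat.eq_dec i j then cis t / u else 0) +
     (if Nat.eq_dec i 0 then 2 * K * Cconj (cis s0) / u else 0))%C).
  assert (Sp : forall X : nat -> C, csum (fun i => D i * X i)%C (S j) =
     (cis t / u * X j + 2 * K * Cconj (cis s0) / u * X O)%C).
  { intros X. rewrite (csum_ext _ (fun i => (if Nat.eq_dec i j then cis t / u * X j else 0) +
      (if Nat.eq_dec i 0 then 2 * K * Cconj (cis s0) / u * X O else 0))%C).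
    - rewrite csum_plus, !csum_single by lia. reflexivity.
    - intros k _. unfold D. destruct (Nat.eq_dec k j) as [->|], (Nat.eq_dec _ 0) as [E|]; rewrite ?E; ring. }
  pose proof (herglotz_limit psi lam q D (S j) (m ^ 2 / (4 * K) + 2 * K + Re (cis t * cis s0 ^ S j)%C)
    Hpsi HS Tq) as A.
  rewrite Sp in A. rewrite Eq in A.
  replace (cis t / u * q (S j) + 2 * K * Cconj (cis s0) / u * (r * u * cis s0))%C with
    (cis t * (q (S j) / u) + RtoC (2 * K * r))%C in A.
  2:{ rewrite cis_conj, cis_opp, !RtoC_mult. field. split; auto. apply cis_neq_0. }
  replace (Re (cis t * (q (S j) / u - cis s0 ^ S j))%C) with
    (Re (cis t * (q (S j) / u) + RtoC (2 * K * r))%C - 2 * K * r - Re (cis t * cis s0 ^ S j)%C).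
  2:{ set (X := (q (S j) / u)%C). set (Y := (cis s0 ^ S j)%C). unfold Re; simpl. ring. }
  assert (A' : Re (cis t * (q (S j) / u) + RtoC (2 * K * r))%C <=
     m ^ 2 / (4 * K) + 2 * K + Re (cis t * cis s0 ^ S j)%C); [|lra].
  apply A. clear A. intros s.
  rewrite (csum_ext _ (fun i => D i * (u * cis s ^ S i))%C) by (intros; unfold u; ring).
  rewrite Sp.
  replace (cis t / u * (u * cis s ^ S j) + 2 * K * Cconj (cis s0) / u * (u * cis s ^ 1))%C with
    (cis t * cis s0 ^ S j + (cis t * (cis s ^ S j - cis s0 ^ S j) + RtoC (2 * K) * (cis (- s0) * cis s)))%C.
  2:{ rewrite cis_conj, RtoC_mult. simpl. field. auto. }
  rewrite <- cis_plus. replace (- s0 + s) with (s - s0) by ring.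
  set (dd := Cmod (cis s - cis s0)%C).
  assert (Dd : dd * dd = 2 - 2 * cos (s - s0)).
  { unfold dd. rewrite Cmod_sqr, cos_minus. unfold cis, Re, Im; simpl.
    pose proof (sin2_cos2 s) as S1. pose proof (sin2_cos2 s0) as S2. unfold Rsqr in *. nra. }
  assert (X1 : Re (cis t * (cis s ^ S j - cis s0 ^ S j))%C <= m * dd).
  { eapply Rle_trans; [apply Re_le_Cmod|]. rewrite Cmod_mult, Cmod_cis, Rmult_1_l.
    apply cis_power_distance. }
  set (X := (cis t * (cis s ^ S j - cis s0 ^ S j))%C) in *. set (Y := (cis t * cis s0 ^ S j)%C).
  replace (Re (Y + (X + RtoC (2 * K) * cis (s - s0)))%C) with (Re Y + (Re X + 2 * K * cos (s - s0)))
    by (unfold cis, Re; simpl; ring).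
  (* Since K dd^2 = 2 K (1 - cos (s - s0)), the linear gain m dd is traded against the penalty. *)
  assert (X2 : m * dd <= m ^ 2 / (4 * K) + K * (dd * dd)).
  { apply Rmult_le_reg_r with (4 * K); [lra|].
    replace ((m ^ 2 / (4 * K) + K * (dd * dd)) * (4 * K)) with (m * m + 4 * K * K * (dd * dd)) by (field; lra).
    pose proof (Rle_0_sqr (m - 2 * K * dd)) as Q. unfold Rsqr in Q. lra. }
  nra.
Qed.

(* [exp ((al - 1) lam(rho .)) k_s] is again of the form [exp (al lam')] with [lam'] in the strip. *)
Lemma strip_step lam rho s : strip psi lam -> 0 < rho < 1 ->
  exists lam', strip psi lam' /\ forall h b, taylor_on_disc h (epow (al - 1) lam) ->
    taylor_on_disc b (epow al lam') -> forall n, b (S n) =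
     (h (S n) * RtoC rho ^ S n + csum (fun j => h (n - j)%nat * RtoC rho ^ (n - j) * u * cis s ^ S j) (S n))%C.
Proof.
  intros (HL & L0 & HS) Hr.
  destruct (kernel_log psi s Hpsi) as (kap & (HK & K0 & KS) & Ek & Gc).
  set (lr := fun z => lam (RtoC rho * z)%C).
  assert (In : forall z, unit_disc z -> unit_disc (RtoC rho * z)%C).
  { intros z Hz. unfold unit_disc in *. rewrite Cmod_mult, Cmod_R, Rabs_pos_eq by lra.
    pose proof (Cmod_ge_0 z). nra. }
  assert (Hlr : holo lr) by (apply (holo_comp lam (fun z => RtoC rho * z)%C); auto; apply holo_cmul, holo_id).
  (* The weights (al - 1) / al and 1 / al add up to 1, so the combination stays in the strip. *)
  exists (fun z => RtoC ((al - 1) / al) * lr z + RtoC (/ al) * kap z)%C.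
  assert (HL' : holo (fun z => RtoC ((al - 1) / al) * lr z + RtoC (/ al) * kap z)%C)
    by (apply holo_plus; apply holo_cmul; auto).
  assert (Pa : 0 < / al) by (apply Rinv_0_lt_compat; lra).
  assert (Pb : 0 <= (al - 1) / al) by (apply Rdiv_le_0_compat; lra).
  assert (Pab : (al - 1) / al + / al = 1) by (field; lra).
  split.
  - split; auto. split.
    + unfold lr. rewrite Cmult_0_r, L0, K0. ring.
    + intros z Hz. pose proof (HS _ (In z Hz)) as A. pose proof (KS z Hz) as B. fold (lr z) in A.
      replace (Im (RtoC ((al - 1) / al) * lr z + RtoC (/ al) * kap z)%C) with
        ((al - 1) / al * Im (lr z) + / al * Im (kap z)) by (unfold Im; simpl; ring).
      set (x := (al - 1) / al) in *. set (v := / al) in *.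
      assert (Ex : x = 1 - v) by lra. rewrite Ex in *. split; nra.
  - intros h b Th Tb n.
    destruct (taylor_exists (epow 1 kap) (holo_epow 1 kap HK)) as [kc kernel_term].
    assert (Ekc : forall j, kc (S j) = (u * cis s ^ S j)%C /\ kc O = RtoC 1).
    { intros j. rewrite !(Gc 1 kc kernel_term), kernel_coef_1_S. split; [unfold u, opening; ring|].
      unfold kernel_coef. simpl. rewrite Rmult_1_l. ring. }
    assert (Tp : taylor_on_disc b (fun z => epow 1 kap z * epow (al - 1) lam (RtoC rho * z))%C).
    { refine (taylor_ext _ _ _ _ (fun k => eq_refl) _ Tb).
      intros z Hz. unfold epow. rewrite <- cexp_plus. f_equal. fold (lr z).
      rewrite RtoC_div, RtoC_inv by lra. field. apply RtoC_neq_0; lra. }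
    rewrite (taylor_mult_coef (S n) _ _ _ _ b kernel_term (taylor_dilate _ _ rho ltac:(lra) Th) Tp).
    unfold cauchy_prod. rewrite csum_S_l. destruct (Ekc O) as [_ ->]. rewrite Nat.sub_0_r. f_equal; [ring|].
    apply csum_ext. intros k Hk. destruct (Ekc k) as [-> _]. simpl Nat.sub. ring.
Qed.

(** The quadratic term is strictly convex in the first coefficient and thereby separates kernels
    from their averages. *)
Let Psi (theta eps : R) (n : nat) (b : nat -> C) : R :=
  Re (cis theta * b n)%C + eps * (Cmod (b 1%nat) * Cmod (b 1%nat)).

Lemma Cmod_plus_sqr z w : Cmod (z + w)%C * Cmod (z + w)%C =
  Cmod z * Cmod z + Cmod w * Cmod w + Re (2 * Cconj z * w)%C.
Proof. rewrite !Cmod_sqr. unfold Re, Im; simpl. ring. Qed.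

(** Replacing the factor exp lam by the kernel at s turns the first coefficient into h 1 + u cis s,
    and |u cis s| = |u| whatever s is. The rest of the functional is affine in that factor, so
    averaging over s restores q there, while |u|^2 stays in the place of |q 1|^2. The radius rho
    comes from Herglotz' formula and tends to 1 at the end. *)
Lemma Psi_increase theta eps m sup lam q b : 0 < eps ->
  (forall lam' b', strip psi lam' -> taylor_on_disc b' (epow al lam') -> Psi theta eps (S m) b' <= sup) ->
  strip psi lam -> taylor_on_disc q (epow 1 lam) -> taylor_on_disc b (epow al lam) ->
  Psi theta eps (S m) b + eps * (Cmod u * Cmod u - Cmod (q 1%nat) * Cmod (q 1%nat)) <= sup.
Proof.
  intros He Hsup HS Tq Tb. pose proof HS as (HL & L0 & _).
  destruct (taylor_exists _ (holo_epow (al - 1) lam HL)) as [h Th].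
  assert (h0 : h O = RtoC 1).
  { rewrite (taylor_0 _ _ Th). unfold epow. rewrite L0, Cmult_0_r. apply cexp_0. }
  assert (q0 : q O = RtoC 1).
  { rewrite (taylor_0 _ _ Tq). unfold epow. rewrite L0, Cmult_0_r. apply cexp_0. }
  assert (Eb : forall n, b n = cauchy_prod q h n).
  { intros n. apply (taylor_mult_coef n _ _ _ _ b Tq Th).
    refine (taylor_ext _ _ _ _ (fun k => eq_refl) _ Tb).
    intros z Hz. unfold epow. rewrite <- cexp_plus. f_equal. rewrite RtoC_minus. ring. }
  set (Y := csum (fun j => q (S j) * h (m - j)%nat)%C (S m)).
  assert (Eb1 : b 1%nat = (h 1%nat + q 1%nat)%C).
  { rewrite Eb. unfold cauchy_prod. simpl. rewrite q0, h0. ring. }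
  assert (Ebn : b (S m) = (h (S m) + Y)%C).
  { rewrite Eb. unfold cauchy_prod. rewrite csum_S_l, q0, Nat.sub_0_r. unfold Y. simpl Nat.sub. ring. }
  set (A := Re (cis theta * b (S m))%C). set (H1 := Cmod (h 1%nat) * Cmod (h 1%nat)).
  set (V := Re (2 * Cconj (h 1%nat) * q 1%nat)%C).
  assert (Fin : forall rho, 0 < rho < 1 ->
    A * rho ^ S m + eps * (H1 + V) * rho ^ 2 + eps * (Cmod u * Cmod u) <= sup).
  { intros rho Hr.
    (* The second summand is the cross term of eps |h 1 rho + u cis s|^2, the only part of the
       square that depends on s. *)
    set (D := fun j => (cis theta * (h (m - j)%nat * RtoC rho ^ (m - j)) +
       (if Nat.eq_dec j 0 then RtoC (2 * eps * rho) * Cconj (h 1%nat) else 0))%C).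
    set (h1r := (h 1%nat * RtoC rho)%C).
    assert (Sp : forall X : nat -> C, csum (fun j => D j * X j)%C (S m) =
      (cis theta * csum (fun j => h (m - j)%nat * RtoC rho ^ (m - j) * X j) (S m) +
       RtoC (2 * eps * rho) * Cconj (h 1%nat) * X O)%C).
    { intros X. rewrite <- csum_scal, <- (csum_single (RtoC (2 * eps * rho) * Cconj (h 1%nat) * X O)%C 0 (S m)) by lia.
      rewrite <- csum_plus. apply csum_ext. intros k _. unfold D.
      destruct (Nat.eq_dec k 0) as [->|]; ring. }
    set (tau := sup - Re (cis theta * (h (S m) * RtoC rho ^ S m))%C - eps * (H1 * rho ^ 2 + Cmod u * Cmod u)).
    assert (Hg : Re (csum (fun j => D j * q (S j) * RtoC rho ^ S j)%C (S m)) <= tau).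
    { apply (herglotz psi lam); auto. intros s.
      destruct (strip_step lam rho s HS Hr) as (lam' & HS' & Hc).
      destruct (taylor_exists _ (holo_epow al lam' (proj1 HS'))) as [b' Tb'].
      specialize (Hsup lam' b' HS' Tb'). pose proof (Hc h b' Th Tb' m) as E1.
      pose proof (Hc h b' Th Tb' O) as E2.
      assert (E3 : b' 1%nat = (h 1%nat * RtoC rho + u * cis s)%C).
      { rewrite E2. simpl. rewrite h0. ring. }
      unfold Psi in Hsup. rewrite E1, E3, Cmod_plus_sqr in Hsup.
      rewrite !Cmod_mult, Cmod_cis, Cmod_R, Rabs_pos_eq in Hsup by lra.
      rewrite (csum_ext _ (fun j => D j * (u * cis s ^ S j))%C) by (intros; unfold u; ring).
      rewrite Sp.
      rewrite (csum_ext _ (fun j => h (m - j)%nat * RtoC rho ^ (m - j) * (u * cis s ^ S j))%C) in Hsup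
        by (intros; ring).
      set (Q := csum _ (S m)) in *. unfold tau, H1.
      replace (Re (cis theta * Q + RtoC (2 * eps * rho) * Cconj (h 1%nat) * (u * cis s ^ 1))%C) with
        (Re (cis theta * Q)%C + eps * Re (2 * Cconj (h 1%nat * RtoC rho) * (u * cis s))%C)
        by (unfold Re; simpl; ring).
      rewrite Cmult_plus_distr_l in Hsup.
      set (Z1 := (cis theta * (h (S m) * RtoC rho ^ S m))%C) in *. set (Z2 := (cis theta * Q)%C) in *.
      replace (Re (Z1 + Z2)%C) with (Re Z1 + Re Z2) in Hsup by reflexivity.
      set (x := Cmod (h 1%nat)) in *. set (cu := Cmod u) in *.
      set (R1 := Re (2 * Cconj (h 1%nat * RtoC rho) * (u * cis s))%C) in *. lra. }
    rewrite (csum_ext _ (fun j => D j * (q (S j) * RtoC rho ^ S j))%C) in Hg by (intros; ring).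
    rewrite Sp in Hg.
    rewrite (csum_ext _ (fun j => RtoC rho ^ S m * (q (S j) * h (m - j)%nat))%C) in Hg.
    2:{ intros j Hj. replace (RtoC rho ^ S m)%C with (RtoC rho ^ (m - j) * RtoC rho ^ S j)%C; [ring|].
        rewrite <- Cpow_add_r. f_equal. lia. }
    rewrite csum_scal in Hg. fold Y in Hg. unfold tau in Hg.
    unfold A. rewrite Ebn.
    replace (Re (cis theta * (h (S m) + Y))%C * rho ^ S m) with
      (Re (cis theta * (h (S m) * RtoC rho ^ S m))%C + Re (cis theta * (RtoC rho ^ S m * Y))%C).
    2:{ rewrite <- RtoC_pow. unfold Re; simpl. ring. }
    set (Z1 := Re (cis theta * (h (S m) * RtoC rho ^ S m))%C) in *.
    set (Z2 := (cis theta * (RtoC rho ^ S m * Y))%C) in *.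
    replace (Re (Z2 + RtoC (2 * eps * rho) * Cconj (h 1%nat) * (q 1%nat * RtoC rho ^ 1))%C) with
      (Re Z2 + eps * V * rho ^ 2) in Hg.
    2:{ unfold V. rewrite <- RtoC_pow. unfold Re; simpl. ring. }
    lra. }
  assert (L : A * 1 ^ S m + eps * (H1 + V) * 1 ^ 2 + eps * (Cmod u * Cmod u) <= sup).
  { apply (le_at_1 (fun rho => A * rho ^ S m + eps * (H1 + V) * rho ^ 2 + eps * (Cmod u * Cmod u))); auto.
    apply derivable_continuous_pt. reg. }
  rewrite !pow1 in L. unfold Psi. fold A. rewrite Eb1, Cmod_plus_sqr. fold H1 V. lra.
Qed.

(** The gap makes |q 1| close to |u| for an almost maximal function, which is therefore close to a
    kernel power, where the bound is known. The supremum carries the bound over to every b. *)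
Lemma strip_power_coef_bound lam b n : strip psi lam -> taylor_on_disc b (epow al lam) ->
  (1 <= n)%nat -> Cmod (b n) <= extremal_coef al n.
Proof.
  intros HS Tb Hn. destruct n as [|m]; [lia|]. clear Hn.
  apply Cmod_le_of_phases; [apply extremal_coef_nonneg; auto; lia|]. intros theta.
  destruct (power_rec_lipschitz al (S m) ltac:(lra)) as (K & PK & Lip).
  pose proof opening_le_2 as Hu.
  assert (Rec : forall lam q b, strip psi lam -> taylor_on_disc q (epow 1 lam) ->
     taylor_on_disc b (epow al lam) -> power_rec al q b /\ forall j, Cmod (q (S j)) <= 2).
  { intros l q c HSl Tql Tcl. split.
    - destruct HSl as (HL & L0 & _). eapply epow_power_rec; eauto.
    - intros j. pose proof (coef_le_opening l q j HSl Tql). lra. }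
  (* The total loss is at most (2 + K^2) eps: one eps from the distance to the kernel power, one
     from near-maximality, and K^2 eps from the quadratic term. *)
  apply le_epsilon. intros e0 He0. set (eps := e0 / (2 + K * K)).
  assert (He : 0 < eps) by (apply Rdiv_lt_0_compat; nra).
  assert (E0 : eps * (2 + K * K) = e0) by (unfold eps; field; nra).
  assert (Bd : forall lam' b', strip psi lam' -> taylor_on_disc b' (epow al lam') ->
    forall i, (i <= S m)%nat -> Cmod (b' i) <= K).
  { intros lam' b' HS' Tb' i Hi. destruct (taylor_exists _ (holo_epow 1 lam' (proj1 HS'))) as [q' Tq'].
    destruct (Rec lam' q' b' HS' Tq' Tb') as [R1 R2].
    apply (Lip q' b' q' b' R1 R1 R2 R2 i Hi). }
  destruct (completeness (fun v => exists lam' b', strip psi lam' /\ taylor_on_disc b' (epow al lam') /\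
     v = Psi theta eps (S m) b')) as [sup [Up Least]].
  { exists (K + eps * (K * K)). intros v (lam' & b' & HS' & Tb' & ->). unfold Psi.
    apply Rplus_le_compat.
    - eapply Rle_trans; [apply Re_le_Cmod|]. rewrite Cmod_mult, Cmod_cis, Rmult_1_l. eapply Bd; eauto.
    - apply Rmult_le_compat_l; [lra|].
      assert (Cmod (b' 1%nat) <= K) by (apply (Bd lam' b' HS' Tb'); lia). pose proof (Cmod_ge_0 (b' 1%nat)). nra. }
  { exists (Psi theta eps (S m) b), lam, b. auto. }
  assert (Hsup : forall lam' b', strip psi lam' -> taylor_on_disc b' (epow al lam') -> Psi theta eps (S m) b' <= sup).
  { intros lam' b' HS' Tb'. apply Up. exists lam', b'. auto. }
  set (d := eps / (K + 1)). assert (Pd : 0 < d) by (apply Rdiv_lt_0_compat; lra).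
  assert (Ed : K * d <= eps).
  { unfold d. apply Rmult_le_reg_r with (K + 1); [lra|].
    replace (K * (eps / (K + 1)) * (K + 1)) with (K * eps) by (field; lra). nra. }
  set (M := INR (S m)). assert (PM : 1 <= M) by (unfold M; rewrite S_INR; pose proof (pos_INR m); lra).
  (* This choice bounds the first summand of the concentration estimate by d / 4, and [tau] is
     chosen to do the same for the second; |u| <= 2 turns their sum into d. *)
  set (kk := M ^ 2 / d). assert (Pk : 0 < kk) by (apply Rdiv_lt_0_compat; auto; nra).
  set (tau := Rmin 1 (Cmod u * Cmod u * (d / (8 * kk)))).
  assert (Ht : tau <= 1) by apply Rmin_l.
  assert (Ht2 : tau <= Cmod u * Cmod u * (d / (8 * kk))) by apply Rmin_r.
  assert (Pt : 0 < tau).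
  { apply Rmin_pos; [lra|]. apply Rmult_lt_0_compat; [nra|apply Rdiv_lt_0_compat; lra]. }
  assert (Near : exists lam' b', strip psi lam' /\ taylor_on_disc b' (epow al lam') /\
     sup - eps * tau < Psi theta eps (S m) b').
  { apply NNPP. intros No. assert (sup <= sup - eps * tau); [|nra].
    apply Least. intros v (lam' & b' & HS' & Tb' & ->). apply Rnot_lt_le. intros Hlt.
    apply No. exists lam', b'. auto. }
  destruct Near as (lam' & b' & HS' & Tb' & Hnear).
  destruct (taylor_exists _ (holo_epow 1 lam' (proj1 HS'))) as [q' Tq'].
  pose proof (Psi_increase theta eps m sup lam' q' b' He Hsup HS' Tq' Tb') as Inc.
  assert (Gap : Cmod u * Cmod u - Cmod (q' 1%nat) * Cmod (q' 1%nat) < tau).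
  { apply Rmult_lt_reg_l with eps; auto. lra. }
  destruct (coef_concentration lam' q' HS' Tq') as [s0 Conc].
  set (r := Cmod (q' 1%nat) / Cmod u) in *.
  assert (Er : Cmod (q' 1%nat) = r * Cmod u) by (unfold r; field; lra).
  assert (Pr : 0 <= r) by (apply Rdiv_le_0_compat; [apply Cmod_ge_0|lra]).
  assert (Gr : 1 - r <= d / (8 * kk)).
  { rewrite Er in Gap.
    assert (1 - r * r < d / (8 * kk)) 
      by (apply Rmult_lt_reg_l with (Cmod u * Cmod u); [nra|];
          replace (Cmod u * Cmod u * (1 - r * r)) with
            (Cmod u * Cmod u - r * Cmod u * (r * Cmod u)) by ring; lra).
    assert (0 < d / (8 * kk)) by (apply Rdiv_lt_0_compat; lra).
    destruct (Rle_dec r 1); nra. }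
  destruct (kernel_log psi s0 Hpsi) as (kap & HSk & _ & Gc).
  destruct (taylor_exists _ (holo_epow 1 kap (proj1 HSk))) as [qk Tqk].
  destruct (taylor_exists _ (holo_epow al kap (proj1 HSk))) as [bk Tbk].
  destruct (Rec lam' q' b' HS' Tq' Tb') as [R1 R2]. destruct (Rec kap qk bk HSk Tqk Tbk) as [R3 R4].
  destruct (Lip q' b' qk bk R1 R3 R2 R4 (S m) (le_n _)) as [_ Close].
  specialize (Close d ltac:(lra)).
  assert (Cl : Cmod (b' (S m) - bk (S m))%C <= K * d).
  { apply Close. intros j Hj. rewrite (Gc 1 qk Tqk), kernel_coef_1_S.
    change (1 - - cis (2 * psi))%C with u. rewrite (Cmult_comm _ u).
    eapply Rle_trans; [apply (Conc j kk Pk)|].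
    assert (Hm : INR (S j) ^ 2 <= M ^ 2).
    { apply pow_incr. split; [apply pos_INR|]. unfold M. apply le_INR. lia. }
    assert (X1 : INR (S j) ^ 2 / (4 * kk) <= d / 4).
    { apply Rmult_le_reg_r with (4 * kk); [lra|].
      replace (INR (S j) ^ 2 / (4 * kk) * (4 * kk)) with (INR (S j) ^ 2) by (field; lra).
      replace (d / 4 * (4 * kk)) with (M ^ 2) by (unfold kk; field; lra). exact Hm. }
    assert (X2 : 2 * kk * (1 - r) <= d / 4).
    { apply Rle_trans with (2 * kk * (d / (8 * kk))); [apply Rmult_le_compat_l; lra|].
      apply Req_le. field. lra. }
    apply Rle_trans with (Cmod u * (d / 4 + d / 4)); [apply Rmult_le_compat_l; lra|nra]. }
  assert (Bkb : Cmod (bk (S m)) <= extremal_coef al (S m)).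
  { rewrite (Gc al bk Tbk), Cmod_mult, Cmod_pow, Cmod_cis, pow1, Rmult_1_l.
    apply kernel_coef_bound; auto; lia. }
  assert (Rb : Re (cis theta * b' (S m))%C <= extremal_coef al (S m) + eps).
  { eapply Rle_trans; [apply Re_le_Cmod|]. rewrite Cmod_mult, Cmod_cis, Rmult_1_l.
    replace (b' (S m)) with ((b' (S m) - bk (S m)) + bk (S m))%C by ring.
    eapply Rle_trans; [apply Cmod_triangle|]. lra. }
  pose proof (Hsup lam b HS Tb) as Hb.
  assert (B1 : Cmod (b' 1%nat) * Cmod (b' 1%nat) <= K * K).
  { assert (Cmod (b' 1%nat) <= K) by (apply (Bd lam' b' HS' Tb'); lia). pose proof (Cmod_ge_0 (b' 1%nat)). nra. }
  unfold Psi in *. pose proof (Cmod_ge_0 (b 1%nat)).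
  assert (0 <= eps * (Cmod (b 1%nat) * Cmod (b 1%nat))) by (apply Rmult_le_pos; nra).
  assert (eps * (Cmod (b' 1%nat) * Cmod (b' 1%nat)) <= eps * (K * K)) by (apply Rmult_le_compat_l; lra).
  nra.
Qed.

End Hull.

(** * Subordination to functions omitting a sector *)

Lemma subordinate_inside w : class_B w -> w (RtoC 0) = RtoC 0 ->
  holo w /\ forall z, unit_disc z -> unit_disc (w z).
Proof.
  intros [Hw Bw] W0. apply holo_analytic in Hw. split; auto.
  intros z Hz. destruct (taylor_exists w Hw) as [a Ta].
  unfold unit_disc in *. eapply Rle_lt_trans; [apply (schwarz a w 1); auto|].
  - intros k Hk. replace k with O by lia. now rewrite (taylor_0 _ _ Ta).
  - rewrite pow_1. exact Hz.
Qed.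

Lemma cis_period t (k : Z) : cis (t + 2 * PI * IZR k) = cis t.
Proof.
  assert (P : forall n, cis (2 * PI * INR n) = RtoC 1).
  { intros n. rewrite Rmult_comm. apply cis_2PI. }
  rewrite cis_plus. replace (cis (2 * PI * IZR k)) with (RtoC 1); [ring|].
  destruct (Z_le_gt_dec 0 k) as [Hk|Hk].
  - rewrite <- (Z2Nat.id k Hk), <- INR_IZR_INZ. now rewrite P.
  - replace (IZR k) with (- INR (Z.to_nat (- k))).
    + replace (2 * PI * - INR (Z.to_nat (- k))) with (- (2 * PI * INR (Z.to_nat (- k)))) by ring.
      rewrite cis_opp, P. field.
    + rewrite INR_IZR_INZ, Z2Nat.id by lia. rewrite opp_IZR. ring.
Qed.

Lemma angle_reduction theta tau : exists k : Z, theta + 2 * PI * IZR k <= tau < theta + 2 * PI * IZR k + 2 * PI.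
Proof.
  pose proof twopi_pos as P. destruct (archimed ((tau - theta) / (2 * PI))) as [A B].
  set (n := up ((tau - theta) / (2 * PI))) in *. exists (n - 1)%Z. rewrite minus_IZR.
  set (v := (tau - theta) / (2 * PI)) in *.
  assert (E : tau = theta + 2 * PI * v) by (unfold v; field; lra). rewrite E. nra.
Qed.

(** The apex p belongs to the sector (t = 0), and beta = 0 describes a single ray. *)
Definition omits_sector (f : C -> C) (p : C) (theta0 beta : R) : Prop :=
  forall theta t, theta0 <= theta <= theta0 + beta -> 0 <= t ->
    ~ image_disc f (p + RtoC t * cis theta)%C.

(** The argument of g - p avoids an arc of length beta, so by connectedness it stays in the
    complementary gap of length 2 PI - beta = al PI. Division of the logarithm by al gives a strip
    of width PI. *)
Lemma sector_coef_bound g b p theta0 beta al : taylor_on_disc b g ->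
  omits_sector g p theta0 beta -> 0 <= beta -> 1 <= al <= 2 -> beta = (2 - al) * PI ->
  forall n, (1 <= n)%nat -> Cmod (b n) <= Cmod (g (RtoC 0) - p)%C * extremal_coef al n.
Proof.
  intros Tb Om Hb Ha Eb n Hn. pose proof PI_RGT_0 as PP.
  pose proof (taylor_holo _ _ Tb) as Hg.
  assert (Nz : forall z, unit_disc z -> (g z - p)%C <> RtoC 0).
  { intros z Hz E. apply (Om theta0 0); [lra|lra|]. exists z. split; auto.
    replace (p + 0 * cis theta0)%C with p by ring.
    replace (g z) with (p + (g z - p))%C by ring. rewrite E. ring. }
  destruct (analytic_log (fun z => g z - p)%C) as (L & HL & L0 & EL); auto.
  { apply holo_minus; auto. apply holo_const. }
  cbv beta in EL. set (d := (g (RtoC 0) - p)%C) in *.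
  destruct (polar d) as [tau Et].
  assert (Ang : forall z theta k, unit_disc z -> theta0 <= theta <= theta0 + beta ->
     tau + Im (L z) <> theta + 2 * PI * IZR k).
  { intros z th k Hz Hth E. apply (Om th (Cmod d * exp (Re (L z)))); auto.
    - apply Rmult_le_pos; [apply Cmod_ge_0|left; apply exp_pos].
    - exists z. split; auto. rewrite <- (cis_period th k), <- E, cis_plus, RtoC_mult.
      replace (g z) with (p + (g z - p))%C by ring. rewrite (EL z Hz). rewrite Et at 1. unfold cexp. ring. }
  (* The sector is moved by full turns to its last position starting at or before the argument tau
     of g(0) - p. *)
  destruct (angle_reduction theta0 tau) as [k [K1 K2]].
  set (t1 := theta0 + 2 * PI * IZR k) in *.
  assert (K3 : t1 + beta < tau).
  { apply Rnot_le_lt. intros Hle.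
    apply (Ang (RtoC 0) (tau - 2 * PI * IZR k) k unit_disc_0); [unfold t1 in *; lra|].
    rewrite L0. simpl. ring. }
  assert (HI : forall z, unit_disc z -> t1 + beta - tau < Im (L z) < t1 + 2 * PI - tau).
  { apply Im_stays_between; auto.
    - rewrite L0. simpl. lra.
    - intros z Hz. split; intros E.
      + apply (Ang z (theta0 + beta) k Hz); [lra|]. rewrite E. unfold t1. ring.
      + apply (Ang z theta0 (k + 1)%Z Hz); [lra|]. rewrite E, plus_IZR. unfold t1. ring. }
  (* The midpoint of the gap for Im L, divided by al. *)
  set (psi := (t1 + beta / 2 + PI - tau) / al).
  assert (Lo : psi - PI / 2 = (t1 + beta - tau) / al) by (unfold psi; rewrite Eb; field; lra).
  assert (Up : psi + PI / 2 = (t1 + 2 * PI - tau) / al) by (unfold psi; rewrite Eb; field; lra).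
  assert (Pa : 0 < / al) by (apply Rinv_0_lt_compat; lra).
  assert (Hl : holo (fun z => RtoC (/ al) * L z)%C) by (apply holo_cmul; auto).
  assert (HS : strip psi (fun z => RtoC (/ al) * L z)%C).
  { split; auto. split; [rewrite L0; ring|]. intros z Hz. rewrite Lo, Up. specialize (HI z Hz).
    replace (Im (RtoC (/ al) * L z)%C) with (Im (L z) * / al) by (unfold Im; simpl; ring).
    unfold Rdiv. split; apply Rmult_lt_compat_r; lra. }
  assert (Hpsi : - (PI / 2) < psi < PI / 2).
  { destruct HS as (_ & Z & HS). specialize (HS _ unit_disc_0). rewrite Z in HS. simpl in HS. lra. }
  destruct (taylor_exists _ (holo_epow al _ Hl)) as [c Tc].
  assert (Ec : b n = (d * c n)%C).
  { assert (T1 : taylor_on_disc (fun n => match n with O => p | _ => RtoC 0 end) (fun _ => p)).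
    { apply taylor_clim. intros z Hz eps He. exists 1%nat. intros [|j] Hj; [lia|].
      rewrite psum_shift. unfold psum. rewrite (csum_ext _ (fun _ => RtoC 0 * 0)%C) by (intros; ring).
      rewrite csum_scal. match goal with |- Cmod ?X <= _ => replace X with (RtoC 0) by ring end.
      rewrite Cmod_0. lra. }
    pose proof (taylor_plus _ _ _ _ T1 (taylor_scal d _ _ Tc)) as T2.
    assert (T3 : taylor_on_disc b (fun z => p + d * epow al (fun z => RtoC (/ al) * L z) z)%C).
    { refine (taylor_ext _ _ _ _ (fun k => eq_refl) _ Tb). intros z Hz.
      replace (g z) with (p + (g z - p))%C by ring. rewrite (EL z Hz). unfold epow. do 3 f_equal.
      rewrite RtoC_inv by lra. field. apply RtoC_neq_0; lra. }
    rewrite (taylor_unique _ _ _ T3 T2 n). destruct n; [lia|]. ring. }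
  rewrite Ec, Cmod_mult. apply Rmult_le_compat_l; [apply Cmod_ge_0|].
  apply (strip_power_coef_bound al psi Ha Hpsi _ c n HS Tc Hn).
Qed.

Lemma extremal_coef_continuous n al : continuity_pt (fun a => extremal_coef a n) al.
Proof.
  assert (N : forall k x, continuity_pt (fun a => neg_binom a k) x).
  { induction k; intros x; simpl; [apply continuity_pt_const; intros ? ?; auto|].
    apply continuity_pt_mult; auto.
    apply derivable_continuous_pt. unfold Rdiv. reg. }
  assert (M : forall k x, continuity_pt (fun a => neg_binom (- a) k) x).
  { intros k x. apply (continuity_pt_comp Ropp (fun a => neg_binom a k)); auto.
    apply derivable_continuous_pt. reg. }
  unfold extremal_coef. generalize n at 2. intros m.
  assert (T : forall k, continuity_pt (fun a => neg_binom a k * neg_binom (- a) (n - k) * (-1) ^ k) al).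
  { intros k. apply continuity_pt_mult; [apply continuity_pt_mult; auto|].
    apply continuity_pt_const; intros ? ?; auto. }
  induction m; [exact (T O)|]. apply (continuity_pt_plus _ _ _ IHm (T (S m))).
Qed.

Lemma le_right_limit (f : R -> R) (a c x : R) : a < c -> continuity_pt f a ->
  (forall y, a < y < c -> x <= f y) -> x <= f a.
Proof.
  intros Hac Hc A. apply le_epsilon. intros eps He. destruct (Hc eps He) as (d & Hd & B).
  set (y := a + Rmin (d / 2) ((c - a) / 2)).
  assert (Py : 0 < Rmin (d / 2) ((c - a) / 2)) by (apply Rmin_pos; lra).
  assert (Rmin (d / 2) ((c - a) / 2) <= d / 2) by apply Rmin_l.
  assert (Rmin (d / 2) ((c - a) / 2) <= (c - a) / 2) by apply Rmin_r.
  specialize (A y ltac:(unfold y; lra)). specialize (B y). simpl in B. unfold R_dist in B.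
  assert (Q : Rabs (f y - f a) < eps).
  { apply B. split; [split; [exact I|unfold y; lra]|]. unfold y. rewrite Rabs_pos_eq; lra. }
  apply Rabs_def2 in Q. lra.
Qed.

(** * Geometry of the image of a concave univalent function *)

Definition univalent (f : C -> C) : Prop := holo f /\
  forall z1 z2, unit_disc z1 -> unit_disc z2 -> f z1 = f z2 -> z1 = z2.

Lemma univalent_open f z0 e : univalent f -> unit_disc z0 -> 0 < e ->
  exists d, 0 < d /\ forall p, Cmod (p - f z0)%C < d ->
    exists w, Cmod (w - z0)%C < e /\ unit_disc w /\ f w = p.
Proof.
  intros [Hf Inj] Hz He. destruct (unit_disc_open z0 Hz) as (r & Hr & Hin).
  assert (In : forall w, Cmod (w - z0)%C < Rmin e r -> unit_disc w).
  { intros w Hw. apply Hin. eapply Rlt_le_trans; [exact Hw|apply Rmin_r]. }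
  destruct (open_mapping f z0 (Rmin e r) Hf) as (d & Hd & Om); auto.
  { apply Rmin_pos; auto. }
  exists d. split; auto. intros p Hp. destruct (Om p Hp) as (w & Hw & E).
  exists w. split; [eapply Rlt_le_trans; [exact Hw|apply Rmin_l]|]. split; auto.
Qed.

Definition preimage (f : C -> C) (p : C) : C :=
  epsilon (inhabits (RtoC 0)) (fun z => unit_disc z /\ f z = p).

Lemma preimage_spec f p : image_disc f p -> unit_disc (preimage f p) /\ f (preimage f p) = p.
Proof. intros A. unfold preimage. apply epsilon_spec, A. Qed.

Lemma preimage_continuous f p e : univalent f -> image_disc f p -> 0 < e ->
  exists d, 0 < d /\ forall p', Cmod (p' - p)%C < d -> image_disc f p' /\
    Cmod (preimage f p' - preimage f p)%C < e.
Proof.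
  intros U Ip He. destruct (preimage_spec f p Ip) as [Dz Ez].
  destruct (univalent_open f _ e U Dz He) as (d & Hd & Om). exists d. split; auto.
  intros p' Hp'. rewrite Ez in Om. destruct (Om p' Hp') as (w & Hw & Dw & Ew).
  assert (Ip' : image_disc f p') by (exists w; auto). split; auto.
  destruct (preimage_spec f p' Ip') as [D' E'].
  replace (preimage f p') with w; auto. apply (proj2 U); auto. now rewrite Ew.
Qed.

(* On circles near the unit circle a univalent function takes bounded values somewhere,
   by the minimum principle for [(f - f 0) / z ^ k]. *)
Lemma univalent_bounded_somewhere f : univalent f -> exists M, 0 < M /\
  forall rho, 0 < rho < 1 -> exists z, Cmod z = rho /\ Cmod (f z - f (RtoC 0))%C <= M.
Proof.
  intros [Hf Inj]. set (F := fun z => (f z - f (RtoC 0))%C).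
  assert (HF : holo F) by (apply holo_minus; auto; apply holo_const).
  destruct (taylor_exists F HF) as [a Ta].
  assert (Half : unit_disc (RtoC (1 / 2))) by (unfold unit_disc; rewrite Cmod_R, Rabs_pos_eq; lra).
  assert (Ex : exists k, a k <> RtoC 0).
  { apply NNPP. intros No.
    assert (A : forall k, a k = RtoC 0) by (intros k; apply NNPP; intros N; apply No; exists k; auto).
    destruct (taylor_shift_n 1 a F Ta) as (G & TG & EG); [auto|].
    destruct (taylor_shift_n 2 a F Ta) as (G2 & TG2 & EG2); [auto|].
    assert (Z : forall z, unit_disc z -> F z = RtoC 0).
    { intros z Hz. apply (clim_unique (psum a z)); [exact (proj1 (taylor_clim a F) Ta z Hz)|].
      intros eps He. exists O. intros n _. unfold psum. rewrite (csum_ext _ (fun _ => RtoC 0 * 0)%C).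
      - rewrite csum_scal. match goal with |- Cmod ?X <= _ => replace X with (RtoC 0) by ring end.
        rewrite Cmod_0; lra.
      - intros k _. rewrite A. ring. }
    assert (E : RtoC (1 / 2) = RtoC 0).
    { apply Inj; auto; [apply unit_disc_0|]. specialize (Z _ Half). unfold F in Z.
      replace (f (RtoC (1 / 2))) with (f (RtoC (1 / 2)) - f (RtoC 0) + f (RtoC 0))%C by ring.
      rewrite Z. ring. }
    apply RtoC_inj in E. lra. }
  assert (Least : exists k, a k <> RtoC 0 /\ forall j, (j < k)%nat -> a j = RtoC 0).
  { destruct Ex as [k Hk]. revert Hk. induction k as [k IH] using lt_wf_ind. intros Hk.
    destruct (classic (exists j, (j < k)%nat /\ a j <> RtoC 0)) as [(j & Hj & Nj)|No]; [apply (IH j Hj Nj)|].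
    exists k. split; auto. intros j Hj. apply NNPP. intros N. apply No. exists j. auto. }
  destruct Least as (k & Hk & Hlt).
  destruct (taylor_shift_n k a F Ta Hlt) as (G & TG & EG).
  assert (G0 : G (RtoC 0) = a k) by (rewrite <- (taylor_0 _ _ TG); f_equal; lia).
  assert (Gn : forall z, unit_disc z -> G z <> RtoC 0).
  { intros z Hz E. destruct (classic (z = RtoC 0)) as [->|Nz]; [rewrite G0 in E; auto|].
    apply Nz, Inj; auto; [apply unit_disc_0|]. specialize (EG z Hz). rewrite E in EG. unfold F in EG.
    replace (f z) with (f z - f (RtoC 0) + f (RtoC 0))%C by ring. rewrite EG. ring. }
  assert (Pk : 0 < Cmod (a k)) by (apply Cmod_gt_0; auto).
  exists (2 * Cmod (a k)). split; [lra|]. intros rho Hr. apply NNPP. intros No.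
  assert (Big : forall t, 2 * Cmod (a k) <= Cmod (G (circ rho t))).
  { intros t. apply Rnot_lt_le. intros Hl. apply No. exists (circ rho t).
    split; [apply Cmod_circ; lra|].
    assert (U : unit_disc (circ rho t)) by (unfold unit_disc; rewrite Cmod_circ; lra).
    change (Cmod (F (circ rho t)) <= 2 * Cmod (a k)). rewrite EG, Cmod_mult, Cmod_pow, Cmod_circ by (auto; lra).
    assert (rho ^ k <= 1) by (rewrite <- (pow1 k); apply pow_incr; lra).
    assert (0 <= rho ^ k) by (apply pow_le; lra). pose proof (Cmod_ge_0 (G (circ rho t))). nra. }
  assert (Mx : Cmod (/ G (RtoC 0))%C <= / (2 * Cmod (a k))).
  { apply (maximum_principle (fun z => / G z)%C rho); auto.
    - apply holo_inv; auto. eapply taylor_holo; eauto.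
    - rewrite Cmod_0. lra.
    - left. apply Rinv_0_lt_compat. lra.
    - intros t. rewrite Cmod_inv.
      + apply Rinv_le_contravar; [lra|apply Big].
      + apply Gn. unfold unit_disc. rewrite Cmod_circ; lra. }
  rewrite G0, Cmod_inv, Rinv_mult in Mx by auto.
  assert (0 < / Cmod (a k)) by (apply Rinv_0_lt_compat; auto). lra.
Qed.

(** If f were onto, a closed square around f(0) would be a compact part of the image, and its
    preimage would keep a positive distance from the unit circle. But f takes values in that square
    on circles of radius arbitrarily close to 1. *)
Lemma univalent_not_onto f : univalent f -> exists p, ~ image_disc f p.
Proof.
  intros U. apply NNPP. intros No.
  assert (On : forall p, image_disc f p) by (intros p; apply NNPP; intros N; apply No; exists p; auto).
  destruct (univalent_bounded_somewhere f U) as (M & PM & HM).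
  assert (Loc : forall x y, exists d : posreal, forall p, Rabs (Re p - x) < d -> Rabs (Im p - y) < d ->
     Cmod (preimage f p) <= 1 - d).
  { intros x y. destruct (preimage_spec f (x, y) (On _)) as [Dz _]. unfold unit_disc in Dz.
    set (z0 := preimage f (x, y)) in *. set (s := (1 - Cmod z0) / 2).
    destruct (preimage_continuous f (x, y) s U (On _)) as (d & Hd & Cn); [unfold s; lra|].
    assert (Pd : 0 < Rmin (d / 2) s) by (apply Rmin_pos; unfold s; lra).
    exists (mkposreal _ Pd). simpl. intros p Hx Hy.
    assert (Rmin (d / 2) s <= d / 2) by apply Rmin_l. assert (Rmin (d / 2) s <= s) by apply Rmin_r.
    destruct (Cn p) as [_ C1].
    { eapply Rle_lt_trans; [apply Cmod_le_sum|]. unfold Re, Im in *. simpl.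
      unfold Rminus in *. lra. }
    fold z0 in C1. pose proof (Cmod_triangle (preimage f p - z0) z0) as T.
    replace (preimage f p - z0 + z0)%C with (preimage f p) in T by ring. unfold s in *. lra. }
  set (dl := fun x y => proj1_sig (constructive_indefinite_description _ (Loc x y))).
  assert (Hdl : forall x y p, Rabs (Re p - x) < dl x y -> Rabs (Im p - y) < dl x y ->
     Cmod (preimage f p) <= 1 - dl x y).
  { intros x y. unfold dl. exact (proj2_sig (constructive_indefinite_description _ (Loc x y))). }
  set (f0 := f (RtoC 0)) in *.
  destruct (compactness_value_2d (Re f0 - M) (Re f0 + M) (Im f0 - M) (Im f0 + M) dl) as [d Hd].
  pose proof (cond_pos d) as Pd.
  set (rho := Rmax (1 / 2) (1 - d / 2)).
  assert (Hr : 1 / 2 <= rho < 1) by (split; [apply Rmax_l|apply Rmax_lub_lt; lra]).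
  assert (Hr2 : 1 - d / 2 <= rho) by apply Rmax_r.
  destruct (HM rho ltac:(lra)) as (z & Ez & Bz). fold f0 in Bz.
  pose proof (re_le_Cmod (f z - f0)%C) as B1. pose proof (Im_le_Cmod (f z - f0)%C) as B2.
  assert (I1 : Re f0 - M <= Re (f z) <= Re f0 + M).
  { assert (A : Rabs (Re (f z - f0)%C) <= M) by lra. apply Rabs_le_between in A. unfold Re in *; simpl in A. lra. }
  assert (I2 : Im f0 - M <= Im (f z) <= Im f0 + M).
  { assert (A : Rabs (Im (f z - f0)%C) <= M) by lra. apply Rabs_le_between in A. unfold Im in *; simpl in A. lra. }
  apply (Hd _ _ I1 I2). intros (x & y & _ & _ & D1 & D2 & D3).
  pose proof (Hdl x y (f z) D1 D2) as B.
  assert (Dz : unit_disc z) by (unfold unit_disc; lra).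
  destruct (preimage_spec f (f z) (On _)) as [D' E'].
  rewrite (proj2 U _ _ D' Dz E') in B. lra.
Qed.

Lemma cis_eq_1 x : cis x = RtoC 1 -> exists k : Z, x = 2 * PI * IZR k.
Proof.
  intros E. destruct (angle_reduction 0 x) as [k Hk]. exists k.
  set (y := x - 2 * PI * IZR k) in *.
  assert (Ey : cis y = RtoC 1).
  { rewrite <- (cis_period y k). unfold y. replace (x - 2 * PI * IZR k + 2 * PI * IZR k) with x by ring. auto. }
  apply (f_equal Re) in Ey. simpl in Ey. pose proof PI_RGT_0.
  assert (Py : 0 <= y < 2 * PI) by (unfold y; lra).
  assert (y = 0); [|unfold y in *; lra].
  destruct (Req_dec y 0) as [|N]; auto. exfalso.
  replace y with (2 * (y / 2)) in Ey by field. rewrite cos_2a_sin in Ey.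
  assert (0 < sin (y / 2)) by (apply sin_gt_0; lra). nra.
Qed.

(** Were all points far from p attained, a large circle around p would lift through the inverse of
    f, and the holomorphic logarithm of f - p would provide a single-valued continuous argument
    along it. But the argument grows by 2 PI in one turn. *)
Lemma univalent_complement_unbounded f p R0 : univalent f -> ~ image_disc f p ->
  exists q, R0 < Cmod (q - p)%C /\ ~ image_disc f q.
Proof.
  intros U Np. apply NNPP. intros No.
  set (R1 := Rmax R0 0 + 1).
  assert (HR : R0 < R1 /\ 0 < R1).
  { unfold R1. pose proof (Rmax_l R0 0). pose proof (Rmax_r R0 0). lra. }
  set (y := fun t => (p + RtoC R1 * cis t)%C).
  assert (Iy : forall t, image_disc f (y t)).
  { intros t. apply NNPP. intros N. apply No. exists (y t). split; auto. unfold y.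
    replace (p + RtoC R1 * cis t - p)%C with (RtoC R1 * cis t)%C by ring.
    rewrite Cmod_mult, Cmod_cis, Cmod_R, Rabs_pos_eq; lra. }
  assert (Nz : forall z, unit_disc z -> (f z - p)%C <> RtoC 0).
  { intros z Hz E. apply Np. exists z. split; auto.
    replace (f z) with (f z - p + p)%C by ring. rewrite E. ring. }
  destruct (analytic_log (fun z => f z - p)%C) as (L & HL & L0 & EL); auto.
  { apply holo_minus; [apply U|apply holo_const]. }
  cbv beta in EL. destruct (polar (f (RtoC 0) - p)%C) as [tau Et].
  set (v := fun t => Im (L (preimage f (y t)))).
  assert (Cv : forall t, continuity_pt v t).
  { intros t. apply continuity_pt_filterlim.
    destruct (preimage_spec f _ (Iy t)) as [Dz _]. destruct (HL _ Dz) as [l Hl].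
    apply (pcont_comp L (fun t => preimage f (y t)) t l Hl).
    apply pcont_intro. intros eps He.
    destruct (preimage_continuous f (y t) eps U (Iy t) He) as (d & Hd & Cn).
    assert (Cy : pcont y t) by (apply pcont_plus; [apply pcont_const|apply circ_pcont]).
    destruct (pcont_elim y t Cy (d / 2)) as (d' & Hd' & Cd); [lra|].
    exists d'. split; auto. intros s Hs. left. apply Cn. specialize (Cd s Hs). lra. }
  assert (Eu : forall t, cis (tau + v t - t) = RtoC 1).
  { intros t. destruct (preimage_spec f _ (Iy t)) as [Dz Ez].
    pose proof (EL _ Dz) as E. rewrite Ez in E. unfold y in E at 1.
    replace (p + RtoC R1 * cis t - p)%C with (RtoC R1 * cis t)%C in E by ring.
    rewrite Et in E. unfold cexp in E. fold (v t) in E.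
    set (r := Cmod (f (RtoC 0) - p)%C) in *. set (x := exp _) in *.
    assert (E1 : (RtoC R1 * cis t)%C = (RtoC (r * x) * cis (tau + v t))%C).
    { rewrite E, cis_plus, RtoC_mult. ring. }
    assert (Er : R1 = r * x).
    { apply (f_equal Cmod) in E1. rewrite !Cmod_mult, !Cmod_cis, !Cmod_R in E1.
      rewrite !Rabs_pos_eq in E1; [lra| |lra].
      apply Rmult_le_pos; [apply Cmod_ge_0|left; apply exp_pos]. }
    rewrite <- Er in E1. unfold Rminus. rewrite cis_plus, cis_opp.
    replace (cis (tau + v t)) with (cis t).
    - field. apply cis_neq_0.
    - replace (cis t) with (/ RtoC R1 * (RtoC R1 * cis t))%C by (field; apply RtoC_neq_0; lra).
      rewrite E1. field. apply RtoC_neq_0; lra. }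
  assert (V : v (2 * PI) = v 0).
  { assert (Ey : y (2 * PI) = y 0).
    { unfold y. replace (2 * PI) with (0 + 2 * PI * IZR 1) by ring. now rewrite cis_period. }
    unfold v. now rewrite Ey. }
  destruct (cis_eq_1 _ (Eu 0)) as [k Hk]. pose proof PI_RGT_0.
  (* [h] runs from - PI to PI. At a zero of [h], tau + v t - t would be an odd multiple of PI, while
     it always is a multiple of 2 PI. *)
  set (h := fun t => t - v t + v 0 - PI).
  destruct (IVT_interv h 0 (2 * PI)) as (t & Ht & Eh).
  - intros t _. unfold h.
    assert (Cc : forall c, continuity_pt (fun _ => c) t) by (intros c; apply continuity_pt_const; intros ? ?; auto).
    apply continuity_pt_minus; auto. apply continuity_pt_plus; auto. apply continuity_pt_minus; auto.
    apply derivable_continuous_pt, derivable_pt_id.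
  - lra.
  - unfold h. lra.
  - unfold h. lra.
  - specialize (Eu t). unfold h in Eh.
    replace (tau + v t - t) with ((tau + v 0 - 0) + - PI) in Eu by lra.
    rewrite Hk in Eu. rewrite cis_plus in Eu.
    replace (2 * PI * IZR k) with (0 + 2 * PI * IZR k) in Eu by ring.
    rewrite cis_period, cis_0 in Eu. apply (f_equal Re) in Eu. unfold cis in Eu. simpl in Eu.
    rewrite cos_neg, cos_PI in Eu. lra.
Qed.

Lemma cis_lipschitz s t : Cmod (cis s - cis t)%C <= 2 * Rabs (s - t).
Proof.
  assert (A : forall x, Rabs (sin x) <= Rabs x).
  { assert (B : forall x, 0 <= x -> Rabs (sin x) <= x).
    { intros x Hx. destruct (Req_dec x 0) as [->|]; [rewrite sin_0, Rabs_R0; lra|].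
      apply Rabs_le. split; [|left; apply sin_lt_x; lra].
      destruct (Rle_dec x PI) as [Hl|Hl].
      - pose proof (sin_ge_0 x Hx Hl). lra.
      - pose proof (SIN_bound x). pose proof PI2_1. lra. }
    intros x. destruct (Rle_dec 0 x) as [Hx|Hx].
    - rewrite (Rabs_pos_eq x) by auto. auto.
    - rewrite <- Rabs_Ropp, <- sin_neg, <- (Rabs_Ropp x), (Rabs_pos_eq (- x)) by lra. apply B. lra. }
  assert (E : Cmod (cis s - cis t)%C * Cmod (cis s - cis t)%C = (2 * sin ((s - t) / 2)) * (2 * sin ((s - t) / 2))).
  { rewrite Cmod_sqr. replace (2 * sin ((s - t) / 2) * (2 * sin ((s - t) / 2))) with
      (2 * (2 * sin ((s - t) / 2) * sin ((s - t) / 2))) by ring.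
    replace (2 * sin ((s - t) / 2) * sin ((s - t) / 2)) with (1 - cos (s - t)).
    - rewrite cos_minus. unfold cis, Re, Im; simpl.
      pose proof (sin2_cos2 s). pose proof (sin2_cos2 t). unfold Rsqr in *. nra.
    - replace (s - t) with (2 * ((s - t) / 2)) at 1 by field. rewrite cos_2a_sin. ring. }
  specialize (A ((s - t) / 2)). rewrite <- (Rabs_pos_eq (Cmod _) (Cmod_ge_0 _)).
  apply Rsqr_eq_abs_0 in E. rewrite E, Rabs_mult, (Rabs_pos_eq 2) by lra.
  unfold Rdiv in A. rewrite Rabs_mult, (Rabs_pos_eq (/ 2)) in A by lra.
  pose proof (Rabs_pos (s - t)). unfold Rdiv. lra.
Qed.

(** By convexity an omitted point makes the whole segment back to p omitted. So an attained point on
    a ray forces all neighbouring directions to be attained beyond some distance, and if every ray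
    met the image, compactness of the circle would bound the complement. *)
Lemma univalent_omits_ray f p : univalent f -> convex_set (compl (image_disc f)) ->
  ~ image_disc f p -> exists theta, omits_sector f p theta 0.
Proof.
  intros U Cv Np. apply NNPP. intros No.
  assert (Cr : forall theta s t, 0 <= t <= s -> ~ image_disc f (p + RtoC s * cis theta)%C ->
     ~ image_disc f (p + RtoC t * cis theta)%C).
  { intros th s t Hts Ns. destruct (Req_dec s 0) as [E|E].
    { replace t with s by lra. auto. }
    replace (p + RtoC t * cis th)%C with
      (RtoC (1 - t / s) * p + RtoC (t / s) * (p + RtoC s * cis th))%C.
    - apply Cv; auto. split; [apply Rdiv_le_0_compat; lra|].
      apply Rmult_le_reg_r with s; [lra|]. unfold Rdiv. rewrite Rmult_assoc, Rinv_l; lra.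
    - rewrite RtoC_minus, RtoC_div by auto. field. apply RtoC_neq_0; auto. }
  (* One number serves as angular tolerance and, inverted, as distance, so that a single gauge
     suffices for the compactness argument. *)
  assert (Loc : forall theta, exists d : posreal, forall th s, Rabs (th - theta) < d ->
     / d <= s -> image_disc f (p + RtoC s * cis th)%C).
  { intros theta.
    assert (Hit : exists t, 0 <= t /\ image_disc f (p + RtoC t * cis theta)%C).
    { apply NNPP. intros N. apply No. exists theta. intros th t Hth Ht Im.
      apply N. exists t. split; auto. replace theta with th by lra. auto. }
    destruct Hit as (t & Ht & It).
    destruct (preimage_continuous f _ 1 U It Rlt_0_1) as (e & He & Cn).
    set (dd := Rmin (e / (4 * (t + 1))) (/ (t + 1))).
    assert (P1 : 0 < / (t + 1)) by (apply Rinv_0_lt_compat; lra).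
    assert (Pd : 0 < dd) by (apply Rmin_pos; auto; apply Rdiv_lt_0_compat; lra).
    assert (D1 : dd <= e / (4 * (t + 1))) by apply Rmin_l.
    assert (D2 : dd <= / (t + 1)) by apply Rmin_r.
    exists (mkposreal dd Pd). simpl. intros th s Hth Hs.
    assert (Hts : t <= s).
    { apply Rle_trans with (/ dd); auto. apply Rinv_le_contravar in D2; auto. rewrite Rinv_inv in D2. lra. }
    apply NNPP. intros Ns. apply (Cr th s t) in Ns; [|lra]. apply Ns. apply (Cn (p + RtoC t * cis th)%C).
    replace (p + RtoC t * cis th - (p + RtoC t * cis theta))%C with (RtoC t * (cis th - cis theta))%C by ring.
    rewrite Cmod_mult, Cmod_R, Rabs_pos_eq by auto. pose proof (cis_lipschitz th theta) as Lp.
    apply Rle_lt_trans with ((t + 1) * (2 * dd)).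
    - apply Rmult_le_compat; try lra. apply Cmod_ge_0.
    - apply Rmult_le_compat_l with (r := 4 * (t + 1)) in D1; [|lra].
      replace (4 * (t + 1) * (e / (4 * (t + 1)))) with e in D1 by (field; lra). lra. }
  set (dl := fun x => proj1_sig (constructive_indefinite_description _ (Loc x))).
  assert (Hdl : forall x th s, Rabs (th - x) < dl x -> / dl x <= s -> image_disc f (p + RtoC s * cis th)%C).
  { intros x. unfold dl. exact (proj2_sig (constructive_indefinite_description _ (Loc x))). }
  destruct (compactness_value_1d 0 (2 * PI) dl) as [d Hd]. pose proof (cond_pos d) as Pd.
  destruct (univalent_complement_unbounded f p (/ d) U Np) as (q & Hq & Nq).
  destruct (polar (q - p)%C) as [th0 Eq]. destruct (angle_reduction 0 th0) as [k Hk].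
  set (th := th0 - 2 * PI * IZR k).
  assert (Eq2 : q = (p + RtoC (Cmod (q - p)) * cis th)%C).
  { rewrite <- (cis_period th k). unfold th. replace (th0 - 2 * PI * IZR k + 2 * PI * IZR k) with th0 by ring.
    rewrite <- Eq. ring. }
  apply (Hd th); [unfold th; lra|]. intros (x & _ & D1 & D2). apply Nq. rewrite Eq2.
  apply (Hdl x th); auto. apply Rle_trans with (/ d); [|lra].
  apply Rinv_le_contravar; auto.
Qed.

(** The cone angle is a supremum, so an arc of length (2 - a) PI is available only for a > al, and
    the bound at al follows by continuity in the exponent. For al = 2 such a would leave the range
    of the coefficient bound, and an omitted ray is used instead. *)
Lemma concave_coef_bound al f g b p : 1 <= al <= 2 -> C0hat al f -> subordinate g f ->
  taylor_on_disc b g -> ~ image_disc f p ->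
  forall n, (1 <= n)%nat -> Cmod (b n) <= Cmod (f (RtoC 0) - p)%C * extremal_coef al n.
Proof.
  intros Ha (Hf & Inj & _ & Cv & Op) (w & Bw & W0 & Eg) Tb Np n Hn.
  destruct (subordinate_inside w Bw W0) as [Hw Iw].
  assert (U : univalent f) by (split; auto; apply holo_analytic, Hf).
  assert (G0 : g (RtoC 0) = f (RtoC 0)) by (rewrite Eg by apply unit_disc_0; now rewrite W0).
  assert (Om : forall theta beta, omits_sector f p theta beta -> omits_sector g p theta beta).
  { intros th be A x t Hx Ht (z & Hz & Ez). apply (A x t Hx Ht). exists (w z). rewrite <- Eg; auto. }
  pose proof PI_RGT_0 as PP. rewrite <- G0.
  destruct (Req_dec al 2) as [->|N2].
  - destruct (univalent_omits_ray f p U Cv Np) as [th Hth].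
    apply (sector_coef_bound g b p th 0 2); auto; lra.
  - apply (le_right_limit (fun a => Cmod (g (RtoC 0) - p)%C * extremal_coef a n) al 2); [lra| |].
    { apply continuity_pt_mult; [apply continuity_pt_const; intros ? ?; auto|apply extremal_coef_continuous]. }
    intros a Haa.
    unfold opening_angle_at_infinity, cone_angle in Op.
    match type of Op with 2 * PI - real (Lub_Rbar ?X) <= _ => set (E := X) in * end.
    assert (Ex : exists beta, E beta /\ (2 - a) * PI < beta).
    { apply NNPP. intros No. destruct (Lub_Rbar_correct E) as [_ Lb].
      specialize (Lb (Finite ((2 - a) * PI))).
      assert (Ub : is_ub_Rbar E (Finite ((2 - a) * PI))).
      { intros x Hx. apply Rnot_lt_le. intros Hl. apply No. exists x. auto. }
      specialize (Lb Ub). destruct (Lub_Rbar E) as [l| |]; simpl in *; try contradiction; nra. }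
    destruct Ex as (beta & [Hb [th0 Ht0]] & Hbeta).
    apply (sector_coef_bound g b p th0 ((2 - a) * PI) a); auto; try lra; try nra.
    apply Om. intros th t Hth Ht. apply (Ht0 th); auto. lra.
Qed.

(** The boundary point is found at the supremum of the parameters up to which the segment from p
    stays in [S]. *)
Lemma segment_boundary (S : C -> Prop) (p q : C) : S p -> ~ S q -> exists c, boundary S c.
Proof.
  intros Sp Nq. set (x := fun t => (p + RtoC t * (q - p))%C).
  assert (X0 : x 0 = p) by (unfold x; ring). assert (X1 : x 1 = q) by (unfold x; ring).
  destruct (completeness (fun t => 0 <= t <= 1 /\ forall s, 0 <= s <= t -> S (x s))) as [T [Ub Lb]].
  { exists 1. intros t Ht. apply Ht. }
  { exists 0. split; [lra|]. intros s Hs. replace s with 0 by lra. now rewrite X0. }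
  assert (T0 : 0 <= T).
  { apply Ub. split; [lra|]. intros s Hs. replace s with 0 by lra. now rewrite X0. }
  assert (T1 : T <= 1) by (apply Lb; intros t Ht; apply Ht).
  assert (Below : forall s, 0 <= s < T -> S (x s)).
  { intros s Hs. apply NNPP. intros N. assert (T <= s); [|lra].
    apply Lb. intros t [Ht At]. apply Rnot_lt_le. intros Hl. apply N, At. lra. }
  assert (Near : forall d, 0 < d -> exists e, 0 < e /\ forall s, Rabs (s - T) < e -> Cmod (x s - x T)%C < d).
  { intros d Hd. pose proof (Cmod_ge_0 (q - p)). exists (d / (Cmod (q - p)%C + 1)).
    split; [apply Rdiv_lt_0_compat; lra|]. intros s Hs. unfold x.
    replace (p + RtoC s * (q - p) - (p + RtoC T * (q - p)))%C with (RtoC (s - T) * (q - p))%C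
      by (rewrite RtoC_minus; ring).
    rewrite Cmod_mult, Cmod_R. pose proof (Rabs_pos (s - T)).
    apply Rmult_lt_compat_r with (r := Cmod (q - p)%C + 1) in Hs; [|lra].
    unfold Rdiv in Hs. rewrite Rmult_assoc, Rinv_l in Hs by lra. nra. }
  exists (x T). split; intros A; apply locally_Cmod in A; destruct A as (d & Hd & A);
    destruct (Near d Hd) as (e & He & Ne).
  - assert (ST : S (x T)).
    { apply A. replace (x T - x T)%C with (RtoC 0) by ring. now rewrite Cmod_0. }
    destruct (Req_dec T 1) as [E|E]; [apply Nq; rewrite <- X1, <- E; auto|].
    set (t := Rmin 1 (T + e / 2)).
    assert (t <= 1) by apply Rmin_l. assert (t <= T + e / 2) by apply Rmin_r.
    assert (T < t) by (apply Rmin_glb_lt; lra).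
    assert (t <= T); [|lra]. apply Ub. split; [lra|]. intros s Hs.
    destruct (Rlt_dec s T) as [Hl|Hl]; [apply Below; lra|].
    apply A, Ne. rewrite Rabs_pos_eq; lra.
  - assert (NT : ~ S (x T)).
    { apply A. replace (x T - x T)%C with (RtoC 0) by ring. now rewrite Cmod_0. }
    destruct (Req_dec T 0) as [E|E]; [apply NT; rewrite E, X0; auto|].
    set (t := Rmax 0 (T - e / 2)).
    assert (0 <= t) by apply Rmax_l. assert (T - e / 2 <= t) by apply Rmax_r.
    assert (t < T) by (apply Rmax_lub_lt; lra).
    apply (A (x t)); [|apply Below; lra]. apply Ne. rewrite Rabs_left; lra.
Qed.

(** A boundary point has omitted points arbitrarily near, so a bound valid at omitted points passes
    to it. The existence of a boundary point keeps the infimum finite; [real] would send an infinite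
    one to 0. *)
Lemma dist_boundary_ge (f : C -> C) (X : R) : univalent f ->
  (forall p, ~ image_disc f p -> X <= Cmod (f (RtoC 0) - p)%C) ->
  X <= dist_to_set (f (RtoC 0)) (boundary (image_disc f)).
Proof.
  intros U A. destruct (univalent_not_onto f U) as [p Np].
  destruct (segment_boundary (image_disc f) (f (RtoC 0)) p) as [c Hc]; auto.
  { exists (RtoC 0). split; auto. apply unit_disc_0. }
  unfold dist_to_set. match goal with |- _ <= real (Glb_Rbar ?Y) => set (E := Y) end.
  destruct (Glb_Rbar_correct E) as [Lb Gr].
  assert (LX : is_lb_Rbar E (Finite X)).
  { intros d (q & [Hq _] & ->). simpl. apply le_epsilon. intros eps He.
    apply NNPP. intros No. apply Hq, locally_Cmod. exists eps. split; auto.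
    intros q' Hq'. apply NNPP. intros Nq'. apply No. eapply Rle_trans; [apply (A q' Nq')|].
    replace (f (RtoC 0) - q')%C with ((f (RtoC 0) - q) + - (q' - q))%C by ring.
    eapply Rle_trans; [apply Cmod_triangle|]. rewrite Cmod_opp. lra. }
  specialize (Gr _ LX).
  assert (Ec : E (Cmod (f (RtoC 0) - c)%C)) by (exists c; auto).
  specialize (Lb _ Ec). destruct (Glb_Rbar E) as [l| |]; simpl in *; try contradiction. exact Gr.
Qed.

(** * The extremal function *)

(** On this strip the arctangent of Im / Re recovers Im k, so the principal branch is the
    exponential of al k. *)
Lemma Cpower_cexp k al : - (PI / 2) < Im k < PI / 2 ->
  Cpower_principal (cexp k) al = cexp (RtoC al * k)%C.
Proof.
  intros Hk. unfold Cpower_principal. rewrite Cmod_cexp.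
  assert (Pc : 0 < cos (Im k)) by (apply cos_gt_0; lra). pose proof (exp_pos (Re k)).
  replace (Im (cexp k) / Re (cexp k)) with (tan (Im k)).
  2:{ unfold cexp, cis, Re, Im, tan in *; simpl. field. split; lra. }
  rewrite atan_tan by lra. unfold Rpower. rewrite ln_exp.
  unfold cexp, cis. replace (Re (RtoC al * k)%C) with (al * Re k) by (unfold Re; simpl; ring).
  replace (Im (RtoC al * k)%C) with (al * Im k) by (unfold Im; simpl; ring).
  apply injective_projections; simpl; ring.
Qed.

(** The kernel with psi = 0 and s = 0, for which xi = -1. *)
Lemma half_plane_log : exists kap, strip 0 kap /\
  (forall z, unit_disc z -> cexp (kap z) = ((1 + z) / (1 - z))%C) /\
  (forall al a, taylor_on_disc a (epow al kap) -> forall n, a n = RtoC (extremal_coef al n)).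
Proof.
  pose proof PI_RGT_0. destruct (kernel_log 0 0) as (kap & HS & Ek & Gc); [lra|].
  rewrite Rmult_0_r, cis_0 in *. exists kap. split; auto. split.
  - intros z Hz. rewrite Ek by auto. f_equal; [ring|f_equal; ring].
  - intros al a Ta n. rewrite (Gc al a Ta n), Cpow_1_l, <- kernel_coef_m1, Cmult_1_l. f_equal.
    apply injective_projections; simpl; ring.
Qed.

Lemma f_alpha_epow al kap z : strip 0 kap ->
  (forall z, unit_disc z -> cexp (kap z) = ((1 + z) / (1 - z))%C) -> unit_disc z ->
  f_alpha al z = (RtoC (1 / (2 * al)) * (epow al kap z - 1))%C.
Proof.
  intros (_ & _ & HS) Ek Hz. unfold f_alpha. rewrite <- Ek by auto.
  specialize (HS z Hz). rewrite Cpower_cexp by lra. reflexivity.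
Qed.

Lemma taylor_const p : taylor_on_disc (fun n => match n with O => p | _ => RtoC 0 end) (fun _ => p).
Proof.
  apply taylor_clim. intros z Hz eps He. exists 1%nat. intros [|j] Hj; [lia|].
  rewrite psum_shift. unfold psum. rewrite (csum_ext _ (fun _ => RtoC 0 * 0)%C) by (intros; ring).
  rewrite csum_scal. match goal with |- Cmod ?X <= _ => replace X with (RtoC 0) by ring end.
  rewrite Cmod_0. lra.
Qed.

Lemma f_alpha_coef al A : 1 <= al <= 2 -> taylor_on_disc (fun n => RtoC (A n)) (f_alpha al) ->
  A O = 0 /\ forall n, (1 <= n)%nat -> A n = extremal_coef al n / (2 * al).
Proof.
  intros Ha TA. destruct half_plane_log as (kap & HS & Ek & Gc).
  destruct (taylor_exists _ (holo_epow al kap (proj1 HS))) as [c Tc].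
  pose proof (taylor_scal (RtoC (1 / (2 * al))) _ _ (taylor_plus _ _ _ _ Tc (taylor_const (- RtoC 1)%C))) as T2.
  assert (T3 : taylor_on_disc (fun n => RtoC (A n))
     (fun z => RtoC (1 / (2 * al)) * (epow al kap z + - RtoC 1))%C).
  { refine (taylor_ext _ _ _ _ (fun k => eq_refl) _ TA).
    intros z Hz. rewrite (f_alpha_epow al kap z HS Ek Hz). reflexivity. }
  pose proof (taylor_unique _ _ _ T3 T2) as U. cbv beta in U. split.
  - apply RtoC_inj. rewrite U, (taylor_0 _ _ Tc). unfold epow. destruct HS as (_ & -> & _).
    rewrite Cmult_0_r, cexp_0. ring.
  - intros [|n] Hn; [lia|]. apply RtoC_inj. rewrite U, (Gc al c Tc), Cplus_0_r, <- RtoC_mult.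
    f_equal. field. lra.
Qed.

Lemma f_alpha_coef_nonneg al A n : 1 <= al <= 2 ->
  taylor_on_disc (fun n => RtoC (A n)) (f_alpha al) -> 0 <= A n.
Proof.
  intros Ha TA. destruct (f_alpha_coef al A Ha TA) as [A0 An].
  destruct n; [rewrite A0; lra|]. rewrite An by lia.
  apply Rdiv_le_0_compat; [apply extremal_coef_nonneg; auto; lia|lra].
Qed.

(** * The real equation for the radius *)

Definition phi (al x : R) : R := (Rpower ((1 + x) / (1 - x)) al - 1) / (2 * al).

Lemma f_alpha_real al x : 1 <= al -> -1 < x < 1 -> f_alpha al (RtoC x) = RtoC (phi al x).
Proof.
  intros Ha Hx. unfold f_alpha, phi.
  replace ((RtoC 1 + RtoC x) / (RtoC 1 - RtoC x))%C with (RtoC ((1 + x) / (1 - x))).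
  2:{ rewrite RtoC_div, RtoC_plus, RtoC_minus by lra. reflexivity. }
  assert (P : 0 < (1 + x) / (1 - x)) by (apply Rdiv_lt_0_compat; lra).
  set (y := (1 + x) / (1 - x)) in *. unfold Cpower_principal.
  rewrite Cmod_R, Rabs_pos_eq by lra. simpl Im. replace (0 / Re (RtoC y)) with 0 by (unfold Rdiv; ring).
  rewrite atan_0, Rmult_0_r, cos_0, sin_0.
  apply injective_projections; simpl; field; lra.
Qed.

Lemma phi_0 al : 1 <= al -> phi al 0 = 0.
Proof.
  intros Ha. unfold phi. replace ((1 + 0) / (1 - 0)) with 1 by field.
  unfold Rpower. rewrite ln_1, Rmult_0_r, exp_0. field. lra.
Qed.

Lemma phi_increasing al x y : 1 <= al -> -1 < x -> x < y -> y < 1 -> phi al x < phi al y.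
Proof.
  intros Ha Hx Hxy Hy. unfold phi. apply Rmult_lt_compat_r; [apply Rinv_0_lt_compat; lra|].
  apply Rplus_lt_compat_r. apply Rlt_Rpower_l; [lra|].
  split; [apply Rdiv_lt_0_compat; lra|].
  apply Rmult_lt_reg_r with ((1 - x) * (1 - y)); [apply Rmult_lt_0_compat; lra|].
  replace ((1 + x) / (1 - x) * ((1 - x) * (1 - y))) with ((1 + x) * (1 - y)) by (field; lra).
  replace ((1 + y) / (1 - y) * ((1 - x) * (1 - y))) with ((1 + y) * (1 - x)) by (field; lra). nra.
Qed.

Lemma phi_continuous al x : -1 < x < 1 -> continuity_pt (phi al) x.
Proof.
  intros Hx. apply continuity_pt_filterlim.
  apply (ex_derive_continuous (V := R_NormedModule)). unfold phi, Rpower.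
  auto_derive. split; [lra|]. split; [apply Rdiv_lt_0_compat; lra|auto].
Qed.

Lemma pow_le_base x m : (1 <= m)%nat -> 0 <= x < 1 -> 0 <= x ^ m <= x.
Proof.
  intros Hm Hx. split; [apply pow_le; lra|]. destruct m; [lia|]. simpl.
  assert (x ^ m <= 1) by (rewrite <- (pow1 m); apply pow_incr; lra).
  assert (0 <= x ^ m) by (apply pow_le; lra). nra.
Qed.

Section RealSide.

Variables (al : R) (A : nat -> R) (m0 N : nat).
Hypothesis Hal : 1 <= al <= 2.
Hypothesis HA : taylor_on_disc (fun n => RtoC (A n)) (f_alpha al).

Lemma phi_partial_sums x : 0 <= x < 1 -> Un_cv (sum_f_R0 (fun k => A k * x ^ k)) (phi al x).
Proof.
  intros Hx eps He.
  assert (U : unit_disc (RtoC x)) by (unfold unit_disc; rewrite Cmod_R, Rabs_pos_eq; lra).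
  destruct (proj1 (taylor_clim _ _) HA _ U (eps / 2)) as [M HM]; [lra|].
  exists M. intros n Hn. specialize (HM (S n) ltac:(lia)). unfold R_dist.
  rewrite f_alpha_real in HM by lra. unfold psum in HM.
  rewrite (csum_ext _ (fun k => RtoC (A k * x ^ k))) in HM
    by (intros; rewrite RtoC_mult, RtoC_pow; reflexivity).
  rewrite <- RtoC_sum, <- RtoC_minus, Cmod_R in HM. lra.
Qed.

Lemma phi_series x : 0 <= x < 1 -> is_series (fun k => A k * x ^ k) (phi al x).
Proof.
  intros Hx. apply is_series_Reals. intros eps He.
  destruct (phi_partial_sums x Hx eps He) as [M HM]. exists M. exact HM.
Qed.

Lemma tail_ex x : 0 <= x < 1 -> ex_series (tail_terms A N x).
Proof.
  intros Hx. apply (ex_series_incr_n (fun k => A k * x ^ k) N). eexists. apply phi_series, Hx.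
Qed.

Lemma tail_increasing x y : 0 <= x -> x <= y -> y < 1 ->
  0 <= Series (tail_terms A N x) <= Series (tail_terms A N y).
Proof.
  intros Hx Hxy Hy. pose proof (fun n => f_alpha_coef_nonneg al A n Hal HA) as P.
  assert (T : forall n, 0 <= tail_terms A N x n <= tail_terms A N y n).
  { intros n. unfold tail_terms. assert (0 <= x ^ (N + n)) by (apply pow_le; auto).
    assert (x ^ (N + n) <= y ^ (N + n)) by (apply pow_incr; lra). specialize (P (N + n)%nat). nra. }
  split.
  - rewrite <- (Rmult_0_l (Series (tail_terms A N x))), <- Series_scal_l. apply Series_le; [|apply tail_ex; lra].
    intros n. specialize (T n). lra.
  - apply Series_le; auto. apply tail_ex. lra.
Qed.

Hypothesis Hm0 : (1 <= m0)%nat.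
Hypothesis HN : (1 <= N)%nat.

Lemma tail_sum x : 0 <= x < 1 ->
  Series (tail_terms A N x) = phi al x - sum_f_R0 (fun k => A k * x ^ k) (pred N).
Proof.
  intros Hx. pose proof (phi_series x Hx) as S. rewrite <- (is_series_unique _ _ S).
  rewrite (Series_incr_n (fun k => A k * x ^ k) N); [|lia|eexists; exact S].
  unfold tail_terms. ring.
Qed.

Definition Freal (x : R) : R := Series (tail_terms A N x) + phi al (x ^ m0) - 1 / (2 * al).

Lemma F_Freal x : 0 <= x < 1 -> F al A m0 N x = RtoC (Freal x).
Proof.
  intros Hx. unfold F, Freal. pose proof (pow_le_base x m0 Hm0 Hx).
  rewrite f_alpha_real by lra. rewrite <- RtoC_plus, <- RtoC_minus. reflexivity.
Qed.

Lemma Freal_increasing x y : 0 <= x -> x < y -> y < 1 -> Freal x < Freal y.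
Proof.
  intros Hx Hxy Hy. unfold Freal. pose proof (tail_increasing x y Hx ltac:(lra) Hy).
  pose proof (pow_le_base x m0 Hm0 ltac:(lra)). pose proof (pow_le_base y m0 Hm0 ltac:(lra)).
  assert (x ^ m0 < y ^ m0).
  { clear - Hx Hxy Hm0. destruct m0 as [|n]; [lia|]. clear Hm0. induction n; [simpl; lra|].
    change (x * x ^ S n < y * y ^ S n). assert (0 <= x ^ S n) by (apply pow_le; lra).
    set (a := x ^ S n) in *. set (b := y ^ S n) in *. nra. }
  pose proof (phi_increasing al (x ^ m0) (y ^ m0) ltac:(lra) ltac:(lra) ltac:(lra) ltac:(lra)). lra.
Qed.

(** Continuity comes from writing the tail as [phi] minus a polynomial. The value at 0 is - 1 / (2
    al), and close to 1 the term phi (x^m0) alone exceeds 1 / (2 al). *)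
Lemma Freal_root : exists rho, 0 < rho < 1 /\ Freal rho = 0.
Proof.
  set (G := fun x => phi al x - sum_f_R0 (fun k => A k * x ^ k) (pred N) + phi al (x ^ m0) - 1 / (2 * al)).
  assert (E : forall x, 0 <= x < 1 -> Freal x = G x).
  { intros x Hx. unfold Freal, G. rewrite tail_sum by auto. ring. }
  assert (Pm : 1 <= INR m0) by (replace 1 with (INR 1) by reflexivity; apply le_INR; auto).
  (* Bernoulli's inequality gives (1 - d)^m0 >= 1 / 2, and phi at 1 / 2 is (3^al - 1) / (2 al) > 1 /
     (2 al). *)
  set (d := / (2 * INR m0)). assert (Pd : 0 < d) by (apply Rinv_0_lt_compat; lra).
  assert (Ed : INR m0 * d = 1 / 2) by (unfold d; field; lra).
  set (x1 := 1 - d). assert (Hd : d <= 1 / 2) by nra.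
  assert (B : 1 / 2 <= x1 ^ m0).
  { assert (Bern : forall k, 1 - INR k * d <= x1 ^ k).
    { induction k; [simpl; lra|]. rewrite S_INR. simpl. pose proof (pos_INR k).
      assert (Hb : x1 * (1 - INR k * d) <= x1 * x1 ^ k) by (apply Rmult_le_compat_l; [unfold x1; lra|exact IHk]).
      assert (0 <= INR k * d * d) by (repeat apply Rmult_le_pos; lra).
      replace (x1 * (1 - INR k * d)) with (1 - (INR k + 1) * d + INR k * d * d) in Hb by (unfold x1; ring).
      lra. }
    specialize (Bern m0). lra. }
  assert (Hx1 : 1 / 2 <= x1 < 1) by (unfold x1; lra).
  pose proof (pow_le_base x1 m0 Hm0 ltac:(lra)) as Hp.
  assert (G0 : G 0 < 0).
  { rewrite <- E by lra. unfold Freal. rewrite tail_sum by lra. rewrite phi_0 by lra.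
    replace (0 ^ m0) with 0 by (destruct m0; [lia|simpl; ring]). rewrite phi_0 by lra.
    assert (Z : sum_f_R0 (fun k => A k * 0 ^ k) (pred N) = 0).
    { apply sum_eq_R0. intros k _. destruct k; [|simpl; ring].
      rewrite (proj1 (f_alpha_coef al A Hal HA)). ring. }
    rewrite Z. assert (0 < 1 / (2 * al)) by (apply Rdiv_lt_0_compat; lra). lra. }
  assert (G1 : 0 < G x1).
  { rewrite <- E by lra. unfold Freal.
    pose proof (tail_increasing x1 x1 ltac:(lra) ltac:(lra) ltac:(lra)) as T.
    assert (1 / (2 * al) < phi al (x1 ^ m0)); [|lra].
    apply Rlt_le_trans with (phi al (1 / 2)).
    - unfold phi. apply Rmult_lt_compat_r; [apply Rinv_0_lt_compat; lra|].
      replace ((1 + 1 / 2) / (1 - 1 / 2)) with 3 by field.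
      assert (Rpower 3 1 <= Rpower 3 al) by (apply Rle_Rpower; lra). rewrite Rpower_1 in H by lra. lra.
    - destruct (Req_dec (1 / 2) (x1 ^ m0)) as [<-|Ne]; [lra|]. left. apply phi_increasing; lra. }
  assert (C : forall x, 0 <= x <= x1 -> continuity_pt G x).
  { intros x Hx. pose proof (pow_le_base x m0 Hm0 ltac:(lra)). unfold G.
    assert (Cc : forall c, continuity_pt (fun _ => c) x) by (intros c; apply continuity_pt_const; intros ? ?; auto).
    assert (Cp : forall k, continuity_pt (fun x => x ^ k) x)
      by (intros k; apply derivable_continuous_pt, derivable_pt_pow).
    apply continuity_pt_minus; auto. apply continuity_pt_plus.
    - apply continuity_pt_minus; [apply phi_continuous; lra|].
      generalize (pred N) as n. induction n.
      + apply (continuity_pt_mult (fun _ => A O) (fun x => x ^ 0)); auto.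
      + apply (continuity_pt_plus (fun x => sum_f_R0 (fun k => A k * x ^ k) n) (fun x => A (S n) * x ^ S n)); auto.
        apply (continuity_pt_mult (fun _ => A (S n)) (fun x => x ^ S n)); auto.
    - apply (continuity_pt_comp (fun x => x ^ m0) (phi al)); auto. apply phi_continuous. lra. }
  destruct (IVT_interv G 0 x1) as (rho & Hr & Er); auto; [lra|].
  exists rho. assert (rho <> 0) by (intros ->; lra). split; [lra|]. rewrite E by lra. exact Er.
Qed.

End RealSide.

Section Extremal.

Variable al : R.
Hypothesis Hal : 1 <= al <= 2.

(** This normalisation maps the image of [f_alpha] onto the sector |arg| < al PI / 2 with apex 0. *)
Let scaled (q : C) : C := (RtoC (2 * al) * q + 1)%C.

Lemma scaled_f_alpha kap z : strip 0 kap ->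
  (forall z, unit_disc z -> cexp (kap z) = ((1 + z) / (1 - z))%C) -> unit_disc z ->
  scaled (f_alpha al z) = cexp (RtoC al * kap z)%C.
Proof.
  intros HS Ek Hz. unfold scaled. rewrite (f_alpha_epow al kap z HS Ek Hz).
  rewrite RtoC_div, RtoC_mult by lra. unfold epow. field.
  repeat split; apply RtoC_neq_0; lra.
Qed.

Lemma one_plus_cexp_neq_0 k : - (PI / 2) < Im k < PI / 2 -> (cexp k + 1)%C <> RtoC 0.
Proof.
  intros Hk E. apply (f_equal Re) in E. unfold cexp, cis, Re in E; simpl in E.
  assert (0 < cos (Im k)) by (apply cos_gt_0; lra). pose proof (exp_pos (fst k)). nra.
Qed.

Lemma cayley_disc k : - (PI / 2) < Im k < PI / 2 ->
  unit_disc ((cexp k - 1) / (cexp k + 1))%C.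
Proof.
  intros Hk. pose proof (one_plus_cexp_neq_0 k Hk) as N. unfold unit_disc. rewrite Cmod_div by auto.
  assert (P : 0 < Cmod (cexp k + 1)%C) by (apply Cmod_gt_0; auto).
  apply Rmult_lt_reg_r with (Cmod (cexp k + 1)%C); auto.
  unfold Rdiv. rewrite Rmult_assoc, Rinv_l, Rmult_1_r, Rmult_1_l by lra.
  apply Rsqr_incrst_0; [|apply Cmod_ge_0|lra]. unfold Rsqr. rewrite !Cmod_sqr.
  assert (0 < Re (cexp k)).
  { replace (Re (cexp k)) with (exp (Re k) * cos (Im k)) by (unfold cexp, cis, Re; simpl; ring).
    apply Rmult_lt_0_compat; [apply exp_pos|apply cos_gt_0; lra]. }
  clear N P. revert H. generalize (cexp k). intros [x y]. unfold Re, Im; simpl. lra.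
Qed.

(** The Cayley map inverts (1 + z) / (1 - z); hence the whole sector is attained. *)
Lemma image_f_alpha_log k : - (PI / 2) < Im k < PI / 2 ->
  image_disc (f_alpha al) (RtoC (1 / (2 * al)) * (cexp (RtoC al * k) - 1))%C.
Proof.
  intros Hk. exists ((cexp k - 1) / (cexp k + 1))%C. split; [apply cayley_disc; auto|].
  unfold f_alpha. pose proof (one_plus_cexp_neq_0 k Hk) as N.
  replace ((RtoC 1 + (cexp k - 1) / (cexp k + 1)) / (RtoC 1 - (cexp k - 1) / (cexp k + 1)))%C with (cexp k).
  - rewrite Cpower_cexp by auto. reflexivity.
  - field. split; auto.
    replace (cexp k + 1 - (cexp k - 1))%C with (RtoC 2) by (apply injective_projections; simpl; ring).
    apply RtoC_neq_0; lra.
Qed.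

(* The complement of the image is a closed sector, i.e. an intersection of half-planes. *)
Lemma compl_f_alpha q : compl (image_disc (f_alpha al)) q <->
  forall ph, Rabs ph <= (al - 1) * (PI / 2) -> Re (scaled q * cis (- ph))%C <= 0.
Proof.
  pose proof PI_RGT_0 as PP. destruct half_plane_log as (kap & HS & Ek & _).
  assert (Rl : forall r t ph, Re (RtoC r * cis t * cis (- ph))%C = r * cos (t - ph)).
  { intros r t ph. rewrite cos_minus. unfold cis. rewrite cos_neg, sin_neg. unfold Re; simpl. ring. }
  split.
  - intros Nq ph Hph. apply Rabs_le_between in Hph. destruct (polar (scaled q)) as [t0 E].
    destruct (angle_reduction (- PI) t0) as [k Hk]. set (t := t0 - 2 * PI * IZR k).
    assert (Et : scaled q = (RtoC (Cmod (scaled q)) * cis t)%C).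
    { rewrite <- (cis_period t k). unfold t. replace (t0 - 2 * PI * IZR k + 2 * PI * IZR k) with t0 by ring. exact E. }
    set (r := Cmod (scaled q)) in *. pose proof (Cmod_ge_0 (scaled q)) as Pr. fold r in Pr.
    rewrite Et, Rl. destruct (Req_dec r 0) as [->|Nr]; [lra|].
    assert (Ht : - PI <= t < PI) by (unfold t; lra).
    (* Inside the open sector the polar logarithm divided by al lies in the strip, so q would be
       attained. Outside it, |t - ph| lies between PI / 2 and 3 PI / 2, where the cosine is
       nonpositive. *)
    destruct (Rlt_dec (Rabs t) (al * (PI / 2))) as [Hlt|Hge].
    + exfalso. apply Rabs_def2 in Hlt. apply Nq.
      set (k1 := (ln r / al, t / al) : C).
      assert (Ek1 : cexp (RtoC al * k1)%C = scaled q).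
      { rewrite Et. unfold cexp, k1. simpl.
        replace (al * (ln r / al) - 0 * (t / al)) with (ln r) by (field; lra).
        replace (al * (t / al) + 0 * (ln r / al)) with t by (field; lra).
        rewrite exp_ln by lra. reflexivity. }
      replace q with (RtoC (1 / (2 * al)) * (cexp (RtoC al * k1) - 1))%C.
      * apply image_f_alpha_log. unfold k1. simpl. split.
        -- apply Rmult_lt_reg_r with al; [lra|]. unfold Rdiv at 2. rewrite Rmult_assoc, Rinv_l; lra.
        -- apply Rmult_lt_reg_r with al; [lra|]. unfold Rdiv at 1. rewrite Rmult_assoc, Rinv_l; lra.
      * rewrite Ek1. unfold scaled. rewrite RtoC_div, RtoC_mult by lra. field. repeat split; apply RtoC_neq_0; lra.
    + assert (cos (t - ph) <= 0); [|nra].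
      destruct (Rle_dec 0 t) as [T|T].
      * rewrite Rabs_pos_eq in Hge by auto. apply cos_le_0; lra.
      * rewrite Rabs_left in Hge by lra. rewrite <- cos_neg. apply cos_le_0; lra.
  - intros Hq (z & Hz & Ez). pose proof HS as (_ & _ & Hs). specialize (Hs z Hz).
    pose proof (scaled_f_alpha kap z HS Ek Hz) as E. rewrite Ez in E. unfold cexp in E.
    replace (Im (RtoC al * kap z)%C) with (al * Im (kap z)) in E by (unfold Im; simpl; ring).
    set (y := Im (kap z)) in *. set (m := (al - 1) * (PI / 2)).
    assert (Pm : 0 <= m) by (apply Rmult_le_pos; lra).
    (* The admissible normal direction closest to al y. It is less than PI / 2 away from it, against
       the half-plane inequality. *)
    set (ph := Rmax (- m) (Rmin m (al * y))).
    assert (Hph : Rabs ph <= m).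
    { apply Rabs_le. split; [apply Rmax_l|]. apply Rmax_lub; [lra|apply Rmin_l]. }
    specialize (Hq ph Hph). rewrite E, Rl in Hq.
    assert (0 < cos (al * y - ph)).
    { assert (Hy : - (al * (PI / 2)) < al * y < al * (PI / 2)) by (split; nra).
      apply cos_gt_0; unfold ph, Rmax, Rmin; destruct (Rle_dec m (al * y)); destruct (Rle_dec _ _);
        unfold m in *; lra. }
    pose proof (exp_pos (Re (RtoC al * kap z)%C)). nra.
Qed.

Lemma Re_scaled_convex p q t ph : Re (scaled (RtoC (1 - t) * p + RtoC t * q)%C * cis ph)%C =
  (1 - t) * Re (scaled p * cis ph)%C + t * Re (scaled q * cis ph)%C.
Proof. unfold scaled, cis, Re; simpl. ring. Qed.

Lemma Re_scaled_ray p t th ph : Re (scaled (p + RtoC t * cis th)%C * cis (- ph))%C =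
  Re (scaled p * cis (- ph))%C + 2 * al * t * cos (th - ph).
Proof.
  rewrite cos_minus. unfold scaled, cis. rewrite cos_neg, sin_neg. unfold Re; simpl. ring.
Qed.

(** Equal powers have logarithms that differ by a multiple of 2 PI i, while al (Im k1 - Im k2) is
    below al PI <= 2 PI in modulus. *)
Lemma f_alpha_injective z1 z2 : unit_disc z1 -> unit_disc z2 -> f_alpha al z1 = f_alpha al z2 -> z1 = z2.
Proof.
  intros H1 H2 E. pose proof PI_RGT_0 as PP. destruct half_plane_log as (kap & HS & Ek & _).
  pose proof (scaled_f_alpha kap z1 HS Ek H1) as E1. pose proof (scaled_f_alpha kap z2 HS Ek H2) as E2.
  rewrite E, E2 in E1. destruct HS as (_ & _ & HS).
  pose proof (HS z1 H1) as S1. pose proof (HS z2 H2) as S2.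
  set (k1 := kap z1) in *. set (k2 := kap z2) in *.
  assert (ER : Re k1 = Re k2).
  { apply (f_equal Cmod) in E1. rewrite !Cmod_cexp in E1. apply exp_inv in E1.
    unfold Re in *; simpl in E1. apply Rmult_eq_reg_l with al; lra. }
  assert (E3 : cexp (RtoC al * k1 - RtoC al * k2)%C = RtoC 1).
  { unfold Cminus. rewrite cexp_plus, cexp_opp, <- E1. field. apply cexp_neq_0. }
  unfold cexp in E3. replace (Re (RtoC al * k1 - RtoC al * k2)%C) with (al * (Re k1 - Re k2)) in E3
    by (unfold Re; simpl; ring).
  replace (Im (RtoC al * k1 - RtoC al * k2)%C) with (al * (Im k1 - Im k2)) in E3
    by (unfold Im; simpl; ring).
  rewrite ER, Rminus_diag, Rmult_0_r, exp_0, Cmult_1_l in E3.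
  destruct (cis_eq_1 _ E3) as [j Hj].
  assert (B : - (2 * PI) < al * (Im k1 - Im k2) < 2 * PI) by (split; nra).
  assert (j = 0%Z).
  { assert (IZR j < IZR 1) by nra. assert (IZR (-1) < IZR j) by nra.
    apply lt_IZR in H, H0. lia. }
  subst j. assert (EI : Im k1 = Im k2) by nra.
  assert (Ekk : k1 = k2) by (apply injective_projections; auto).
  assert (N : forall z, unit_disc z -> (1 - z)%C <> RtoC 0).
  { intros z Hz A. unfold unit_disc in Hz. replace z with (1 - (1 - z))%C in Hz by ring.
    rewrite A in Hz. replace (1 - 0)%C with (RtoC 1) in Hz by ring. rewrite Cmod_1 in Hz. lra. }
  pose proof (Ek z1 H1) as F1. pose proof (Ek z2 H2) as F2. fold k1 in F1. fold k2 in F2.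
  rewrite Ekk, F2 in F1.
  assert (X : ((1 + z2) * (1 - z1))%C = ((1 + z1) * (1 - z2))%C).
  { replace (1 + z2)%C with ((1 + z2) / (1 - z2) * (1 - z2))%C by (field; auto).
    rewrite F1. field. auto. }
  assert (Y : (RtoC 2 * (z1 - z2))%C = RtoC 0).
  { transitivity ((1 + z1) * (1 - z2) - (1 + z2) * (1 - z1))%C; [ring|rewrite X; ring]. }
  apply Cmult_zero in Y. destruct Y as [Y|Y]; [exfalso; revert Y; apply RtoC_neq_0; lra|].
  replace z1 with (z1 - z2 + z2)%C by ring. rewrite Y. ring.
Qed.

(** Near 1 the modulus of (1 + z) / (1 - z) exceeds [B] >= 2, and al >= 1 makes its power at least
    as large; [B] is chosen to absorb the affine normalisation. *)
Lemma f_alpha_infinite_at_1 : infinite_at_1 (f_alpha al).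
Proof.
  destruct half_plane_log as (kap & HS & Ek & _). intros P [M HM].
  set (B := Rmax M 0 * (2 * al) + 2).
  assert (HB : 2 <= B /\ M * (2 * al) + 2 <= B).
  { unfold B. pose proof (Rmax_l M 0). pose proof (Rmax_r M 0). split; nra. }
  unfold filtermap, within. apply locally_Cmod. exists (1 / (B + 1)).
  split; [apply Rdiv_lt_0_compat; lra|]. intros z Hz Dz. apply HM.
  pose proof (scaled_f_alpha kap z HS Ek Dz) as E.
  set (e := Cmod (z - 1)%C) in *.
  assert (N : (1 - z)%C <> RtoC 0).
  { intros A. unfold unit_disc in Dz. replace z with (1 - (1 - z))%C in Dz by ring.
    rewrite A in Dz. replace (1 - 0)%C with (RtoC 1) in Dz by ring. rewrite Cmod_1 in Dz. lra. }
  assert (Ee : Cmod (1 - z)%C = e).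
  { unfold e. rewrite <- Cmod_opp. f_equal. ring. }
  assert (Pe : 0 < e) by (rewrite <- Ee; apply Cmod_gt_0; auto).
  assert (Big : B < exp (Re (kap z))).
  { rewrite <- Cmod_cexp, Ek, Cmod_div, Ee by auto.
    pose proof (Cmod_triangle (1 + z) (1 - z)) as T.
    replace (1 + z + (1 - z))%C with (RtoC 2) in T by ring.
    rewrite Cmod_R, Rabs_pos_eq, Ee in T by lra.
    apply Rmult_lt_compat_r with (r := B + 1) in Hz; [|lra].
    unfold Rdiv in Hz. rewrite Rmult_1_l, Rinv_l in Hz by lra.
    apply Rmult_lt_reg_r with e; auto. unfold Rdiv. rewrite Rmult_assoc, Rinv_l; nra. }
  assert (Big2 : B < Cmod (scaled (f_alpha al z))).
  { rewrite E, Cmod_cexp. eapply Rlt_le_trans; [exact Big|].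
    replace (Re (RtoC al * kap z)%C) with (al * Re (kap z)) by (unfold Re; simpl; ring).
    assert (0 < Re (kap z)) by (apply exp_lt_inv; rewrite exp_0; lra).
    destruct (Req_dec al 1) as [->|Na]; [rewrite Rmult_1_l; lra|].
    left. apply exp_increasing. nra. }
  unfold scaled in Big2. pose proof (Cmod_triangle (RtoC (2 * al) * f_alpha al z) 1) as T.
  rewrite Cmod_1, Cmod_mult, Cmod_R, Rabs_pos_eq in T by lra.
  apply Rmult_lt_reg_l with (2 * al); lra.
Qed.

Lemma f_alpha_C0hat : C0hat al (f_alpha al).
Proof.
  pose proof PI_RGT_0 as PP. destruct half_plane_log as (kap & HS & Ek & _).
  split; [|split; [exact f_alpha_injective|split; [exact f_alpha_infinite_at_1|split]]].
  - apply holo_analytic. apply holo_ext with (fun z => RtoC (1 / (2 * al)) * (epow al kap z - 1))%C.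
    + intros z Hz. symmetry. apply f_alpha_epow; auto.
    + apply holo_cmul, holo_minus; [apply holo_epow, HS|apply holo_const].
  - intros p q t Hp Hq Ht. rewrite compl_f_alpha in *. intros ph Hph.
    specialize (Hp ph Hph). specialize (Hq ph Hph). rewrite Re_scaled_convex. nra.
  - unfold opening_angle_at_infinity, cone_angle.
    match goal with |- 2 * PI - real (Lub_Rbar ?X) <= _ => set (E := X) end.
    destruct (Lub_Rbar_correct E) as [Ub Lb].
    assert (In : E (2 * PI - al * PI)).
    (* The complement is a translate of the closed sector of directions from al PI / 2 to 2 PI - al
       PI / 2, hence invariant under them. *)
    { split; [nra|]. exists (al * (PI / 2)). intros th Hth p t Hp Ht.
      change (cos th, sin th) with (cis th).
      rewrite compl_f_alpha in *. intros ph Hph. specialize (Hp ph Hph). rewrite Re_scaled_ray.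
      apply Rabs_le_between in Hph.
      assert (cos (th - ph) <= 0) by (apply cos_le_0; lra).
      assert (0 <= 2 * al * t) by nra. nra. }
    specialize (Ub _ In). specialize (Lb (Finite (2 * PI))).
    assert (U2 : is_ub_Rbar E (Finite (2 * PI))) by (intros x [Hx _]; simpl; lra).
    specialize (Lb U2). destruct (Lub_Rbar E) as [l| |]; simpl in *; try contradiction. lra.
Qed.

(** The apex - 1 / (2 al) of the omitted sector is a boundary point at distance 1 / (2 al) from
    f_alpha(0) = 0. *)
Lemma bohr_rhs_f_alpha : bohr_rhs (f_alpha al) <= 1 / (2 * al).
Proof.
  pose proof PI_RGT_0 as PP. unfold bohr_rhs.
  assert (F0 : f_alpha al (RtoC 0) = RtoC 0) by (rewrite f_alpha_real, phi_0 by lra; reflexivity).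
  rewrite F0, Cmod_0, Rplus_0_l. set (q := RtoC (- (1 / (2 * al)))).
  assert (Sq : scaled q = RtoC 0).
  { unfold scaled, q. rewrite <- RtoC_mult, <- RtoC_plus. f_equal. field. lra. }
  assert (Nq : compl (image_disc (f_alpha al)) q).
  { rewrite compl_f_alpha. intros ph _. rewrite Sq, Cmult_0_l. simpl. lra. }
  assert (Bq : boundary (image_disc (f_alpha al)) q).
  { split; intros A; apply locally_Cmod in A; destruct A as (d & Hd & A).
    - apply Nq, A. replace (q - q)%C with (RtoC 0) by ring. rewrite Cmod_0. lra.
    - set (k := RtoC (ln (d * al) / al)).
      assert (Pda : 0 < d * al) by (apply Rmult_lt_0_compat; lra).
      assert (Eq : (RtoC (1 / (2 * al)) * (cexp (RtoC al * k) - 1))%C = RtoC (d / 2 - 1 / (2 * al))).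
      { unfold cexp, k. rewrite <- RtoC_mult. simpl Re. simpl Im.
        replace (al * (ln (d * al) / al)) with (ln (d * al)) by (field; lra).
        rewrite exp_ln, cis_0, Cmult_1_r, <- RtoC_minus, <- RtoC_mult by auto. f_equal. field. lra. }
      apply (A (RtoC (d / 2 - 1 / (2 * al)))).
      + unfold q. rewrite <- RtoC_minus, Cmod_R, Rabs_pos_eq; lra.
      + rewrite <- Eq. apply image_f_alpha_log. unfold k. simpl. lra. }
  unfold dist_to_set. match goal with |- real (Glb_Rbar ?Y) <= _ => set (E := Y) end.
  destruct (Glb_Rbar_correct E) as [Lb Gr].
  assert (Ec : E (1 / (2 * al))).
  { exists q. split; auto. unfold q. rewrite <- RtoC_minus, Cmod_R, Rabs_pos_eq; [ring|].
    assert (0 < 1 / (2 * al)) by (apply Rdiv_lt_0_compat; lra). lra. }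
  specialize (Lb _ Ec). specialize (Gr (Finite 0)).
  assert (L0 : is_lb_Rbar E (Finite 0)) by (intros d (p & _ & ->); apply Cmod_ge_0).
  specialize (Gr L0). destruct (Glb_Rbar E) as [l| |]; simpl in *; try contradiction. exact Lb.
Qed.

End Extremal.

(** * The Bohr inequality and its sharpness *)

(** The factors are products of k consecutive integers; for reading off zero coefficients it
    suffices that they do not vanish. *)
Lemma taylor_C_derive_n a w k : taylor_on_disc a w -> exists c : nat -> R,
  (forall n, c n <> 0) /\ taylor_on_disc (fun n => RtoC (c n) * a (n + k)%nat)%C (C_derive_n w k).
Proof.
  intros Ta. induction k as [|k (c & Hc & IH)].
  - exists (fun _ => 1). split; [intros; lra|].
    refine (taylor_ext _ _ _ _ _ (fun z _ => eq_refl) Ta).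
    intros n. rewrite Nat.add_0_r. simpl. ring.
  - exists (fun n => INR (S n) * c (S n)). split.
    + intros n. apply Rmult_integral_contrapositive. split; auto. apply not_0_INR. lia.
    + refine (taylor_ext _ _ _ _ _ (fun z _ => eq_refl) (taylor_C_derive _ _ IH)).
      intros n. cbv beta. rewrite RtoC_mult. replace (S n + k)%nat with (n + S k)%nat by lia. ring.
Qed.

Lemma C_derive_n_0 a w k : taylor_on_disc a w -> C_derive_n w k (RtoC 0) = RtoC 0 <-> a k = RtoC 0.
Proof.
  intros Ta. destruct (taylor_C_derive_n a w k Ta) as (c & Hc & T).
  rewrite <- (taylor_0 _ _ T). simpl. split; intros E.
  - apply Cmult_zero in E. destruct E as [E|E]; auto. exfalso. revert E. apply RtoC_neq_0, Hc.
  - rewrite E. ring.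
Qed.

Lemma taylor_monomial m : taylor_on_disc (fun n => if Nat.eq_dec n m then RtoC 1 else RtoC 0) (fun z => z ^ m)%C.
Proof.
  induction m.
  - refine (taylor_ext _ _ _ _ _ (fun z _ => eq_refl) (taylor_const (RtoC 1))). intros [|n]; reflexivity.
  - refine (taylor_ext _ _ _ _ _ _ (taylor_zmul _ _ IHm)).
    + intros [|n]; [reflexivity|]. destruct (Nat.eq_dec n m), (Nat.eq_dec (S n) (S m)); auto; lia.
    + intros z _. now rewrite Cpow_S.
Qed.

Lemma monomial_class_Bm m : class_Bm m (fun z => z ^ m)%C.
Proof.
  pose proof (taylor_monomial m) as T. split; [split|split].
  - apply holo_analytic, holo_pow, holo_id.
  - intros z Hz. unfold unit_disc in Hz. rewrite Cmod_pow. rewrite <- (pow1 m). apply pow_incr.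
    pose proof (Cmod_ge_0 z). lra.
  - intros k Hk. apply (proj2 (C_derive_n_0 _ _ k T)). destruct (Nat.eq_dec k m); [lia|auto].
  - intros E. apply (proj1 (C_derive_n_0 _ _ m T)) in E. destruct (Nat.eq_dec m m); [|lia].
    apply RtoC_inj in E. lra.
Qed.

Section Assembly.

Variables (al : R) (A : nat -> R) (m0 N : nat).
Hypothesis Hal : 1 <= al <= 2.
Hypothesis HA : taylor_on_disc (fun n => RtoC (A n)) (f_alpha al).
Hypothesis Hm0 : (1 <= m0)%nat.
Hypothesis HN : (1 <= N)%nat.

Lemma majorant_coef n : (1 <= n)%nat -> extremal_coef al n = 2 * al * A n.
Proof. intros Hn. rewrite (proj2 (f_alpha_coef al A Hal HA) n Hn). field. lra. Qed.

(** The constant term g(0) = f(0) is kept apart, and the other coefficients are at most 2 al |f(0) -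
    p| A n; at x this majorant sums to [phi]. *)
Lemma subordinate_growth f g b p y x : C0hat al f -> subordinate g f -> taylor_on_disc b g ->
  ~ image_disc f p -> unit_disc y -> Cmod y <= x < 1 ->
  Cmod (g y) <= Cmod (f (RtoC 0)) + Cmod (f (RtoC 0) - p)%C * (2 * al * phi al x).
Proof.
  intros HC HS Tb Np Dy Hy. set (D := Cmod (f (RtoC 0) - p)%C).
  assert (PD : 0 <= D) by apply Cmod_ge_0. pose proof (Cmod_ge_0 y) as Py.
  pose proof (fun n => f_alpha_coef_nonneg al A n Hal HA) as PA.
  assert (b0 : b O = f (RtoC 0)).
  { rewrite (taylor_0 _ _ Tb). destruct HS as (w & _ & W0 & Eg). rewrite Eg, W0 by apply unit_disc_0. auto. }
  replace (g y) with (g y - 0)%C by ring.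
  apply (clim_le (psum b y) (g y) (RtoC 0) _ 1%nat); [exact (proj1 (taylor_clim _ _) Tb y Dy)|].
  intros [|n] Hn; [lia|]. replace (psum b y (S n) - 0)%C with (psum b y (S n)) by ring.
  eapply Rle_trans; [apply Cmod_csum|].
  apply Rle_trans with (Cmod (f (RtoC 0)) + D * (2 * al) * sum_f_R0 (fun k => A k * x ^ k) n).
  - clear Hn. induction n.
    + simpl. rewrite b0, Cmult_1_r. rewrite Rmult_1_r.
      assert (0 <= D * (2 * al) * A O) by (repeat apply Rmult_le_pos; auto; lra). lra.
    + rewrite !tech5. rewrite Cmod_mult, Cmod_pow.
      pose proof (concave_coef_bound al f g b p Hal HC HS Tb Np (S n) ltac:(lia)) as B.
      rewrite majorant_coef in B by lia. fold D in B.
      assert (Cmod (b (S n)) * Cmod y ^ S n <= D * (2 * al * A (S n)) * x ^ S n).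
      { apply Rmult_le_compat; auto; [apply Cmod_ge_0|apply pow_le; auto|apply pow_incr; lra]. }
      lra.
  - assert (sum_f_R0 (fun k => A k * x ^ k) n <= phi al x).
    { apply sum_incr; [apply phi_partial_sums; auto; lra|].
      intros k. apply Rmult_le_pos; auto. apply pow_le; lra. }
    assert (0 <= D * (2 * al)) by (apply Rmult_le_pos; lra). nra.
Qed.

(** For each omitted p the excess over |f(0)| is at most |f(0) - p| times 2 al (tail + phi (r^m0)),
    a factor at most 1 to the left of the root. The infimum over p gives the distance. *)
Lemma bohr_inequality f g b w0 z rho : 0 < rho < 1 -> Freal al A m0 N rho = 0 ->
  C0hat al f -> subordinate g f -> taylor_on_disc b g -> class_Bm m0 w0 -> Cmod z < rho ->
  ex_series (tail_terms (fun n => Cmod (b n)) N (Cmod z)) /\ bohr_lhs g b w0 N z <= bohr_rhs f.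
Proof.
  intros Hr Er HC HS Tb HB Hz. set (r := Cmod z) in *.
  assert (Pr : 0 <= r) by apply Cmod_ge_0.
  assert (Dz : unit_disc z) by (unfold unit_disc; fold r; lra).
  assert (U : univalent f) by (destruct HC as (Hf & Inj & _); split; auto; apply holo_analytic, Hf).
  pose proof (tail_ex al A N Hal HA r ltac:(lra)) as ExA.
  assert (Cmp : forall p, ~ image_disc f p -> forall n,
    0 <= tail_terms (fun n => Cmod (b n)) N r n <= Cmod (f (RtoC 0) - p)%C * (2 * al) * tail_terms A N r n).
  { intros p Np n. unfold tail_terms. assert (0 <= r ^ (N + n)) by (apply pow_le; auto).
    pose proof (concave_coef_bound al f g b p Hal HC HS Tb Np (N + n) ltac:(lia)) as B.
    rewrite majorant_coef in B by lia. pose proof (Cmod_ge_0 (b (N + n)%nat)). nra. }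
  split.
  { destruct (univalent_not_onto f U) as [p Np].
    apply (ex_series_le (V := R_CompleteNormedModule) _
      (fun n => Cmod (f (RtoC 0) - p)%C * (2 * al) * tail_terms A N r n)).
    - intros n. destruct (Cmp p Np n). unfold norm; simpl. unfold abs; simpl. rewrite Rabs_pos_eq; auto.
    - apply (ex_series_scal (V := R_NormedModule)). exact ExA. }
  unfold bohr_lhs, bohr_rhs. fold r.
  assert (Schwarz : Cmod (w0 z) <= r ^ m0).
  { destruct HB as ([Hw Bw] & Hd & _). apply holo_analytic in Hw.
    destruct (taylor_exists w0 Hw) as [a Ta]. apply (schwarz a w0 m0); auto.
    intros k Hk. apply (C_derive_n_0 a w0 k Ta). auto. }
  pose proof (pow_le_base r m0 Hm0 ltac:(lra)) as Px.
  set (S := Series (tail_terms (fun n => Cmod (b n)) N r)).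
  set (X := Cmod (g (w0 z)) + S - Cmod (f (RtoC 0))).
  assert (HX : X <= dist_to_set (f (RtoC 0)) (boundary (image_disc f))); [|unfold X in HX; lra].
  apply dist_boundary_ge; auto. intros p Np.
  set (D := Cmod (f (RtoC 0) - p)%C). assert (PD : 0 <= D) by apply Cmod_ge_0.
  assert (HS1 : S <= D * (2 * al) * Series (tail_terms A N r)).
  { unfold S. rewrite <- Series_scal_l. apply Series_le; [apply (Cmp p Np)|].
    apply (ex_series_scal (V := R_NormedModule)). exact ExA. }
  assert (HG : Cmod (g (w0 z)) <= Cmod (f (RtoC 0)) + D * (2 * al * phi al (r ^ m0))).
  { apply (subordinate_growth f g b p); auto; [unfold unit_disc|]; lra. }
  assert (HF : Freal al A m0 N r < 0).
  { rewrite <- Er. apply Freal_increasing; auto; lra. }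
  unfold Freal in HF.
  assert (Q : 2 * al * (Series (tail_terms A N r) + phi al (r ^ m0)) <= 1).
  { apply Rmult_le_reg_l with (/ (2 * al)); [apply Rinv_0_lt_compat; lra|].
    rewrite <- Rmult_assoc, Rinv_l by lra. unfold Rdiv in HF. lra. }
  unfold X. nra.
Qed.

(** Take [f_alpha] as subordinate to itself, the monomial z^m0 and a real point between the root and
    min (rho', 1). All quantities are then nonnegative reals and the left-hand side is [Freal] + 1 /
    (2 al). *)
Lemma bohr_sharp rho rho' : 0 < rho < 1 -> Freal al A m0 N rho = 0 -> rho < rho' ->
  exists (g : C -> C) (b : nat -> C) (w0 : C -> C) (z : C),
    subordinate g (f_alpha al) /\ taylor_on_disc b g /\ class_Bm m0 w0 /\
    unit_disc z /\ Cmod z < rho' /\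
    ex_series (tail_terms (fun n => Cmod (b n)) N (Cmod z)) /\
    bohr_rhs (f_alpha al) < bohr_lhs g b w0 N z.
Proof.
  intros Hr Er Hrr. set (x := (rho + Rmin rho' 1) / 2).
  assert (Rmin rho' 1 <= rho') by apply Rmin_l. assert (Rmin rho' 1 <= 1) by apply Rmin_r.
  assert (rho < Rmin rho' 1) by (apply Rmin_glb_lt; lra).
  assert (Hx : rho < x < 1 /\ x < rho') by (unfold x; lra).
  assert (Mx : Cmod (RtoC x) = x) by (rewrite Cmod_R, Rabs_pos_eq; lra).
  pose proof (pow_le_base x m0 Hm0 ltac:(lra)) as Px.
  assert (Et : forall n, tail_terms A N x n = tail_terms (fun n => Cmod (RtoC (A n))) N x n).
  { intros n. unfold tail_terms. rewrite Cmod_R, Rabs_pos_eq; auto. eapply f_alpha_coef_nonneg; eauto. }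
  exists (f_alpha al), (fun n => RtoC (A n)), (fun z => z ^ m0)%C, (RtoC x).
  unfold unit_disc, bohr_lhs. rewrite !Mx.
  split; [|split; [exact HA|split; [apply monomial_class_Bm|split; [lra|split; [lra|split]]]]].
  - exists (fun z => z). split; [split|].
    + apply holo_analytic, holo_id.
    + intros z Hz. left. exact Hz.
    + auto.
  - apply (ex_series_ext (V := R_NormedModule) _ _ Et). eapply tail_ex; eauto. lra.
  - eapply Rle_lt_trans; [apply bohr_rhs_f_alpha, Hal|].
    rewrite <- (Series_ext _ _ Et), <- RtoC_pow, f_alpha_real by lra.
    rewrite Cmod_R. pose proof (Rle_abs (phi al (x ^ m0))).
    assert (HF : 0 < Freal al A m0 N x) by (rewrite <- Er; apply Freal_increasing; auto; lra).
    unfold Freal in HF. lra.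
Qed.

End Assembly.

Theorem theorem3p2 (alpha : R) (A : nat -> R) (m0 N : nat)
    (Halpha : 1 <= alpha <= 2)
    (HA : taylor_on_disc (fun n => RtoC (A n)) (f_alpha alpha))
    (Hm0 : (1 <= m0)%nat) (HN : (1 <= N)%nat) :
  exists rho : R,
    unique (fun x : R => 0 < x < 1 /\ F alpha A m0 N x = RtoC 0) rho /\
    (forall (f g : C -> C) (a b : nat -> C) (w0 : C -> C),
        C0hat alpha f -> subordinate g f ->
        taylor_on_disc a f -> taylor_on_disc b g ->
        class_Bm m0 w0 ->
        forall z : C, Cmod z < Rmin rho (1 / 3) ->
          ex_series (tail_terms (fun n => Cmod (b n)) N (Cmod z)) /\
          bohr_lhs g b w0 N z <= bohr_rhs f) /\
    (rho <= 1 / 3 ->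
      C0hat alpha (f_alpha alpha) /\
      forall rho' : R, rho < rho' ->
        exists (g : C -> C) (b : nat -> C) (w0 : C -> C) (z : C),
          subordinate g (f_alpha alpha) /\ taylor_on_disc b g /\
          class_Bm m0 w0 /\
          unit_disc z /\ Cmod z < rho' /\
          ex_series (tail_terms (fun n => Cmod (b n)) N (Cmod z)) /\
          bohr_rhs (f_alpha alpha) < bohr_lhs g b w0 N z).
Proof.
  destruct (Freal_root alpha A m0 N Halpha HA Hm0 HN) as (rho & Hr & Er).
  assert (EF : forall x, 0 < x < 1 -> F alpha A m0 N x = RtoC (Freal alpha A m0 N x))
    by (intros x Hx; apply F_Freal; auto; lra).
  exists rho. split; [|split].
  - split.
    + split; auto. rewrite EF, Er by auto. reflexivity.
    + intros x [Hx Ex]. rewrite EF in Ex by auto. apply RtoC_inj in Ex.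
      destruct (Rtotal_order rho x) as [Hl|[Hl|Hl]]; auto; exfalso.
      * pose proof (Freal_increasing alpha A m0 N Halpha HA Hm0 rho x). lra.
      * pose proof (Freal_increasing alpha A m0 N Halpha HA Hm0 x rho). lra.
  - intros f g a b w0 HC HS _ Tb HB z Hz.
    apply (bohr_inequality alpha A m0 N Halpha HA Hm0 HN f g b w0 z rho); auto.
    eapply Rlt_le_trans; [exact Hz|apply Rmin_l].
  - intros _. split; [apply f_alpha_C0hat; auto|].
    intros rho' Hrr. apply (bohr_sharp alpha A m0 N Halpha HA Hm0 rho rho' Hr Er Hrr).
Qed.
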